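(* Let $V=(V_0,\dots,V_{b-1})$ be a random vector with $V_j\ge0$ and $\mathbb E(V_j)=1$ for all $j\in\Lambda$ (the coordinates not being assumed independent). Let $\{(X_{uj})_{j\in\Lambda}:u\in\Lambda^*\}$ be i.i.d. random vectors with the law of $V$, and let $Q$ be the associated multiplicative cascade. Let $\nu$ be a $\sigma$-ergodic Borel probability measure on $\Sigma$, and put $$h_{V,\nu}=\sum_{j\in\Lambda}\mathbb E(V_j\log V_j)\,\nu([j]).$$ (i) If $h_{V,\nu}<h_\nu(\sigma)$, then $\mathbb E(Z)=1$, i.e. $\nu$ is $Q$-regular. (ii) If $h_{V,\nu}>h_\nu(\sigma)$, then $\mathbb E(Z)=0$, i.e. $\nu$ is $Q$-singular.
   Context: Let $b\ge2$ be an integer, $\Lambda=\{0,\dots,b-1\}$, $\Lambda^*=\bigcup_{n\ge0}\Lambda^n$ the finite words, and $\Sigma=\Lambda^{\mathbb N}$ the space of sequences $x=x_1x_2\cdots$ with the product topology and Borel $\sigma$-field; $\sigma$ is the left shift on $\Sigma$, and ''$\sigma$-ergodic'' means $\sigma$-invariant and ergodic. Write $x|_n=x_1\cdots x_n$, and let $[u]$ be the cylinder of sequences with prefix $u$. Conventions: $0\log0=0$ and $\infty\cdot0=0$. For $n\ge1$ put $Q_n(\omega,x)=\prod_{k=1}^nX_{x|_k}(\omega)$. The measures $Q_n(\omega,\cdot)\,\nu$ almost surely converge weakly to a random measure $Q\cdot\nu$, whose total mass is almost surely $Z=\limsup_{n\to\infty}Z_n$, where $Z_n=\int_\Sigma Q_n(\cdot,x)\,\nu(\mathrm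 dx)$. The measure $\nu$ is $Q$-regular if $\mathbb E(Z)=1$, and $Q$-singular if $Q\cdot\nu=0$ almost surely. The entropy is $h_\nu(\sigma)=\lim_{n\to\infty}\frac1n\sum_{u\in\Lambda^n}-\nu([u])\log\nu([u])$. *)

(* Defs.v *)
From HB Require Import structures.
From mathcomp Require Import all_boot all_order all_algebra.
From mathcomp Require Import all_classical all_reals all_analysis.

Set Implicit Arguments.
Unset Strict Implicit.
Unset Printing Implicit Defensive.

Import Order.TTheory GRing.Theory Num.Theory.
Import numFieldNormedType.Exports.

Local Open Scope classical_set_scope.
Local Open Scope ring_scope.
Local Open Scope ereal_scope.

(* Sequences are indexed from 0: the letter x_k (k >= 1) is x (k - 1).
   Measurable types are pointed in the library, hence the dependency on the
   proof that b >= 2. *)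
Definition seq_space (b : nat) (b_ge2 : (2 <= b)%N) : Type :=
  prod_topology (fun _ : nat => discrete_topology 'I_b).

HB.instance Definition _ b (b_ge2 : (2 <= b)%N) :=
  Topological.on (seq_space b_ge2).
HB.instance Definition _ b (b_ge2 : (2 <= b)%N) :=
  isPointed.Build (seq_space b_ge2) (fun=> Ordinal (ltnW b_ge2)).
HB.instance Definition _ b (b_ge2 : (2 <= b)%N) :=
  Measurable.copy (seq_space b_ge2)
    (g_sigma_algebraType (@open (seq_space b_ge2))).

Definition left_shift b (b_ge2 : (2 <= b)%N) (x : seq_space b_ge2) :
    seq_space b_ge2 :=
  fun n => x n.+1.

Definition prefix_word b (b_ge2 : (2 <= b)%N) (x : seq_space b_ge2)
    (n : nat) : seq 'I_b :=
  mkseq x n.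

Definition cylinder b (b_ge2 : (2 <= b)%N) (u : seq 'I_b) :
    set (seq_space b_ge2) :=
  [set x | prefix_word x (size u) = u].

Definition invariant_measure d (T : measurableType d) (R : realType)
    (f : T -> T) (nu : probability T R) : Prop :=
  forall A, measurable A -> nu (f @^-1` A) = nu A.

Definition ergodic d (T : measurableType d) (R : realType)
    (f : T -> T) (nu : probability T R) : Prop :=
  invariant_measure f nu /\
  forall A, measurable A -> f @^-1` A = A -> nu A = 0 \/ nu A = 1.

Definition entropy (R : realType) b (b_ge2 : (2 <= b)%N)
    (nu : probability (seq_space b_ge2) R) : R :=
  limn (fun n => n%:R^-1 *
    \sum_(u : n.-tuple 'I_b)
      - (fine (nu (cylinder u))
         * ln (fine (nu (cylinder u)))))%R.

Definition independent_family d d' (T : measurableType d)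
    (T' : measurableType d') (R : realType) (P : probability T R)
    (I : choiceType) (X : I -> {RV P >-> T'}) : Prop :=
  forall (s : seq I) (B : I -> set T'), uniq s ->
    (forall i, measurable (B i)) ->
    P (\bigcap_(i in [set` s]) X i @^-1` B i)
    = \prod_(i <- s) P (X i @^-1` B i).

Definition iid_copies d d1 d' (T : measurableType d) (T1 : measurableType d1)
    (T' : measurableType d') (R : realType)
    (P : probability T R) (P1 : probability T1 R)
    (I : choiceType) (X : I -> {RV P >-> T'}) (V : {RV P1 >-> T'}) : Prop :=
  independent_family X /\
  forall i (B : set T'), measurable B ->
    distribution P (X i) B = distribution P1 V B.

Section cascade.
Context d (T : measurableType d) (R : realType) (P : probability T R)
  (b : nat) (b_ge2 : (2 <= b)%N).
(* X u is the random vector (X_{uj})_j; X_{uj} is its j-th coordinate. *)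
Variable X : seq 'I_b -> {RV P >-> b.-tuple R}.
Variable nu : probability (seq_space b_ge2) R.

(* x|_(k+1) is the word x|_k followed by the letter x k, so that
   X_{x|_(k+1)} is the coordinate x k of the vector attached to x|_k. *)
Definition cascade_density (n : nat) (w : T) (x : seq_space b_ge2) : R :=
  (\prod_(k < n) tnth (X (prefix_word x k) w) (x k))%R.

Definition cascade_mass (n : nat) (w : T) : \bar R :=
  \int[nu]_x (cascade_density n w x)%:E.

Definition cascade_Z (w : T) : \bar R :=
  limn_esup (fun n => cascade_mass n w).

(* M is the random measure Q.nu: almost surely Q_n(w, .) nu converges weakly
   to M w. The integral of f against Q_n(w, .) nu is that of f * Q_n(w, .)
   against nu; continuous functions on the compact space seq_space are
   bounded. *)
Definition cascade_limit (M : R.-ftker T ~> seq_space b_ge2) : Prop :=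
  {ae P, forall w, forall f : seq_space b_ge2 -> R, continuous f ->
    \int[nu]_x (f x * cascade_density n w x)%:E @[n --> \oo]
      --> \int[M w]_x (f x)%:E}.

Definition Q_regular : Prop := \int[P]_w cascade_Z w = 1.

(* Weak limits being almost surely unique, "exists M" and "for the limit M"
   agree. *)
Definition Q_singular : Prop :=
  exists2 M : R.-ftker T ~> seq_space b_ge2, cascade_limit M &
    {ae P, forall w, forall A, measurable A -> M w A = 0}.

End cascade.

(* Here ln 0 = 0 and +oo * 0 = 0. *)
Definition cascade_entropy d (T : measurableType d) (R : realType)
    (P : probability T R) (b : nat) (b_ge2 : (2 <= b)%N)
    (V : {RV P >-> b.-tuple R})
    (nu : probability (seq_space b_ge2) R) : \bar R :=
  \sum_(j < b)
    'E_P[fun w => (tnth (V w) j * ln (tnth (V w) j))%R] * nu (cylinder [:: j]).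

(* Main.v *)
(* Work on the space of environments with the law of X, and write Z_n for the
   total mass of Q_n nu. For a Borel set A, let mu(A) be the mean of the limit of
   the masses of Q_n (nu restricted to A). The measure mu is shift invariant and
   at most nu, so mu = c nu by ergodicity, and c is 0 or 1 by a zero-one
   argument: either nu is Q-regular, or Z_n tends to 0 almost surely. Each
   alternative gives one inequality between the entropies.
   - Regular case. Write Q_u for the product of the weights along u, and draw
     the environment and the word u of length n jointly with density Q_u with
     respect to P x nu. The mean of log (Q_u nu[u]) is then n h_V - H_n(nu), and
     Q_u nu[u] <= Z_n, where Z_n is tight under this law by uniform
     integrability. Hence h_V <= h.
   - Singular case. The mean C_n of Z_n times the entropy of the random
     probability Q_n nu / Z_n is at least H_n(nu) - h_V n. The entropy of a
     decomposition into two masses x and y is at most a constant times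
     sqrt (x y), which makes the increments of C_n at most a constant times the
     mean of sqrt Z_n, and this tends to 0. Hence h <= h_V. *)

Require Import Defs.
From HB Require Import structures.
From mathcomp Require Import all_boot all_order all_algebra.
From mathcomp Require Import all_classical all_reals all_analysis.
From mathcomp Require Import measurable_realfun ring lra.

Import Order.TTheory GRing.Theory Num.Theory.
Import numFieldNormedType.Exports.

Local Open Scope classical_set_scope.
Local Open Scope ring_scope.
Local Open Scope ereal_scope.

Set Implicit Arguments.
Unset Strict Implicit.
Unset Printing Implicit Defensive.

(** * Entropy of finite families *)

(** Only mean entropies are compared, and no pointwise entropy theorem for [nu] enters: by
    stationarity the mean of an additive functional of a word of length [n] is exactly [n] times its
    mean over one letter. No moment of [V] beyond its mean is assumed, and this shapes the two
    cases. In the regular case [E (V_j log V_j)] may a priori be infinite, so the logarithm is cut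
    at [c], and [c] is sent to infinity only after the inequality is known for each [c]. In the
    singular case the entropy created by the first letter is bounded by square roots of products
    over pairs of siblings, for which first moments suffice. The coordinates of [V] may be
    dependent, so [sqrt (V_i V_j)] is replaced by the arithmetic mean, whose expectation is 1. The
    sibling subtrees are independent, so the mean of the product of their square roots factors: one
    factor is at most 1, the other at most the mean of [sqrt Z_n]. The rest of the entropy sits in
    the subtrees and involves [nu] restricted to one first letter and shifted; superadditivity of
    entropy and invariance of [nu] recombine these pieces into [nu] itself. *)

Section entropy_function.
Local Open Scope ring_scope.
Context {R : realType}.

Definition xlnx (z : R) : R := z * ln z.

(** With [S] the sum of the family, this is [S] times the Shannon entropy of the normalised family.
    The homogeneous form avoids dividing by [S]. *)
Definition eta (I : finType) (a : I -> R) : R :=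
  xlnx (\sum_i a i) - \sum_i xlnx (a i).

Lemma ln_le_subr1 (x : R) : 0 < x -> ln x <= x - 1.
Proof.
move=> x0; have := @le_ln1Dx R (x - 1).
by rewrite addrCA subrr addr0; apply; lra.
Qed.

(** This is [ln t <= t - 1] at [t = 1 / z]. It bounds [V log V] below by -1, and in the mean it
    bounds [E (Z_n log Z_n)] below by 0 when [E Z_n = 1]. *)
Lemma xlnx_ge (z : R) : 0 <= z -> z - 1 <= xlnx z.
Proof.
rewrite le_eqVlt => /predU1P[<-|z0].
  by rewrite /xlnx mul0r sub0r lerN10.
have := @ln_le_subr1 z^-1; rewrite invr_gt0 => /(_ z0).
rewrite lnV// => h; rewrite /xlnx.
have : z * (- ln z) <= z * (z^-1 - 1) by rewrite ler_pM2l.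
by rewrite mulrBr divff ?gt_eqF// mulrN mulr1; lra.
Qed.

Lemma xlnxM (x y : R) : 0 <= x -> 0 <= y -> xlnx (x * y) = y * xlnx x + x * xlnx y.
Proof.
rewrite /xlnx le_eqVlt => /predU1P[<-|x0]; first by rewrite !(mul0r, mulr0) addr0.
rewrite le_eqVlt => /predU1P[<-|y0]; first by rewrite !(mul0r, mulr0) addr0.
by rewrite lnM//; ring.
Qed.

Lemma sum_xlnx (I : finType) (a : I -> R) :
  eta a = \sum_i (a i * (ln (\sum_j a j) - ln (a i))).
Proof.
rewrite /eta /xlnx mulr_suml -sumrB; apply: eq_bigr => i _.
by rewrite mulrBr.
Qed.

Lemma ler_sum_term (I : finType) (a : I -> R) i :
  (forall i, 0 <= a i) -> a i <= \sum_j a j.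
Proof. by move=> a0; rewrite (bigD1 i)//= lerDl sumr_ge0. Qed.

Lemma eta_ge0 (I : finType) (a : I -> R) : (forall i, 0 <= a i) -> 0 <= eta a.
Proof.
move=> a0; rewrite sum_xlnx; apply: sumr_ge0 => i _.
have := a0 i; rewrite le_eqVlt => /predU1P[<-|ai0]; first by rewrite mul0r.
apply: mulr_ge0; first exact: ltW.
rewrite subr_ge0 ler_ln ?posrE//; first exact: ler_sum_term.
exact: lt_le_trans ai0 (ler_sum_term _ a0).
Qed.

(* Two-term log-sum inequality, from [ln t <= t - 1] at the ratios of [s] and
   [s'] to the mean ratio. *)
Lemma log_sum_ineq (a a' s s' : R) : 0 <= a -> a <= s -> 0 <= a' -> a' <= s' ->
  a * (ln s - ln a) + a' * (ln s' - ln a') <=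
  (a + a') * (ln (s + s') - ln (a + a')).
Proof.
rewrite le_eqVlt => /predU1P[<- s0|a0 as_].
  rewrite le_eqVlt => /predU1P[<- _|a'0 as']; first by rewrite addr0 !mul0r addr0.
  have s'0 : 0 < s' by exact: lt_le_trans as'.
  rewrite !add0r mul0r add0r ler_pM2l// lerD2r ler_ln ?posrE//.
    by rewrite lerDr.
  by rewrite ltr_wpDl.
have s0 : 0 < s by exact: lt_le_trans as_.
rewrite le_eqVlt => /predU1P[<- s'0|a'0 as'].
  by rewrite mul0r !addr0 ler_pM2l// lerD2r ler_ln ?posrE ?lerDl// ltr_wpDr.
have s'0 : 0 < s' by exact: lt_le_trans as'.
have A0 : 0 < a + a' by rewrite addr_gt0.
have S0 : 0 < s + s' by rewrite addr_gt0.
set r := (a + a') / (s + s').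
have r0 : 0 < r by rewrite divr_gt0.
have key (x y : R) : 0 < x -> 0 < y -> x * (ln y - ln x + ln r) <= y * r - x.
  move=> x0 y0; have yr0 : 0 < y * r by rewrite mulr_gt0.
  have /ln_le_subr1 : 0 < y * r / x by rewrite divr_gt0.
  rewrite ln_div// [ln (y * r)]lnM// => h.
  have : x * (ln y + ln r - ln x) <= x * (y * r / x - 1) by rewrite ler_pM2l.
  by rewrite [x * (_ - 1)]mulrBr mulr1 [x * (_ / _)]mulrC divfK ?gt_eqF// => /(le_trans _); apply; lra.
have lr : ln r = ln (a + a') - ln (s + s') by rewrite ln_div.
have k1 := key _ _ a0 s0; have k2 := key _ _ a'0 s'0.
have : s * r + s' * r = a + a' by rewrite -mulrDl mulrC divfK// gt_eqF.
by move: k1 k2; rewrite lr; lra.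
Qed.

(** Concavity of entropy: for a homogeneous function it amounts to superadditivity, here obtained
    term by term. *)
Lemma eta_superadd (I : finType) (a a' : I -> R) :
  (forall i, 0 <= a i) -> (forall i, 0 <= a' i) ->
  eta a + eta a' <= eta (fun i => a i + a' i).
Proof.
move=> a0 a'0; rewrite !sum_xlnx -big_split/=; apply: ler_sum => i _.
by rewrite big_split/=; apply: log_sum_ineq => //; exact: ler_sum_term.
Qed.

Lemma eta0 (I : finType) : eta (fun _ : I => 0) = 0.
Proof. by rewrite sum_xlnx big1// => i _; rewrite mul0r. Qed.

Lemma eta_superadd_sum (I : finType) (J : Type) (r : seq J) (a : J -> I -> R) :
  (forall j i, 0 <= a j i) ->
  \sum_(j <- r) eta (a j) <= eta (fun i => \sum_(j <- r) a j i).
Proof.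
move=> a0; elim: r => [|j r ih].
  rewrite big_nil (_ : (fun i => _) = fun=> 0) ?eta0//.
  by apply/funext => i; rewrite big_nil.
rewrite big_cons (_ : (fun i => _) = fun i => a j i + \sum_(j <- r) a j i).
  apply: le_trans (eta_superadd _ _) => //; first by rewrite lerD2l.
  by move=> i; exact: sumr_ge0.
by apply/funext => i; rewrite big_cons.
Qed.

Lemma sqrtr_sum_le (I : Type) (r : seq I) (P : pred I) (a : I -> R) :
  (forall i, 0 <= a i) ->
  Num.sqrt (\sum_(i <- r | P i) a i) <= \sum_(i <- r | P i) Num.sqrt (a i).
Proof.
move=> a0; elim/big_rec2 : _ => [|i y x _ yx]; first by rewrite sqrtr0.
(* The recursion principle forgets the sign of the partial sum [x], so a negative [x] is treated
   apart. *)
have [x0|x0] := leP 0 x; last first.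
  apply: (@le_trans _ _ (Num.sqrt (a i))).
    by rewrite ler_wsqrtr// gerDl ltW.
  by rewrite lerDl (le_trans _ yx)// sqrtr_ge0.
apply: le_trans (lerD (lexx _) yx).
rewrite -[leRHS]ger0_norm ?addr_ge0 ?sqrtr_ge0// -sqrtr_sqr ler_wsqrtr//.
by rewrite sqrrD !sqr_sqrtr// lerD2r lerDl mulrn_wge0// mulr_ge0// sqrtr_ge0.
Qed.

(** Let [d] be the sum of the other terms and [t = sqrt (d / a j)]. The [j]-th term is [a j] times
    [ln (1 + t ^ 2) <= 2 ln (1 + t) <= 2 t], hence at most [2 sqrt (d * a j)], and the root of [d]
    splits by subadditivity. *)
Lemma eta_le_sqrt (I : finType) (a : I -> R) : (forall i, 0 <= a i) ->
  eta a <= 2 * \sum_j \sum_(i | i != j) Num.sqrt (a i * a j).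
Proof.
move=> a0; rewrite sum_xlnx mulr_sumr; apply: ler_sum => j _.
have := a0 j; rewrite le_eqVlt => /predU1P[<-|aj0].
  by rewrite mul0r mulr_ge0// sumr_ge0// => i _; exact: sqrtr_ge0.
set S := \sum_j _; pose d := \sum_(i | i != j) a i.
have d0 : 0 <= d by exact: sumr_ge0.
have SE : S = a j + d by rewrite /S (bigD1 j).
have S0 : 0 < S by rewrite SE ltr_wpDr.
suff : a j * (ln S - ln (a j)) <= 2 * Num.sqrt (d * a j).
  move/le_trans; apply; rewrite ler_pM2l// mulr_suml.
  by apply: sqrtr_sum_le => i; rewrite mulr_ge0// ltW.
rewrite -ln_div//.
set t := Num.sqrt (d / a j).
have t0 : 0 <= t by exact: sqrtr_ge0.
have tt : S / a j = 1 + t ^+ 2.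
  by rewrite sqr_sqrtr ?divr_ge0 ?(ltW aj0)// SE mulrDl divff ?gt_eqF.
have : ln (S / a j) <= ln ((1 + t) ^+ 2).
  by rewrite tt ler_ln ?posrE ?exprn_gt0 ?ltr_wpDr ?sqr_ge0//; nra.
rewrite lnXn ?ltr_wpDr// => h.
have h2 : ln (S / a j) <= 2 * t.
  by apply: (le_trans h); rewrite -[ln _ *+ 2]mulr_natl ler_pM2l// le_ln1Dx// (lt_le_trans _ t0).
have -> : Num.sqrt (d * a j) = a j * t.
  rewrite -[X in X * t]ger0_norm ?ltW// -sqrtr_sqr -sqrtrM ?sqr_ge0//.
  congr Num.sqrt; rewrite expr2; field; rewrite ?gt_eqF//.
by rewrite mulrCA ler_pM2l.
Qed.

End entropy_function.

(** * Sums over words of a given length *)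

Section sum_over_words.
Local Open Scope ring_scope.
Context {R : nmodType} {b : nat}.
Implicit Types F : seq 'I_b -> R.

Lemma sum_words0 F : \sum_(v : 0.-tuple 'I_b) F v = F [::].
Proof.
rewrite (bigD1 [tuple])//= big1 ?addr0// => v; rewrite (tuple0 v).
by move=> /negP[]; apply/eqP/val_inj.
Qed.

Lemma sum_words_cons n F :
  \sum_(v : n.+1.-tuple 'I_b) F v = \sum_j \sum_(v : n.-tuple 'I_b) F (j :: v).
Proof.
rewrite pair_big/= (reindex (fun p : 'I_b * n.-tuple 'I_b => cons_tuple p.1 p.2))//=.
exists (fun v : n.+1.-tuple 'I_b => (thead v, behead_tuple v)).
  by move=> [j v] _ /=; congr pair; exact: val_inj.
by move=> v _; rewrite /= [RHS]tuple_eta.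
Qed.

Lemma sum_words_rcons n F :
  \sum_(v : n.+1.-tuple 'I_b) F v = \sum_(v : n.-tuple 'I_b) \sum_j F (rcons v j).
Proof.
elim: n F => [|n ih] F.
  rewrite sum_words_cons (sum_words0 (fun v => \sum_j F (rcons v j))).
  by apply: eq_bigr => j _; rewrite (sum_words0 (fun v => F (j :: v))).
rewrite sum_words_cons (sum_words_cons _ (fun v => \sum_j F (rcons v j))).
by apply: eq_bigr => j _; rewrite (ih (fun v => F (j :: v))).
Qed.

End sum_over_words.

(** * Environments *)

Section environments.
Context {R : realType} {b : nat}.

Definition env : Type := seq 'I_b -> b.-tuple R.

Definition env_coord_sets : set (set env) :=
  [set A | exists v, exists2 B, measurable B & A = (fun f : env => f v) @^-1` B].

(** On this canonical space, passing to a subtree and merging two environments are measurable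
    maps. *)
Definition envT := g_sigma_algebraType env_coord_sets.

Definition env_box (s : seq (seq 'I_b)) (B : seq 'I_b -> set (b.-tuple R)) :
    set env :=
  \bigcap_(v in [set` s]) ((fun f : env => f v) @^-1` B v).

Definition iid_env (Pi : probability envT R) (lam : set (b.-tuple R) -> \bar R) :=
  forall (s : seq (seq 'I_b)) (B : seq 'I_b -> set (b.-tuple R)), uniq s ->
    (forall v, measurable (B v)) -> Pi (env_box s B) = \prod_(v <- s) lam (B v).

Lemma measurable_env_coord v : measurable_fun setT (fun f : envT => f v).
Proof.
by move=> _ B mB; rewrite setTI; apply: sub_sigma_algebra; exists v, B.
Qed.

Lemma measurable_fun_env d (T : measurableType d) (g : T -> envT) :
  (forall v, measurable_fun setT (fun x => g x v)) -> measurable_fun setT g.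
Proof.
move=> mg; apply: (@measurability _ _ T envT setT g env_coord_sets) => //.
move=> _ [_ [v [B mB ->]] <-].
exact: mg.
Qed.

Lemma measurable_env_box s B : (forall v, measurable (B v)) ->
  @measurable _ envT (env_box s B).
Proof.
move=> mB; apply: fin_bigcap_measurable => [|v _]; first exact: finite_seq.
by rewrite -[X in measurable X]setTI; exact: (measurable_env_coord v).
Qed.

Definition env_boxes : set (set env) :=
  [set A | exists s, exists2 B, uniq s /\ (forall v, measurable (B v)) &
           A = env_box s B].

Lemma env_boxes_setI : setI_closed env_boxes.
Proof.
move=> _ _ [s [B [us mB] ->]] [t [C [ut mC] ->]].
(* Each box is padded with [setT] outside its own list of words. *)
pose D v := (if v \in s then B v else setT) `&` (if v \in t then C v else setT).
exists (undup (s ++ t)), D; first split; first exact: undup_uniq.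
  by move=> v; apply: measurableI; case: ifPn.
apply/seteqP; split => [f [fs ft] v /=|f fst].
  by rewrite mem_undup mem_cat => _; split; case: ifPn => // h; [exact: fs|exact: ft].
split=> v /= vs.
  have [] : D v (f v) by apply: fst; rewrite /= mem_undup mem_cat vs.
  by rewrite vs.
have [_] : D v (f v) by apply: fst; rewrite /= mem_undup mem_cat vs orbT.
by rewrite vs.
Qed.

Lemma sigma_env_boxes : @measurable _ envT = <<s env_boxes >>.
Proof.
apply/seteqP; split.
  apply: smallest_sub; first exact: smallest_sigma_algebra.
  move=> _ [v [B mB ->]]; apply: sub_sigma_algebra.
  exists [:: v], (fun=> B) => //; apply/seteqP; split=> [f fB u /=|f /(_ v)].
    by rewrite inE => /eqP ->.
  by apply; rewrite /= inE.
apply: smallest_sub; first exact: sigma_algebra_measurable.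
by move=> _ [s [B [_ mB] ->]]; exact: measurable_env_box.
Qed.

(** Boxes form a generating pi-system that contains the whole space. *)
Lemma env_measure_unique (m1 m2 : {measure set envT -> \bar R}) :
  m1 setT < +oo ->
  (forall s B, uniq s -> (forall v, measurable (B v)) ->
    m1 (env_box s B) = m2 (env_box s B)) ->
  forall A, measurable A -> m1 A = m2 A.
Proof.
move=> m1oo m12 A mA.
apply: (@measure_unique _ _ envT env_boxes (fun=> setT)) => //.
- exact: sigma_env_boxes.
- exact: env_boxes_setI.
- move=> _; exists [::], (fun=> setT) => //.
  by apply/seteqP; split => // f _ v /=; rewrite inE.
- by rewrite bigcup_const//; exists 0%N.
- by move=> _ [s [B [us mB] ->]]; exact: m12.
Qed.

Definition subenv (u : seq 'I_b) (f : env) : env := fun v => f (u ++ v).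

(** Merging two independent environments along a set [S] of words preserves the i.i.d. law.
    Independence of what lives on [S] from what lives off [S] thereby becomes an instance of
    Fubini. *)
Definition glue (S : pred (seq 'I_b)) (f g : env) : env :=
  fun v => if S v then f v else g v.

Lemma measurable_subenv u : @measurable_fun _ _ envT envT setT (subenv u).
Proof. by apply: measurable_fun_env => v; exact: measurable_env_coord. Qed.

Lemma measurable_glue S :
  @measurable_fun _ _ (envT * envT)%type envT setT (fun p => glue S p.1 p.2).
Proof.
apply: measurable_fun_env => v; rewrite /glue; case: (S v).
  exact: (measurableT_comp (measurable_env_coord v) measurable_fst).
exact: (measurableT_comp (measurable_env_coord v) measurable_snd).
Qed.

Section iid.
Variables (Pi : probability envT R) (lam : set (b.-tuple R) -> \bar R).
Hypothesis Pi_iid : iid_env Pi lam.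

(** Applied to [subenv u] and to [glue S] on pairs, for which only box probabilities then have to be
    computed. *)
Lemma iid_env_transfer d (T : measurableType d) (mu : {measure set T -> \bar R})
    (g : T -> envT) : measurable_fun setT g ->
  (forall s B, uniq s -> (forall v, measurable (B v)) ->
    mu (g @^-1` env_box s B) = \prod_(v <- s) lam (B v)) ->
  forall A, measurable A -> mu (g @^-1` A) = Pi A.
Proof.
move=> mg mug A mA.
pose G : {mfun T >-> envT} := HB.pack g (isMeasurableFun.Build _ _ _ _ g mg).
apply/esym/(@env_measure_unique Pi (pushforward mu G)) => // [|s B us mB].
  by rewrite (le_lt_trans (probability_le1 _ _))// ltry.
by apply: etrans (esym (mug _ _ us mB)); exact: Pi_iid.
Qed.

Lemma ge0_integral_iid_env_transfer d (T : measurableType d)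
    (mu : {measure set T -> \bar R}) (g : T -> envT) : measurable_fun setT g ->
  (forall s B, uniq s -> (forall v, measurable (B v)) ->
    mu (g @^-1` env_box s B) = \prod_(v <- s) lam (B v)) ->
  forall F : envT -> \bar R, measurable_fun [set: envT] F -> (forall f, 0 <= F f) ->
  \int[Pi]_f F f = \int[mu]_x F (g x).
Proof.
move=> mg mug F mF F0.
rewrite -(@ge0_integral_pushforward _ _ T envT R g mg mu setT F)//.
by apply: eq_measure_integral => A mA _; exact/esym/(iid_env_transfer mg mug).
Qed.

Lemma subenv_box u s B : uniq s -> (forall v, measurable (B v)) ->
  Pi (subenv u @^-1` env_box s B) = \prod_(v <- s) lam (B v).
Proof.
move=> us mB; rewrite (_ : _ @^-1` _ =
    env_box (map (cat u) s) (fun w => B (drop (size u) w))).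
  rewrite Pi_iid ?map_inj_uniq//; last by move=> x y /eqP; rewrite eqseq_cat// eqxx => /eqP.
  by rewrite big_map; apply: eq_bigr => v _; rewrite drop_size_cat.
apply/seteqP; split => [f fs _ /mapP[v vs ->]/=|f fs v vs /=].
  by rewrite drop_size_cat//; exact: fs.
have : B (drop (size u) (u ++ v)) (f (u ++ v)) by apply: fs; exact: map_f.
by rewrite drop_size_cat.
Qed.

Lemma subenv_law u (A : set envT) : measurable A -> Pi (subenv u @^-1` A) = Pi A.
Proof. by apply: iid_env_transfer; [exact: measurable_subenv|exact: subenv_box]. Qed.

Lemma ge0_integral_subenv u (F : envT -> \bar R) : measurable_fun [set: envT] F ->
  (forall f, 0 <= F f) -> \int[Pi]_f F (subenv u f) = \int[Pi]_f F f.
Proof.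
move=> mF F0; apply/esym; apply: ge0_integral_iid_env_transfer => //.
  exact: measurable_subenv.
exact: subenv_box.
Qed.

Lemma glue_box S s B : uniq s -> (forall v, measurable (B v)) ->
  (Pi \x Pi) ((fun p => glue S p.1 p.2) @^-1` env_box s B) =
  \prod_(v <- s) lam (B v).
Proof.
move=> us mB; rewrite (_ : _ @^-1` _ =
    env_box [seq v <- s | S v] B `*` env_box [seq v <- s | ~~ S v] B).
  transitivity (Pi (env_box [seq v <- s | S v] B) *
                Pi (env_box [seq v <- s | ~~ S v] B)).
    by apply: product_measure1E; exact: measurable_env_box.
  by rewrite !Pi_iid ?filter_uniq// !big_filter [RHS](bigID S).
apply/seteqP; split=> [[f g] h|[f g] [/= fs gs] v /= vs].
  by split => v /=; rewrite mem_filter => /andP[Sv /h]/=; rewrite /glue;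
    [rewrite Sv|rewrite (negbTE Sv)].
rewrite /glue; case: ifPn => Sv; first by apply: fs; rewrite /= mem_filter Sv.
by apply: gs; rewrite /= mem_filter /= Sv.
Qed.

Lemma ge0_integral_glue S (F : envT -> \bar R) : measurable_fun [set: envT] F ->
  (forall f, 0 <= F f) -> \int[Pi]_f F f = \int[Pi]_f \int[Pi]_g F (glue S f g).
Proof.
move=> mF F0.
rewrite (ge0_integral_iid_env_transfer (@measurable_glue S) (@glue_box S))//.
rewrite (@fubini_tonelli1 _ _ envT envT R Pi Pi (fun p => F (glue S p.1 p.2)))//.
exact: (measurableT_comp mF (@measurable_glue S)).
Qed.

End iid.
End environments.

(** * Cascades on environments *)

Lemma integral_cst_probability d (T : measurableType d) (R : realType)
  (P : probability T R) (r : R) : \int[P]_x r%:E = r%:E.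
Proof. by rewrite integral_cst//= probability_setT mule1. Qed.

Section cascade_on_environments.
Context {R : realType} {b : nat}.
Notation env := (@env R b).
Notation envT := (@envT R b).
Implicit Types (f g : env) (m : seq 'I_b -> R) (u v : seq 'I_b) (j : 'I_b).

(* The absolute value keeps everything nonnegative on the null set where some
   weight is negative. *)
Definition weight v j f : R := `|tnth (f v) j|%R.

(** Stripping the first letter leaves a product in the environment of the subtree; [path_prod_rcons]
    gives the recursion at the last letter. *)
Fixpoint path_prod v f : R :=
  if v is j :: v' then (weight [::] j f * path_prod v' (subenv [:: j] f))%R
  else 1%R.

(** Consistency makes [m] the cylinder masses of a finite measure. Such [m] are kept general because
    [nu] is restricted to Borel sets and shifted along words. *)
Definition mass_fun m :=
  (forall v, (0 <= m v)%R) /\ (forall v, m v = \sum_j m (rcons v j))%R.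

Definition mass_shift u m : seq 'I_b -> R := fun v => m (u ++ v).

Definition total n m f : R := (\sum_(v : n.-tuple 'I_b) m v * path_prod v f)%R.

(** Plays the part of measurability with respect to the first [n] generations: the weights of a path
    of length [n] are attached to words of length less than [n]. *)
Definition level n (U : Type) (G : env -> U) :=
  forall f g, (forall v, (size v < n)%N -> f v = g v) -> G f = G g.

Lemma weight_ge0 v j f : (0 <= weight v j f)%R.
Proof. exact: normr_ge0. Qed.

Lemma weight_subenv u v j f : weight v j (subenv u f) = weight (u ++ v) j f.
Proof. by []. Qed.

Lemma path_prod_ge0 v f : (0 <= path_prod v f)%R.
Proof. by elim: v f => //= j v ih f; rewrite mulr_ge0 ?weight_ge0. Qed.

Lemma path_prod_rcons v j f :
  path_prod (rcons v j) f = (path_prod v f * weight v j f)%R.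
Proof.
elim: v f => [|i v ih] f /=; first by rewrite mulr1 mul1r.
by rewrite ih mulrA.
Qed.

Lemma mass_fun_shift u m : mass_fun m -> mass_fun (mass_shift u m).
Proof. by case=> m0 mE; split=> v; rewrite /mass_shift// mE; under eq_bigr do rewrite rcons_cat. Qed.

Lemma mass_fun_nil m n : mass_fun m -> m [::] = (\sum_(v : n.-tuple 'I_b) m v)%R.
Proof.
move=> [_ mE]; elim: n => [|n ih]; first by rewrite (sum_words0 m).
by rewrite (sum_words_rcons _ m) ih; apply: eq_bigr.
Qed.

Lemma total_ge0 n m f : mass_fun m -> (0 <= total n m f)%R.
Proof. by case=> m0 _; apply: sumr_ge0 => v _; rewrite mulr_ge0// path_prod_ge0. Qed.

Lemma total0 m f : total 0 m f = m [::].
Proof. by rewrite /total (sum_words0 (fun v => m v * path_prod v f)%R) mulr1. Qed.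

Lemma total_cons n m f : total n.+1 m f =
  (\sum_j weight [::] j f * total n (mass_shift [:: j] m) (subenv [:: j] f))%R.
Proof.
rewrite /total (sum_words_cons _ (fun v => m v * path_prod v f)%R).
by apply: eq_bigr => j _; rewrite mulr_sumr; apply: eq_bigr => v _; rewrite mulrCA.
Qed.

Lemma total_rcons n m f : total n.+1 m f =
  (\sum_(v : n.-tuple 'I_b) \sum_j m (rcons v j) * (path_prod v f * weight v j f))%R.
Proof.
rewrite /total (sum_words_rcons _ (fun v => m v * path_prod v f)%R).
by apply: eq_bigr => v _; apply: eq_bigr => j _; rewrite path_prod_rcons.
Qed.

Lemma total_add n m m' f :
  total n (fun v => m v + m' v)%R f = (total n m f + total n m' f)%R.
Proof. by rewrite -big_split/=; apply: eq_bigr => v _; rewrite mulrDl. Qed.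

Lemma level_path_prod n v : (size v <= n)%N -> level n (path_prod v).
Proof.
elim: v n => [|j v ih] n //= vn f g fg; rewrite /weight fg ?(leq_trans _ vn)//.
case: n vn fg => // n vn fg; congr (_ * _)%R.
by apply: (ih n) => // u un; apply: fg.
Qed.

Lemma level_total n k m : (n <= k)%N -> level k (total n m).
Proof.
move=> nk f g fg; apply: eq_bigr => v _; congr (_ * _)%R.
by apply: (level_path_prod (n := k)) => //; rewrite size_tuple.
Qed.

Lemma measurable_weight v j : @measurable_fun _ _ envT R setT (weight v j).
Proof.
apply: measurableT_comp => //=.
exact: (measurableT_comp (measurable_tnth j) (measurable_env_coord v)).
Qed.

Lemma measurable_path_prod v : @measurable_fun _ _ envT R setT (path_prod v).
Proof.
elim: v => [|j v ih] /=; first exact: measurable_cst.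
apply: measurable_funM; first exact: measurable_weight.
exact: (measurableT_comp ih (@measurable_subenv R b [:: j])).
Qed.

Lemma measurable_total n m : @measurable_fun _ _ envT R setT (total n m).
Proof.
apply: measurable_sum => v; apply: measurable_funM; first exact: measurable_cst.
exact: measurable_path_prod.
Qed.

Section iid.
Variables (Pi : probability envT R) (lam : set (b.-tuple R) -> \bar R).
Hypothesis Pi_iid : iid_env Pi lam.

Lemma ge0_integral_indep S (G H : env -> \bar R) :
  @measurable_fun _ _ envT (\bar R) setT G ->
  @measurable_fun _ _ envT (\bar R) setT H ->
  (forall f, 0 <= G f) -> (forall f, 0 <= H f) ->
  (forall f g, G (glue S f g) = G f) -> (forall f g, H (glue S f g) = H g) ->
  \int[Pi]_f (G f * H f) = \int[Pi]_f G f * \int[Pi]_f H f.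
Proof.
move=> mG mH G0 H0 GS HS.
rewrite (ge0_integral_glue Pi_iid S)/=; last 2 first.
- exact: emeasurable_funM.
- by move=> f; rewrite mule_ge0.
under eq_integral do under eq_integral do rewrite GS HS.
under eq_integral do rewrite ge0_integralZl//.
by rewrite ge0_integralZr// integral_ge0.
Qed.

Lemma integrable_indep S (G H : env -> R) :
  Pi.-integrable setT (EFin \o G) -> Pi.-integrable setT (EFin \o H) ->
  (forall f g, G (glue S f g) = G f) -> (forall f g, H (glue S f g) = H g) ->
  Pi.-integrable setT (EFin \o (fun f => (G f * H f)%R)) /\
  \int[Pi]_f (G f * H f)%:E = \int[Pi]_f (G f)%:E * \int[Pi]_f (H f)%:E.
Proof.
move=> iG iH GS HS.
have mG := measurable_int _ iG; have mH := measurable_int _ iH.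
have iGH : Pi.-integrable setT (EFin \o (fun f => (G f * H f)%R)).
  apply/integrableP; split.
    by rewrite (_ : _ \o _ = (EFin \o G) \* (EFin \o H))//; exact: emeasurable_funM.
  rewrite (eq_integral (fun f : envT => `|(G f)%:E| * `|(H f)%:E|)); last first.
    by move=> f _; rewrite -abseM.
  rewrite (@ge0_integral_indep S (fun f => `|(G f)%:E|) (fun f => `|(H f)%:E|))//.
  - have /integrableP[_ hG] := iG; have /integrableP[_ hH] := iH.
    by rewrite lte_mul_pinfty// ?integral_ge0// ge0_fin_numE// integral_ge0.
  - exact: measurableT_comp.
  - exact: measurableT_comp.
  - by move=> f g; rewrite GS.
  - by move=> f g; rewrite HS.
split=> //.
pose Phi (p : envT * envT) : envT := glue S p.1 p.2.
pose F f := (G f * H f)%:E.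
have mF : measurable_fun [set: envT] F by exact: measurable_int iGH.
have FPhi x y : (F \o Phi) (x, y) = (G x)%:E * (H y)%:E.
  by rewrite [LHS]/= /F /Phi GS HS EFinM.
have mPhi : measurable_fun setT Phi by exact: measurable_glue.
have iFPhi : (Pi \x Pi).-integrable setT (F \o Phi).
  apply/integrableP; split; first exact: measurableT_comp.
  have /integrableP[_] := iGH; apply: le_lt_trans.
  rewrite (ge0_integral_iid_env_transfer Pi_iid mPhi (glue_box Pi_iid S))//.
  exact: measurableT_comp.
transitivity (\int[pushforward (Pi \x Pi)%E Phi]_f F f).
  apply: eq_measure_integral => A mA _; apply/esym.
  exact: (iid_env_transfer Pi_iid mPhi (glue_box Pi_iid S)).
rewrite integral_pushforward// -integral12_prod_meas1//.
rewrite /fubini_F; under eq_integral do under eq_integral do rewrite FPhi.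
under eq_integral do rewrite integralZl//.
rewrite -(@fineK _ (\int[Pi]_f (H f)%:E)) ?integrable_fin_num//.
by rewrite integralZr.
Qed.

Lemma integral_level_indep n (G : env -> \bar R) (H : env -> \bar R) v :
  @measurable_fun _ _ envT (\bar R) setT G ->
  @measurable_fun _ _ envT (\bar R) setT H ->
  (forall f, 0 <= G f) -> (forall f, 0 <= H f) -> level n G -> (n <= size v)%N ->
  \int[Pi]_f (G f * H (subenv v f)) = \int[Pi]_f G f * \int[Pi]_f H f.
Proof.
move=> mG mH G0 H0 nG nv.
rewrite (@ge0_integral_indep (fun u => size u < n)%N G (H \o subenv v))//=.
- by rewrite (ge0_integral_subenv Pi_iid).
- exact: measurableT_comp mH (@measurable_subenv R b v).
- by move=> f g; apply: nG => u un; rewrite /glue un.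
- move=> f g; congr H; apply/funext => u; rewrite /subenv /glue size_cat.
  by rewrite ltnNge (leq_trans nv)// leq_addr.
Qed.

Hypothesis weight_mean : forall j, \int[Pi]_f (weight [::] j f)%:E = 1.

Lemma integral_mul_weight n (G : env -> R) v j :
  @measurable_fun _ _ envT R setT G -> (forall f, (0 <= G f)%R) -> level n G ->
  (n <= size v)%N ->
  \int[Pi]_f (G f * weight v j f)%:E = \int[Pi]_f (G f)%:E.
Proof.
move=> mG G0 nG nv.
under eq_integral => f _ do
  rewrite EFinM -{1}[v]cats0 -(weight_subenv v [::] j).
rewrite (@integral_level_indep n (EFin \o G) (EFin \o weight [::] j))//=.
- by rewrite weight_mean mule1.
- by apply/measurable_EFinP; exact: mG.
- by apply/measurable_EFinP; exact: measurable_weight.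
- by move=> f; rewrite lee_fin weight_ge0.
- by move=> f g fg; congr EFin; exact: nG.
Qed.

Lemma ge0_integral_lincomb (I : finType) (c : I -> R) (G : I -> env -> R) :
  (forall i, @measurable_fun _ _ envT R setT (G i)) ->
  (forall i, (0 <= c i)%R) -> (forall i f, (0 <= G i f)%R) ->
  \int[Pi]_f (\sum_i c i * G i f)%:E = \sum_i (c i)%:E * \int[Pi]_f (G i f)%:E.
Proof.
move=> mG c0 G0.
under eq_integral do rewrite -sumEFin.
rewrite ge0_integral_sum//.
- apply: eq_bigr => i _; under eq_integral do rewrite EFinM.
  rewrite ge0_integralZl_EFin//; first by move=> f _; rewrite lee_fin.
  by apply/measurable_EFinP; exact: mG.
- by move=> i; apply/measurable_EFinP/measurable_funM.
- by move=> i f _; rewrite lee_fin mulr_ge0.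
Qed.

Lemma integral_path_prod v : \int[Pi]_f (path_prod v f)%:E = 1.
Proof.
elim/last_ind: v => [|v j ih] /=.
  exact: integral_cst_probability.
under eq_integral do rewrite path_prod_rcons.
rewrite (@integral_mul_weight (size v))//.
- exact: measurable_path_prod.
- exact: path_prod_ge0.
- exact: level_path_prod.
Qed.

(** For [v] of length [n], the weights at [v] have mean 1 and are independent of [G] and of
    [path_prod v]. The children of [v] thus contribute in the mean the sum of [m (rcons v j)], which
    is [m v]. *)
Lemma integral_total_martingale n m (G : env -> R) : mass_fun m ->
  @measurable_fun _ _ envT R setT G -> (forall f, (0 <= G f)%R) -> level n G ->
  \int[Pi]_f (G f * total n.+1 m f)%:E = \int[Pi]_f (G f * total n m f)%:E.
Proof.
move=> [m0 mE] mG G0 nG.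
have mGp v : @measurable_fun _ _ envT R setT (fun f => G f * path_prod v f)%R.
  by apply: measurable_funM => //; exact: measurable_path_prod.
have Gp0 v f : (0 <= G f * path_prod v f)%R by rewrite mulr_ge0 ?path_prod_ge0.
under eq_integral => f _.
  rewrite total_rcons pair_big/= mulr_sumr.
  under eq_bigr => p _ do rewrite mulrCA [(G f * (_ * _))%R]mulrA.
  over.
rewrite ge0_integral_lincomb//; last first.
- by move=> p f; rewrite mulr_ge0// weight_ge0.
- by move=> p; apply: measurable_funM => //; exact: measurable_weight.
under [RHS]eq_integral => f _.
  rewrite /total mulr_sumr.
  under eq_bigr => p _ do rewrite mulrCA.
  over.
rewrite ge0_integral_lincomb//.
rewrite -(pair_big xpredT xpredT (fun (v : n.-tuple 'I_b) j =>
  (m (rcons v j))%:E * \int[Pi]_f (G f * path_prod v f * weight v j f)%:E))/=.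
apply: eq_bigr => v _.
under eq_bigr => j _.
  rewrite (@integral_mul_weight n) ?size_tuple//; last first.
    by move=> f g fg; rewrite (nG f g fg) (level_path_prod _ fg)// size_tuple.
  over.
rewrite -ge0_sume_distrl; last by move=> j _; rewrite lee_fin.
by rewrite sumEFin -mE.
Qed.

Lemma integral_total n m : mass_fun m -> \int[Pi]_f (total n m f)%:E = (m [::])%:E.
Proof.
move=> [m0 mE]; rewrite /total ge0_integral_lincomb//.
- under eq_bigr do rewrite integral_path_prod mule1.
  by rewrite sumEFin -mass_fun_nil.
- by move=> v; exact: measurable_path_prod.
- by move=> v f; exact: path_prod_ge0.
Qed.

End iid.
End cascade_on_environments.

(** * Convergence of nonnegative martingales *)

Section limsup_liminf.
Context {R : realType}.
Implicit Types (u : (\bar R)^nat).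

Lemma cvg_limn_einf_esup u : limn_esup u <= limn_einf u ->
  u @ \oo --> limn_esup u.
Proof.
move=> h; have e : limn_einf u = limn_esup u.
  by apply/eqP; rewrite eq_le h limn_einf_sup.
apply: (@squeeze_cvge _ _ _ _ (einfs u) _ (esups u)).
- apply: nearW => n; apply/andP; split.
    by apply: ereal_inf_lbound; exists n => //=.
  by apply: ereal_sup_ubound; exists n => //=.
- by rewrite -e limn_einf_lim; exact: is_cvg_einfs.
- by rewrite limn_esup_lim; exact: is_cvg_esups.
Qed.

Lemma limn_einf_lt_frequently u p N : limn_einf u < p ->
  exists2 n, (N <= n)%N & u n < p.
Proof.
rewrite limn_einf_lim => h.
have : einfs u N < p.
  apply: le_lt_trans h; rewrite (cvg_lim _ (@cvg_einfs_sup _ u))//.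
  by apply: ereal_sup_ubound; exists N.
by move=> /ereal_inf_lt[_ [n /= Nn <-] unp]; exists n.
Qed.

Lemma limn_esup_gt_frequently u q N : q < limn_esup u ->
  exists2 n, (N <= n)%N & q < u n.
Proof.
rewrite limn_esup_lim => h.
have : q < esups u N.
  apply: lt_le_trans h _; rewrite (cvg_lim _ (@cvg_esups_inf _ u))//.
  by apply: ereal_inf_lbound; exists N.
by move=> /ereal_sup_gt[_ [n /= Nn <-] unp]; exists n.
Qed.

Lemma rational_gap (x y : \bar R) : 0 <= x -> x < y ->
  exists p q : rat, [/\ (0 <= p)%R, (p < q)%R, x < (ratr p)%:E & (ratr q)%:E < y].
Proof.
(* A real [z] is chosen first because [y] may be infinite. *)
move=> x0 xy; have [z xz zy] : exists2 z : R, x < z%:E & z%:E <= y.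
  case: y xy => [y xy|xy|]; [by exists y| |by rewrite ltNge leNye].
  by exists (fine x + 1)%R; rewrite ?leey// -(@fineK _ x) ?lte_fin ?ltrDl// ge0_fin_numE.
have xr : x = (fine x)%:E by rewrite fineK// ge0_fin_numE// (lt_le_trans xz)// leey.
move: xz x0; rewrite xr lte_fin lee_fin => xz x0.
have [q] := rat_in_itvoo xz; rewrite in_itv/= => /andP[xq qz].
have [p] := rat_in_itvoo xq; rewrite in_itv/= => /andP[xp pq].
exists p, q; split; rewrite ?lte_fin//.
- by rewrite -(ler_rat R) raddf0 (le_trans x0)// ltW.
- by rewrite -(ltr_rat R).
- by rewrite (lt_le_trans _ zy)// lte_fin.
Qed.

End limsup_liminf.

(* Doob's upcrossing argument, without counting upcrossings: [crossing_state n]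
   is the event that the process has been below [p] and not above [q] since,
   and [crossing n] that such an excursion ends at time [n]. *)
Section martingale_convergence.
Context d (T : measurableType d) (R : realType) (P : probability T R).
Variables (F : nat -> set (set T)) (Z : nat -> T -> R).
Hypothesis F_measurable : forall n A, F n A -> measurable A.
Hypothesis F_setC : forall n A, F n A -> F n (~` A).
Hypothesis F_setI : forall n A B, F n A -> F n B -> F n (A `&` B).
Hypothesis F_nondecreasing : forall n A, F n A -> F n.+1 A.
Hypothesis F0 : F 0 set0.
Hypothesis Z_adapted : forall n c,
  F n [set x | (Z n x < c)%R] /\ F n [set x | (c < Z n x)%R].
Hypothesis Z_ge0 : forall n x, (0 <= Z n x)%R.
Hypothesis Z_measurable : forall n, measurable_fun setT (Z n).
Hypothesis Z_martingale : forall n A, F n A ->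
  \int[P]_x (\1_A x * Z n.+1 x)%:E = \int[P]_x (\1_A x * Z n x)%:E.

Fixpoint crossing_state (p q : R) n : set T :=
  if n is n'.+1 then
    (crossing_state p q n' `&` ~` [set x | q < Z n' x]%R) `|`
    (~` crossing_state p q n' `&` [set x | Z n' x < p]%R)
  else set0.

Definition crossing p q n := crossing_state p q n `&` [set x | q < Z n x]%R.

Let F_setU n A B : F n A -> F n B -> F n (A `|` B).
Proof. by move=> FA FB; rewrite -[A `|` B]setCK setCU; auto. Qed.

Let F_state p q n : F n (crossing_state p q n) /\ F n (crossing_state p q n.+1).
Proof.
elim: n => [|n [_ ih]].
  split => //=; apply: F_setU; apply: F_setI => //.
  - by apply: F_setC; have [] := Z_adapted 0 q.
  - exact: F_setC.
  - by have [] := Z_adapted 0 p.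
have {}ih := F_nondecreasing ih.
split => //=; apply: F_setU; apply: F_setI => //.
- by apply: F_setC; have [] := Z_adapted n.+1 q.
- exact: F_setC.
- by have [] := Z_adapted n.+1 p.
Qed.

Let F_crossing p q n : F n (crossing p q n).
Proof. by apply: F_setI; [have [] := F_state p q n|have [] := Z_adapted n q]. Qed.

(** The process is worth [Z n] during an excursion and [p] otherwise. The potential starts at [p],
    never increases, and drops by at least [q - p] at each completed crossing, so the expected
    number of crossings is at most [p / (q - p)]. *)
Let potential p q n : \bar R := \int[P]_x
  (\1_(crossing_state p q n) x * Z n x + p * \1_(~` crossing_state p q n) x)%:E.

Let mstate p q n : measurable (crossing_state p q n).
Proof. by have [/F_measurable] := F_state p q n. Qed.

Let mZ1 n A : measurable A -> measurable_fun setT (fun x => \1_A x * Z n x)%R.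
Proof. by move=> mA; apply: measurable_funM => //; exact: measurable_indic. Qed.

Let potential_step p q n : (0 <= p)%R -> (p < q)%R ->
  (q - p)%:E * P (crossing p q n) + potential p q n.+1 <= potential p q n.
Proof.
move=> p0 pq; have qp0 : (0 <= q - p)%R by rewrite subr_ge0 ltW.
have mU : measurable (crossing p q n) by exact: F_measurable (F_crossing p q n).
have mc A : measurable A -> measurable_fun setT (fun x : T => p * \1_(~` A) x)%R.
  by move=> mA; apply: measurable_funM => //; apply: measurable_indic; exact: measurableC.
have ic0 (A : set T) x : (0 <= p * \1_A x :> R)%R by rewrite mulr_ge0.
have iZ0 (A : set T) k x : (0 <= \1_A x * Z k x :> R)%R by rewrite mulr_ge0.
(* The state at time [n.+1] belongs to [F n], so the martingale property replaces [Z n.+1] by [Z n];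
   a pointwise comparison remains. *)
have -> : potential p q n.+1 = \int[P]_x
    (\1_(crossing_state p q n.+1) x * Z n x +
     p * \1_(~` crossing_state p q n.+1) x)%:E.
  have split k : \int[P]_x (\1_(crossing_state p q n.+1) x * Z k x +
       p * \1_(~` crossing_state p q n.+1) x)%:E =
     \int[P]_x (\1_(crossing_state p q n.+1) x * Z k x)%:E +
     \int[P]_x (p * \1_(~` crossing_state p q n.+1) x)%:E.
    under eq_integral do rewrite EFinD.
    rewrite ge0_integralD//.
    - by move=> x _; rewrite lee_fin.
    - by apply/measurable_EFinP/mZ1.
    - by move=> x _; rewrite lee_fin.
    - by apply/measurable_EFinP/mc.
  by rewrite /potential !split Z_martingale//; have [] := F_state p q n.
rewrite -[crossing p q n]setIT -integral_indic// -ge0_integralZl_EFin//; last first.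
  exact/measurable_EFinP.
rewrite -ge0_integralD//; last 4 first.
- by move=> x _; rewrite mule_ge0// lee_fin.
- by apply: emeasurable_funM => //; exact/measurable_EFinP.
- by move=> x _; rewrite lee_fin addr_ge0.
- by apply/measurable_EFinP/measurable_funD; [exact: mZ1|exact: mc].
apply: ge0_le_integral => //.
- by move=> x _; rewrite adde_ge0// ?mule_ge0// lee_fin// addr_ge0.
- apply: emeasurable_funD; first by apply: emeasurable_funM => //; exact/measurable_EFinP.
  by apply/measurable_EFinP/measurable_funD; [exact: mZ1|exact: mc].
- by apply/measurable_EFinP/measurable_funD; [exact: mZ1|exact: mc].
move=> x _; rewrite -EFinM -EFinD lee_fin !indicE !in_setC /crossing /= in_setU !in_setI !in_setC.
have -> : (x \in [set x | q < Z n x]%R) = (q < Z n x)%R by apply/idP/idP => [/set_mem|/mem_set].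
have -> : (x \in [set x | Z n x < p]%R) = (Z n x < p)%R by apply/idP/idP => [/set_mem|/mem_set].
case: (x \in _) => /=; case: (ltP q (Z n x)) => qZ /=; case: (ltP (Z n x) p) => pZ /=; lra.
Qed.

Let sum_crossing p q n : (0 <= p)%R -> (p < q)%R ->
  (q - p)%:E * \sum_(0 <= i < n) P (crossing p q i) + potential p q n <= p%:E.
Proof.
move=> p0 pq; elim: n => [|n ih].
  rewrite big_geq// mule0 add0e /potential /=.
  under eq_integral do rewrite indic0 mul0r add0r setC0 indicT mulr1.
  by rewrite integral_cst_probability.
rewrite big_nat_recr//= ge0_muleDr ?sume_ge0// -addeA.
apply: le_trans ih; rewrite leeD2l//.
exact: potential_step.
Qed.

Let crossing_finitely_often p q : (0 <= p)%R -> (p < q)%R ->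
  P (lim_sup_set (crossing p q)) = 0.
Proof.
move=> p0 pq; have qp0 : (0 < q - p)%R by rewrite subr_gt0.
(* Borel-Cantelli. *)
apply: lim_sup_set_cvg0; first by move=> n; exact: F_measurable (F_crossing p q n).
apply: (@le_lt_trans _ _ ((q - p)^-1 * p)%:E); last exact: ltry.
apply: lime_le; first by apply: is_cvg_nneseries.
apply: nearW => n.
rewrite EFinM lee_pdivlMl//.
apply: le_trans (sum_crossing n p0 pq); rewrite leeDl//.
apply: integral_ge0 => x _; rewrite lee_fin addr_ge0// ?mulr_ge0//.
Qed.

Let crossing_state_exit p q i k x : crossing_state p q i x ->
  (q < Z (i + k) x)%R -> exists2 n, (i <= n)%N & crossing p q n x.
Proof.
elim: k i => [|k ih] i si; first by rewrite addn0 => Zi; exists i.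
rewrite addnS -addSn => Zk; have [Zi|Zi] := pselect (q < Z i x)%R.
  by exists i.
have [|n ni Un] := ih i.+1 _ Zk; first by left.
by exists n => //; exact: ltnW.
Qed.

Let crossing_frequently p q x : (p < q)%R ->
  (forall N, exists2 n, (N <= n)%N & (Z n x < p)%R) ->
  (forall N, exists2 n, (N <= n)%N & (q < Z n x)%R) ->
  lim_sup_set (crossing p q) x.
Proof.
move=> pq low high N _.
have [i Ni Zi] := low N.
have si : crossing_state p q i.+1 x.
  rewrite /=; have [s|s] := pselect (crossing_state p q i x); [left|right] => //.
  by split => //= /(lt_trans pq)/(lt_trans Zi); rewrite ltxx.
have [k ik Zk] := high i.+1.
have [|n ni Un] := @crossing_state_exit p q i.+1 (k - i.+1) x si; first by rewrite subnKC.
by exists n => //=; rewrite (leq_trans Ni)// ltnW.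
Qed.

(** A gap between liminf and limsup contains two rationals crossed infinitely often, which has
    probability 0 for each of the countably many pairs. The limit may be infinite at this stage;
    finiteness comes later from Fatou. *)
Theorem nonneg_martingale_cvg : {ae P, forall x,
  (Z n x)%:E @[n --> \oo] --> limn_esup (fun n => (Z n x)%:E)}.
Proof.
pose bad (k : nat) := if unpickle k is Some (p, q) then
  (if (0 <= p :> rat)%R && (p < q)%R then
     lim_sup_set (crossing (ratr p) (ratr q)) else set0)
  else set0.
have nbad : P.-negligible (\bigcup_k bad k).
  apply: negligible_bigcup => k; rewrite /bad.
  case: (unpickle k) => [[p q]|]; last exact: negligible_set0.
  case: ifPn => [/andP[p0 pq]|_]; last exact: negligible_set0.
  apply/negligibleP.
    apply: bigcap_measurable => // n _; apply: bigcup_measurable => i _.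
    exact: F_measurable (F_crossing _ _ i).
  by apply: crossing_finitely_often; rewrite ?ler0q// ltr_rat.
apply: negligibleS nbad => x /= ncvg; apply: contrapT => xbad; apply: ncvg.
apply: cvg_limn_einf_esup; rewrite leNgt; apply/negP => gap.
have einf0 : 0 <= limn_einf (fun n => (Z n x)%:E).
  rewrite limn_einf_lim; apply: lime_ge; first exact: is_cvg_einfs.
  by apply: nearW => n; apply: le_ereal_inf_tmp => _ [m _ <-]; rewrite lee_fin.
have [p [q [p0 pq lp ql]]] := rational_gap einf0 gap.
apply: xbad; exists (pickle (p, q)); [by []|rewrite /bad pickleK p0 pq/=].
apply: crossing_frequently; first by rewrite ltr_rat.
  move=> N; have [n Nn] := limn_einf_lt_frequently N lp.
  by rewrite lte_fin; exists n.
move=> N; have [n Nn] := limn_esup_gt_frequently N ql.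
by rewrite lte_fin; exists n.
Qed.

End martingale_convergence.

(** * Limit masses *)

Section almost_everywhere.
Context d (T : measurableType d) (R : realType) (mu : {measure set T -> \bar R}).

Lemma ae_imply (A B : T -> Prop) : (forall x, A x -> B x) ->
  {ae mu, forall x, A x} -> {ae mu, forall x, B x}.
Proof. exact: filterS. Qed.

Lemma ae_imply2 (A B C : T -> Prop) : (forall x, A x -> B x -> C x) ->
  {ae mu, forall x, A x} -> {ae mu, forall x, B x} -> {ae mu, forall x, C x}.
Proof. exact: filterS2. Qed.

Lemma ae_forall_count (I : countType) (A : I -> T -> Prop) :
  (forall i, {ae mu, forall x, A i x}) -> {ae mu, forall x, forall i, A i x}.
Proof.
move=> h; have hn n : {ae mu, forall x, if unpickle n is Some i then A i x else True}.
  by case: unpickle => [i|]; [exact: h|exact: aeW].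
by apply: ae_imply (ae_foralln hn) => x Ax i; have := Ax (pickle i); rewrite pickleK.
Qed.

End almost_everywhere.

Section cascade_limit_mass.
Context {R : realType} {b : nat}.
Notation env := (@env R b).
Notation envT := (@envT R b).
Variables (Pi : probability envT R) (lam : set (b.-tuple R) -> \bar R).
Hypothesis Pi_iid : iid_env Pi lam.
Hypothesis weight_mean : forall j, \int[Pi]_f (weight [::] j f)%:E = 1.
Implicit Types (f g : env) (m : seq 'I_b -> R) (u v : seq 'I_b) (j : 'I_b).

(** [fine] sends an infinite limsup to 0; by [total_lim_esup] this happens only on a null set. *)
Definition total_lim m f : R := fine (limn_esup (fun n => (total n m f)%:E)).

Lemma measurable_limn_esup_total m :
  @measurable_fun _ _ envT (\bar R) setT (fun f => limn_esup (fun n => (total n m f)%:E)).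
Proof.
apply: measurable_fun_limn_esup => n.
by apply/measurable_EFinP; exact: measurable_total.
Qed.

Lemma measurable_total_lim m : @measurable_fun _ _ envT R setT (total_lim m).
Proof. exact: measurableT_comp (measurable_limn_esup_total m). Qed.

Lemma limn_einf_total_ge0 m f : mass_fun m ->
  0 <= limn_einf (fun n => (total n m f)%:E).
Proof.
move=> mm; rewrite limn_einf_lim; apply: lime_ge; first exact: is_cvg_einfs.
apply: nearW => n; apply: le_ereal_inf_tmp => _ [k _ <-].
by rewrite lee_fin total_ge0.
Qed.

Lemma total_lim_ge0 m f : mass_fun m -> (0 <= total_lim m f)%R.
Proof.
by move=> mm; apply: fine_ge0; rewrite (le_trans (limn_einf_total_ge0 f mm))// limn_einf_sup.
Qed.

Lemma total_cvg_ereal m : mass_fun m -> {ae Pi, forall f,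
  (total n m f)%:E @[n --> \oo] --> limn_esup (fun n => (total n m f)%:E)}.
Proof.
move=> mm.
(* The filtration: measurable events that depend only on the words of length less than [n]. *)
pose F n := [set A : set envT | measurable A /\ level n (A : env -> Prop)].
have measb n c : measurable ([set f | (total n m f < c)%R] : set envT) /\
                 measurable ([set f | (c < total n m f)%R] : set envT).
  have mt := @measurable_total R b n m; split; rewrite -[X in measurable X]setTI.
    by have := mt measurableT `]-oo, c[%classic (measurable_itv _);
       congr (measurable (_ `&` _)); apply/seteqP; split=> f /=; rewrite in_itv.
  by have := mt measurableT `]c, +oo[%classic (measurable_itv _);
     congr (measurable (_ `&` _)); apply/seteqP; split=> f /=; rewrite in_itv/= andbT.
apply: (@nonneg_martingale_cvg _ _ _ Pi F (fun n f => total n m f)).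
- by move=> n A [].
- move=> n A [mA lA]; split; first exact: measurableC.
  by move=> f g /lA h; rewrite /setC /= h.
- move=> n A B [mA lA] [mB lB]; split; first exact: measurableI.
  by move=> f g fg; rewrite /setI /= (lA _ _ fg) (lB _ _ fg).
- move=> n A [mA lA]; split => // f g fg; apply: lA => v vn; apply: fg.
  exact: leqW.
- by split.
- move=> n c; split; split; [by have [] := measb n c| |by have [] := measb n c|];
    by move=> f g fg /=; rewrite (level_total m (leqnn n) fg).
- by move=> n f; exact: total_ge0.
- by move=> n; exact: measurable_total.
- move=> n A [mA lA].
  apply: (integral_total_martingale Pi_iid weight_mean mm).
  + exact: measurable_indic.
  + by move=> f; rewrite indicE.
  + by move=> f g fg; rewrite !indicE; congr (_%:R); rewrite /in_mem/=/in_set/= (lA _ _ fg).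
Qed.

(** Fatou bounds the mean of the liminf, which almost surely equals the limsup. *)
Lemma integral_limn_esup_total m : mass_fun m ->
  \int[Pi]_f limn_esup (fun n => (total n m f)%:E) <= (m [::])%:E.
Proof.
move=> mm; have -> : \int[Pi]_f limn_esup (fun n => (total n m f)%:E) =
    \int[Pi]_f limn_einf (fun n => (total n m f)%:E).
  apply: ge0_ae_eq_integral => //.
  - exact: measurable_limn_esup_total.
  - have -> : (fun f => limn_einf (fun n => (total n m f)%:E)) =
        (fun f => - limn_esup (fun n => - (total n m f)%:E)) by [].
    apply: measurableT_comp => //; apply: measurable_fun_limn_esup => n.
    apply: measurableT_comp => //.
    by apply/measurable_EFinP; exact: measurable_total.
  - by move=> f _; rewrite (le_trans (limn_einf_total_ge0 f mm))// limn_einf_sup.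
  - by move=> f _; exact: limn_einf_total_ge0.
  - apply: ae_imply (total_cvg_ereal mm) => f h _.
    by have [-> _] := cvg_limn_einf_sup h.
apply: le_trans (fatou _ _ _ _) _ => //.
- by move=> n; apply/measurable_EFinP; exact: measurable_total.
- by move=> n f _; rewrite lee_fin total_ge0.
rewrite (_ : (fun n => _) = fun=> (m [::])%:E); last first.
  by apply/funext => n; exact: (integral_total Pi_iid weight_mean).
by rewrite (is_cvg_limn_einfE (is_cvg_cst _)) lim_cst.
Qed.

Lemma total_lim_esup m : mass_fun m -> {ae Pi, forall f,
  limn_esup (fun n => (total n m f)%:E) = (total_lim m f)%:E}.
Proof.
move=> mm; have : Pi.-integrable setT (fun f => limn_esup (fun n => (total n m f)%:E)).
  apply/integrableP; split; first exact: measurable_limn_esup_total.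
  apply: le_lt_trans (ltry (m [::])).
  rewrite (eq_integral (fun f : envT => limn_esup (fun n => (total n m f)%:E))).
    exact: integral_limn_esup_total.
  move=> f _; rewrite gee0_abs// (le_trans (limn_einf_total_ge0 f mm))//.
  exact: limn_einf_sup.
move=> /(integrable_ae measurableT); apply: ae_imply => f /(_ I) h.
by rewrite /total_lim fineK.
Qed.

Lemma total_cvg m : mass_fun m -> {ae Pi, forall f,
  total n m f @[n --> \oo] --> total_lim m f}.
Proof.
move=> mm; apply: ae_imply2 (total_cvg_ereal mm) (total_lim_esup mm) => f h e.
by move: h; rewrite e => /fine_cvg.
Qed.

Lemma ae_subenv u (Q : set env) :
  {ae Pi, forall f, Q f} -> {ae Pi, forall f, Q (subenv u f)}.
Proof.
move=> [N [mN N0 QN]]; exists (subenv u @^-1` N); split.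
- by rewrite -[X in measurable X]setTI; exact: measurable_subenv.
- by rewrite (subenv_law Pi_iid).
- by move=> f /= h; apply: QN.
Qed.

Lemma integral_total_limE m : mass_fun m -> \int[Pi]_f (total_lim m f)%:E =
  \int[Pi]_f limn_esup (fun n => (total n m f)%:E).
Proof.
move=> mm; apply: ge0_ae_eq_integral => //.
- by apply/measurable_EFinP; exact: measurable_total_lim.
- exact: measurable_limn_esup_total.
- by move=> f _; rewrite lee_fin total_lim_ge0.
- by move=> f _; rewrite (le_trans (limn_einf_total_ge0 f mm))// limn_einf_sup.
- by apply: ae_imply (total_lim_esup mm) => f ->.
Qed.

Lemma integral_total_lim_le m : mass_fun m ->
  \int[Pi]_f (total_lim m f)%:E <= (m [::])%:E.
Proof. by move=> mm; rewrite integral_total_limE// integral_limn_esup_total. Qed.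

Lemma integrable_total_lim m : mass_fun m ->
  Pi.-integrable setT (fun f => (total_lim m f)%:E).
Proof.
move=> mm; apply/integrableP; split.
  by apply/measurable_EFinP; exact: measurable_total_lim.
apply: le_lt_trans (ltry (m [::])); apply: le_trans (integral_total_lim_le mm).
by under eq_integral do rewrite /= ger0_norm ?total_lim_ge0//.
Qed.

Definition limit_mass m : R := fine (\int[Pi]_f (total_lim m f)%:E).

Lemma limit_massE m : mass_fun m ->
  (limit_mass m)%:E = \int[Pi]_f (total_lim m f)%:E.
Proof. by move=> mm; rewrite fineK// integrable_fin_num//; exact: integrable_total_lim. Qed.

Lemma limit_mass_ge0 m : mass_fun m -> (0 <= limit_mass m)%R.
Proof.
move=> mm; rewrite -lee_fin limit_massE// integral_ge0// => f _.
by rewrite lee_fin total_lim_ge0.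
Qed.

Lemma limit_mass_le m : mass_fun m -> (limit_mass m <= m [::])%R.
Proof. by move=> mm; rewrite -lee_fin limit_massE// integral_total_lim_le. Qed.

Lemma mass_fun_add m m' : mass_fun m -> mass_fun m' -> mass_fun (fun v => m v + m' v)%R.
Proof.
move=> [m0 mE] [m'0 m'E]; split=> v; first by rewrite addr_ge0.
by rewrite mE m'E big_split.
Qed.

Lemma limit_mass_add m m' : mass_fun m -> mass_fun m' ->
  limit_mass (fun v => m v + m' v)%R = (limit_mass m + limit_mass m')%R.
Proof.
move=> mm mm'; have mmm := mass_fun_add mm mm'.
apply: EFin_inj; rewrite EFinD !limit_massE// -integralD//; last 2 first.
- exact: integrable_total_lim.
- exact: integrable_total_lim.
apply: ae_eq_integral => //.
- by apply/measurable_EFinP; exact: measurable_total_lim.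
- by apply: emeasurable_funD; apply/measurable_EFinP; exact: measurable_total_lim.
apply: ae_imply2 (total_cvg mmm) (ae_imply2 (fun _ => @conj _ _) (total_cvg mm) (total_cvg mm')) => f h'' [h h'] _.
rewrite -EFinD; congr EFin.
have hD : total n (fun v => m v + m' v)%R f @[n --> \oo] -->
          (total_lim m f + total_lim m' f)%R.
  by under eq_fun do rewrite total_add; exact: cvgD.
exact: (cvg_unique (@Rhausdorff R) h'' hD).
Qed.

Lemma total_catn n k m f : total (n + k) m f =
  (\sum_(v : n.-tuple 'I_b) path_prod v f * total k (mass_shift v m) (subenv v f))%R.
Proof.
elim: n m f => [|n ih] m f.
  rewrite (sum_words0 (fun v => path_prod v f * total k (mass_shift v m) (subenv v f))%R).
  by rewrite /= mul1r.
rewrite addSn total_cons.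
rewrite (sum_words_cons _ (fun v => path_prod v f * total k (mass_shift v m) (subenv v f))%R).
apply: eq_bigr => j _; rewrite ih mulr_sumr; apply: eq_bigr => v _.
by rewrite /= mulrA.
Qed.

(** The limit of the branching decomposition [total_catn]. The totals of the subtrees converge
    almost surely because [subenv] preserves the law. *)
Lemma total_lim_cat n m : mass_fun m -> {ae Pi, forall f, total_lim m f =
  (\sum_(v : n.-tuple 'I_b)
     path_prod v f * total_lim (mass_shift v m) (subenv v f))%R}.
Proof.
move=> mm.
have : {ae Pi, forall f, forall v : n.-tuple 'I_b,
    total k (mass_shift v m) (subenv v f) @[k --> \oo] -->
    total_lim (mass_shift v m) (subenv v f)}.
  apply: ae_forall_count => v.
  apply: (@ae_subenv v (fun g => total k (mass_shift v m) g @[k --> \oo] -->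
    total_lim (mass_shift v m) g)).
  exact/total_cvg/mass_fun_shift.
apply: (ae_imply2 _ (total_cvg mm)) => f h hv.
have {}h : total (n + k) m f @[k --> \oo] --> total_lim m f.
  exact: (cvg_comp _ (fun k => total k m f) (cvg_addnl n) h).
apply: (cvg_unique (@Rhausdorff R) h).
rewrite (_ : (fun k => total (n + k) m f) = fun k => \sum_(v : n.-tuple 'I_b)
  path_prod v f * total k (mass_shift v m) (subenv v f))%R; last first.
  by apply/funext => k; exact: total_catn.
apply: cvg_big => [|v _]; first exact: add_continuous.
by apply: cvgMl_tmp; exact: hv.
Qed.

(** Conditioning the limit on the first [n] generations: the limits in the subtrees at depth [n] are
    independent of these generations, so each is replaced by its mean. *)
Lemma integral_mul_total_lim n m (G : env -> R) : mass_fun m ->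
  @measurable_fun _ _ envT R setT G -> (forall f, (0 <= G f)%R) -> level n G ->
  \int[Pi]_f (G f * total_lim m f)%:E = \sum_(v : n.-tuple 'I_b)
    (limit_mass (mass_shift v m))%:E * \int[Pi]_f (G f * path_prod v f)%:E.
Proof.
move=> mm mG G0 nG.
have mGp v : @measurable_fun _ _ envT R setT (fun f => G f * path_prod v f)%R.
  by apply: measurable_funM => //; exact: measurable_path_prod.
have Gp0 v f : (0 <= G f * path_prod v f)%R by rewrite mulr_ge0 ?path_prod_ge0.
have mlim v : @measurable_fun _ _ envT R setT
    (fun f => total_lim (mass_shift v m) (subenv v f)).
  exact: (measurableT_comp (measurable_total_lim _) (@measurable_subenv R b v)).
have lim0 v f : (0 <= total_lim (mass_shift v m) (subenv v f))%R.
  by apply: total_lim_ge0; exact: mass_fun_shift.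
transitivity (\int[Pi]_f (\sum_(v : n.-tuple 'I_b)
    (G f * path_prod v f * total_lim (mass_shift v m) (subenv v f))%:E)).
  apply: ge0_ae_eq_integral => //.
  - apply/measurable_EFinP/measurable_funM => //; exact: measurable_total_lim.
  - by apply: emeasurable_sum => v; apply/measurable_EFinP/measurable_funM.
  - by move=> f _; rewrite lee_fin mulr_ge0// total_lim_ge0.
  - by move=> f _; apply: sume_ge0 => v _; rewrite lee_fin mulr_ge0.
  - apply: ae_imply (total_lim_cat n mm) => f -> _.
    rewrite sumEFin mulr_sumr; congr EFin; apply: eq_bigr => v _.
    by rewrite mulrA.
rewrite ge0_integral_sum//; last 2 first.
- by move=> v; apply/measurable_EFinP/measurable_funM.
- by move=> v f _; rewrite lee_fin mulr_ge0.
apply: eq_bigr => v _.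
rewrite (limit_massE (mass_fun_shift v mm)) [RHS]muleC.
under eq_integral do rewrite EFinM.
apply: (@integral_level_indep _ _ _ _ Pi_iid n
  (fun f => (G f * path_prod v f)%:E) (fun f => (total_lim (mass_shift v m) f)%:E)).
- by apply/measurable_EFinP; exact: mGp.
- by apply/measurable_EFinP; exact: measurable_total_lim.
- by move=> f; rewrite lee_fin.
- by move=> f; rewrite lee_fin; apply: total_lim_ge0; exact: mass_fun_shift.
- by move=> f g fg; rewrite (nG _ _ fg) (level_path_prod _ fg)// size_tuple.
- by rewrite size_tuple.
Qed.

(** Path products have mean 1, so averaging the branching decomposition leaves a plain sum. At
    [n = 1] this yields the shift invariance of the limit mass. *)
Lemma limit_mass_cat n m : mass_fun m ->
  limit_mass m = (\sum_(v : n.-tuple 'I_b) limit_mass (mass_shift v m))%R.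
Proof.
move=> mm; apply: EFin_inj; rewrite limit_massE//.
have := @integral_mul_total_lim n m (fun=> 1%R) mm.
under eq_integral do rewrite mul1r.
move=> ->//; rewrite -sumEFin; apply: eq_bigr => v _.
under eq_integral do rewrite mul1r.
by rewrite (integral_path_prod Pi_iid weight_mean) mule1.
Qed.

End cascade_limit_mass.

(** * The zero-one law *)

Section real_integrands.
Context d (T : measurableType d) (R : realType) (mu : {measure set T -> \bar R}).
Implicit Types g h : T -> R.

Lemma ge0_integralZl_real (c : R) g : (0 <= c)%R -> measurable_fun setT g ->
  (forall x, 0 <= g x)%R ->
  \int[mu]_x (c * g x)%:E = c%:E * \int[mu]_x (g x)%:E.
Proof.
move=> c0 mg g0; under eq_integral do rewrite EFinM.
by rewrite ge0_integralZl_EFin// => [x _|]; [rewrite lee_fin|apply/measurable_EFinP].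
Qed.

Lemma ge0_integralD_real g h : measurable_fun setT g -> measurable_fun setT h ->
  (forall x, 0 <= g x)%R -> (forall x, 0 <= h x)%R ->
  \int[mu]_x (g x + h x)%:E = \int[mu]_x (g x)%:E + \int[mu]_x (h x)%:E.
Proof.
move=> mg mh g0 h0; under eq_integral do rewrite EFinD.
by rewrite ge0_integralD//; (try by move=> x _; rewrite lee_fin);
  apply/measurable_EFinP.
Qed.

Lemma ge0_le_integral_real g h : measurable_fun setT g -> measurable_fun setT h ->
  (forall x, 0 <= g x)%R -> (forall x, g x <= h x)%R ->
  \int[mu]_x (g x)%:E <= \int[mu]_x (h x)%:E.
Proof.
move=> mg mh g0 gh; apply: ge0_le_integral => //.
- by move=> x _; rewrite lee_fin.
- by apply/measurable_EFinP.
- by apply/measurable_EFinP.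
- by move=> x _; rewrite lee_fin.
Qed.

End real_integrands.

Section zero_one_law.
Context {R : realType} {b : nat}.
Notation env := (@env R b).
Notation envT := (@envT R b).
Variables (Pi : probability envT R) (lam : set (b.-tuple R) -> \bar R).
Hypothesis Pi_iid : iid_env Pi lam.
Hypothesis weight_mean : forall j, \int[Pi]_f (weight [::] j f)%:E = 1.
Implicit Types (f g : env) (m : seq 'I_b -> R) (u v : seq 'I_b) (j : 'I_b).

(* A bounded continuous substitute for truncation at level [K]. *)
Definition saturate (K z : R) : R := (K * z / (K + `|z|))%R.

Lemma continuous_saturate K : (0 < K)%R -> continuous (saturate K).
Proof.
move=> K0 z; apply: cvgM; first by apply: cvgMl_tmp; exact: cvg_id.
apply: cvgV; first by rewrite gt_eqF// ltr_wpDr.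
by apply: cvgD; [exact: cvg_cst|apply: cvg_norm; exact: cvg_id].
Qed.

Lemma measurable_saturate K : (0 < K)%R -> measurable_fun setT (saturate K).
Proof. by move=> K0; apply: continuous_measurable_fun; exact: continuous_saturate. Qed.

Lemma saturate_ge0 K z : (0 < K)%R -> (0 <= z)%R -> (0 <= saturate K z)%R.
Proof. by move=> K0 z0; rewrite /saturate divr_ge0 ?mulr_ge0 ?addr_ge0// ltW. Qed.

Lemma saturate_leK K z : (0 < K)%R -> (0 <= z)%R -> (saturate K z <= K)%R.
Proof.
move=> K0 z0; rewrite /saturate ger0_norm// ler_pdivrMr ?ltr_wpDr//.
by rewrite ler_pM2l// lerDr ltW.
Qed.

Lemma saturate_le K z : (0 < K)%R -> (0 <= z)%R -> (saturate K z <= z)%R.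
Proof.
move=> K0 z0; rewrite /saturate ger0_norm// ler_pdivrMr ?ltr_wpDr//.
by rewrite mulrC ler_wpM2l// lerDl.
Qed.

Lemma saturateE K z : (0 < K)%R -> (0 <= z)%R ->
  saturate K z = (z - z * (z / (K + z)))%R.
Proof.
move=> K0 z0; rewrite /saturate ger0_norm//.
by field; rewrite gt_eqF// ltr_wpDr.
Qed.

Lemma integral_saturate_cvg K m : (0 < K)%R -> mass_fun m ->
  \int[Pi]_f (saturate K (total n m f))%:E @[n --> \oo] -->
  \int[Pi]_f (saturate K (total_lim m f))%:E.
Proof.
move=> K0 mm.
have [|||||_ _ cv] := @dominated_convergence _ envT R Pi setT measurableT
  (fun n f => (saturate K (total n m f))%:E)
  (fun f => (saturate K (total_lim m f))%:E) (cst K%:E); last exact: cv.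
- move=> n; apply/measurable_EFinP.
  exact: measurableT_comp (measurable_saturate K0) (@measurable_total R b n m).
- apply/measurable_EFinP.
  exact: measurableT_comp (measurable_saturate K0) (@measurable_total_lim R b m).
- apply: ae_imply (total_cvg Pi_iid weight_mean mm) => f h _.
  apply: cvg_EFin; first by apply: nearW.
  exact: (cvg_comp (fun n => total n m f) _ h (@continuous_saturate K K0 _)).
- exact: finite_measure_integrable_cst.
- apply: aeW => f n _ /=.
  by rewrite lee_fin ger0_norm ?saturate_leK ?saturate_ge0 ?total_ge0.
Qed.

(** Chosen so that [shrink z * z] is [saturate 1 z]. At [z = Z_n] it is a bounded factor that
    depends only on the first [n] generations. *)
Let shrink (z : R) : R := ((1 + `|z|)^-1)%R.

Let continuous_shrink : continuous shrink.
Proof.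
move=> z; apply: cvgV; first by rewrite gt_eqF// ltr_wpDr.
by apply: cvgD; [exact: cvg_cst|apply: cvg_norm; exact: cvg_id].
Qed.

Let shrink_ge0 z : (0 <= shrink z)%R.
Proof. by rewrite invr_ge0 addr_ge0. Qed.

Let shrink_le1 z : (shrink z <= 1)%R.
Proof. by rewrite invf_le1 ?lerDl// ltr_wpDr. Qed.

Lemma integral_shrink_cvg m : mass_fun m ->
  \int[Pi]_f (shrink (total n m f) * total_lim m f)%:E @[n --> \oo] -->
  \int[Pi]_f (saturate 1 (total_lim m f))%:E.
Proof.
move=> mm.
have ms : measurable_fun setT shrink by apply: continuous_measurable_fun.
have [|||||_ _ cv] := @dominated_convergence _ envT R Pi setT measurableT
  (fun n f => (shrink (total n m f) * total_lim m f)%:E)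
  (fun f => (saturate 1 (total_lim m f))%:E) (fun f => (total_lim m f)%:E); last exact: cv.
- move=> n; apply/measurable_EFinP/measurable_funM; last exact: measurable_total_lim.
  exact: measurableT_comp ms (@measurable_total R b n m).
- apply/measurable_EFinP.
  exact: measurableT_comp (measurable_saturate ltr01) (@measurable_total_lim R b m).
- apply: ae_imply (total_cvg Pi_iid weight_mean mm) => f h _.
  apply: cvg_EFin; first by apply: nearW.
  rewrite /saturate mul1r mulrC; apply: cvgMr_tmp.
  exact: (cvg_comp (fun n => total n m f) _ h (@continuous_shrink _)).
- exact: (integrable_total_lim Pi_iid weight_mean mm).
- apply: aeW => f n _ /=.
  by rewrite lee_fin ger0_norm ?mulr_ge0 ?total_lim_ge0// ler_piMl ?total_lim_ge0.
Qed.

(* [Z_n := total n m] satisfies [E[Z | F_n] = c Z_n] for its limit [Z]; letting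
   [n] tend to infinity in [E[Z / (1 + Z_n)] = c E[Z_n / (1 + Z_n)]] gives
   [c = 1] unless [Z] vanishes. *)
Theorem limit_mass_zero_one m c : mass_fun m -> m [::] = 1%R ->
  (forall v, limit_mass Pi (mass_shift v m) = c * m v)%R ->
  limit_mass Pi m = 1%R \/ {ae Pi, forall f, total_lim m f = 0%R}.
Proof.
move=> mm m1 mc.
have ms : measurable_fun setT shrink by apply: continuous_measurable_fun.
have shrink_total n : \int[Pi]_f (shrink (total n m f) * total_lim m f)%:E =
    c%:E * \int[Pi]_f (saturate 1 (total n m f))%:E.
  rewrite (integral_mul_total_lim Pi_iid weight_mean (n := n))//; last 2 first.
  - exact: measurableT_comp ms (@measurable_total R b n m).
  - by move=> f g fg; rewrite (level_total m (leqnn n) fg).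
  have -> : \int[Pi]_f (saturate 1 (total n m f))%:E = \int[Pi]_f
      (\sum_(v : n.-tuple 'I_b) m v * (shrink (total n m f) * path_prod v f))%:E.
    apply: eq_integral => f _; congr EFin.
    rewrite /saturate mul1r mulrC {2}/total mulr_sumr.
    by apply: eq_bigr => v _; rewrite mulrCA.
  rewrite ge0_integral_lincomb.
  - rewrite ge0_sume_distrr; last first.
      move=> v _; rewrite mule_ge0 ?lee_fin ?(mm.1 v)//.
      by apply: integral_ge0 => f _; rewrite lee_fin mulr_ge0 ?path_prod_ge0.
    by apply: eq_bigr => v _; rewrite mc EFinM muleA.
  - move=> v; apply: measurable_funM; last exact: measurable_path_prod.
    exact: measurableT_comp ms (@measurable_total R b n m).
  - by move=> v; exact: mm.1.
  - by move=> v f; rewrite mulr_ge0 ?path_prod_ge0.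
have sE : \int[Pi]_f (saturate 1 (total_lim m f))%:E =
    c%:E * \int[Pi]_f (saturate 1 (total_lim m f))%:E.
  have h : \int[Pi]_f (shrink (total n m f) * total_lim m f)%:E @[n --> \oo] -->
      c%:E * \int[Pi]_f (saturate 1 (total_lim m f))%:E.
    under eq_fun do rewrite shrink_total.
    by apply: cvgeZl => //; exact: integral_saturate_cvg.
  exact: (cvg_unique (@ereal_hausdorff R) (integral_shrink_cvg mm) h).
have s0 f : (0 <= saturate 1 (total_lim m f))%R.
  by rewrite saturate_ge0// total_lim_ge0.
have msat : @measurable_fun _ _ envT R setT (fun f => saturate 1 (total_lim m f)).
  exact: measurableT_comp (measurable_saturate ltr01) (@measurable_total_lim R b m).
have sfin : \int[Pi]_f (saturate 1 (total_lim m f))%:E \is a fin_num.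
  rewrite ge0_fin_numE; last by apply: integral_ge0 => f _; rewrite lee_fin.
  apply: (@le_lt_trans _ _ 1); last exact: ltry.
  rewrite -[leRHS](integral_cst_probability Pi); apply: ge0_le_integral => //.
  - by move=> f _; rewrite lee_fin.
  - by apply/measurable_EFinP.
  - by move=> f _; rewrite lee_fin saturate_leK// total_lim_ge0.
have [sE0|sN0] := eqVneq (\int[Pi]_f (saturate 1 (total_lim m f))%:E) 0.
  right.
  have : \int[Pi]_f `|(saturate 1 (total_lim m f))%:E| = 0.
    by rewrite -sE0; apply: eq_integral => f _; rewrite gee0_abs// lee_fin.
  move/(ae_eq_integral_abs Pi measurableT (proj2 (measurable_EFinP _ _) msat)).
  apply: ae_imply => f /(_ I) [] /eqP.
  rewrite /saturate mul1r mulf_eq0 invr_eq0 => /orP[/eqP//|].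
  by rewrite gt_eqF// ltr_wpDr.
left; have c1 : c = 1%R.
  move: sE sN0; rewrite -(fineK sfin) -EFinM => -[] + sN0 => e.
  have : ((c - 1) * fine (\int[Pi]_f (saturate 1 (total_lim m f))%:E) = 0)%R.
    by rewrite mulrBl mul1r -e subrr.
  move/eqP; rewrite mulf_eq0 subr_eq0 => /orP[/eqP//|/eqP h].
  by move: sN0; rewrite h eqxx.
by have := mc [::]; rewrite c1 m1 mulr1.
Qed.

Lemma integrable_total n m : mass_fun m -> Pi.-integrable setT (fun f => (total n m f)%:E).
Proof.
move=> mm; apply/integrableP; split.
  by apply/measurable_EFinP; exact: measurable_total.
rewrite (eq_integral (fun f : envT => (total n m f)%:E)).
  by rewrite (integral_total Pi_iid weight_mean n mm) ltry.
by move=> f _; rewrite gee0_abs// lee_fin total_ge0.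
Qed.

(** The means of [Z_n] stay equal to 1 while [Z_n] tends to 0, so square roots, whose squares are
    bounded in the mean, tend to 0 in the mean. *)
Lemma integral_sqrt_total_small m : mass_fun m -> m [::] = 1%R ->
  {ae Pi, forall f, total_lim m f = 0%R} ->
  forall e : R, (0 < e)%R ->
  \forall n \near \oo, \int[Pi]_f (Num.sqrt (total n m f))%:E <= e%:E.
Proof.
move=> mm m1 lim0.
have msat n : @measurable_fun _ _ envT R setT (fun f => saturate 1 (total n m f)).
  exact: measurableT_comp (measurable_saturate ltr01) (@measurable_total R b n m).
have msqrt n : @measurable_fun _ _ envT R setT (fun f => Num.sqrt (total n m f)).
  apply: measurableT_comp (@measurable_total R b n m).
  by apply: continuous_measurable_fun; exact: sqrt_continuous.
have sat_cvg0 : \int[Pi]_f (saturate 1 (total n m f))%:E @[n --> \oo] --> 0.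
  have := integral_saturate_cvg ltr01 mm.
  rewrite (_ : \int[Pi]_f (saturate 1 (total_lim m f))%:E = 0)//.
  have ->// : \int[Pi]_f (saturate 1 (total_lim m f))%:E = \int[Pi]_f (cst 0 f).
    apply: ae_eq_integral => //.
      apply/measurable_EFinP.
      exact: measurableT_comp (measurable_saturate ltr01) (@measurable_total_lim R b m).
    by apply: ae_imply lim0 => f -> _; rewrite /saturate mulr0 mul0r.
  by rewrite integral0.
(* With [s = sqrt Z_n] and [t = 1 + Z_n], the square of [s - e t] gives
   [s <= s ^ 2 / (2 e t) + e t / 2]. Here [s ^ 2 / t] is [saturate 1 Z_n], and [t] has mean 2. *)
have bound (e : R) n : (0 < e)%R -> \int[Pi]_f (Num.sqrt (total n m f))%:E <=
    ((2 * e)^-1)%:E * \int[Pi]_f (saturate 1 (total n m f))%:E + e%:E.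
  move=> e0; have ei0 : (0 <= (2 * e)^-1)%R by rewrite invr_ge0 mulr_ge0// ltW.
  have t0 f : (0 <= total n m f)%R by exact: total_ge0.
  have mt1 : @measurable_fun _ _ envT R setT (fun f => 1 + total n m f)%R.
    by apply: measurable_funD => //; exact: measurable_total.
  have e20 : (0 <= e / 2)%R by rewrite divr_ge0// ltW.
  have -> : e%:E = (e / 2)%:E * \int[Pi]_f (1 + total n m f)%:E.
    rewrite ge0_integralD_real//; last exact: measurable_total.
    rewrite (integral_total Pi_iid weight_mean n mm) m1 integral_cst_probability.
    by rewrite -EFinD -EFinM; congr EFin; rewrite mulrDr mulr1 -splitr.
  rewrite -!ge0_integralZl_real//.
  - rewrite -ge0_integralD_real//; last 4 first.
    + exact: measurable_funM.
    + exact: measurable_funM.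
    + by move=> f; rewrite mulr_ge0// saturate_ge0.
    + by move=> f; rewrite mulr_ge0// addr_ge0.
    apply: ge0_le_integral_real => //.
    + by apply: measurable_funD; exact: measurable_funM.
    move=> f; rewrite /saturate mul1r ger0_norm//.
    rewrite -{2}[total n m f]sqr_sqrtr//.
    set t := (1 + total n m f)%R; set s := Num.sqrt _.
    have t_gt0 : (0 < t)%R by rewrite ltr_wpDr.
    rewrite -subr_ge0 (_ : (_ - s = (s - e * t) ^+ 2 / (2 * e * t))%R).
      by rewrite divr_ge0 ?sqr_ge0// !mulr_ge0// ltW.
    by field; rewrite !gt_eqF.
  - by move=> f; rewrite addr_ge0.
  - by move=> f; rewrite saturate_ge0.
move=> e e0; pose e2 := (e / 2)%R.
have e20 : (0 < e2)%R by rewrite divr_gt0.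
(* With this threshold the first term of [bound] at [e2] is at most [e2]. *)
have small : \forall n \near \oo,
    (fine (\int[Pi]_f (saturate 1 (total n m f))%:E) < 2 * e2 * e2)%R.
  by apply: (cvgr_lt _ (fine_cvg sat_cvg0)); rewrite !mulr_gt0.
near=> n.
have fin : \int[Pi]_f (saturate 1 (total n m f))%:E \is a fin_num.
  by near: n; exact: cvg_is_fine sat_cvg0.
apply: le_trans (bound e2 n e20) _; rewrite -(fineK fin) -EFinM -EFinD lee_fin.
rewrite [leRHS](splitr e) lerD2r ler_pdivrMl ?mulr_gt0//.
by apply/ltW; near: n.
Unshelve. all: by end_near. Qed.

(** The mean of [saturate K] at the limit tends to 1 as [K] grows. For [K] large and then [n] large,
    [saturate K Z_n] has mean above [1 - e / 2], so the mass lost by saturation, which is at least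
    half of [Z_n] where [Z_n > K], is small. *)
Lemma total_uniformly_integrable m : mass_fun m -> m [::] = 1%R ->
  limit_mass Pi m = 1%R -> forall e : R, (0 < e)%R -> exists2 K : R, (1 <= K)%R &
  \forall n \near \oo,
    \int[Pi]_f (total n m f * (K < total n m f)%R%:R)%:E <= e%:E.
Proof.
move=> mm m1 lm1 e e0.
have lim0 f : (0 <= total_lim m f)%R by exact: total_lim_ge0.
have mlim := @measurable_total_lim R b m.
have sat_lim : \int[Pi]_f (saturate k.+1%:R (total_lim m f))%:E @[k --> \oo] --> 1.
  rewrite -[X in _ --> X%:E]lm1 (limit_massE Pi_iid weight_mean mm).
  have [|||||_ _ cv] := @dominated_convergence _ envT R Pi setT measurableT
    (fun k f => (saturate k.+1%:R (total_lim m f))%:E)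
    (fun f => (total_lim m f)%:E) (fun f => (total_lim m f)%:E); last exact: cv.
  - move=> k; apply/measurable_EFinP; apply: measurableT_comp mlim.
    exact: measurable_saturate.
  - by apply/measurable_EFinP.
  - apply: aeW => f _; apply: cvg_EFin; first by apply: nearW.
    rewrite (_ : _ \o _ = fun k => total_lim m f *
        (1 + total_lim m f * k.+1%:R^-1)^-1)%R; last first.
      apply/funext => k; rewrite /= /saturate ger0_norm//.
      by field; rewrite !gt_eqF ?ltr_wpDr ?ltr_wpDl// addr_gt0.
    rewrite -[X in _ --> X]mulr1; apply: cvgMl_tmp.
    rewrite -[X in _ --> X]invr1; apply: cvgV => //.
    rewrite -[X in _ --> X]addr0; apply: cvgD; first exact: cvg_cst.
    by rewrite -[X in _ --> X](mulr0 (total_lim m f)); apply: cvgMl_tmp; exact: cvg_harmonic.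
  - exact: (integrable_total_lim Pi_iid weight_mean mm).
  - apply: aeW => f k _ /=.
    by rewrite lee_fin ger0_norm ?saturate_le ?saturate_ge0.
have [k [kfin hk]] : exists k,
    \int[Pi]_f (saturate k.+1%:R (total_lim m f))%:E \is a fin_num /\
    (1 - e / 2 < fine (\int[Pi]_f (saturate k.+1%:R (total_lim m f))%:E))%R.
  have h1 := cvg_is_fine sat_lim.
  have h2 : \forall k \near \oo,
      (1 - e / 2 < fine (\int[Pi]_f (saturate k.+1%:R (total_lim m f))%:E))%R.
    by apply: (cvgr_gt _ (fine_cvg sat_lim)); rewrite gtrBl divr_gt0.
  by have [N _ /(_ N (leqnn _))[]] := filterI h1 h2; exists N.
pose K : R := k.+1%:R; have K0 : (0 < K)%R by [].
exists K; first by rewrite ler1n.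
have satn := integral_saturate_cvg K0 mm.
rewrite -(fineK kfin) in satn.
have big : \forall n \near \oo,
    (1 - e / 2 < fine (\int[Pi]_f (saturate K (total n m f))%:E))%R.
  exact: (cvgr_gt _ (fine_cvg satn)).
near=> n.
have fin : \int[Pi]_f (saturate K (total n m f))%:E \is a fin_num.
  by near: n; exact: cvg_is_fine satn.
have t0 f : (0 <= total n m f)%R by exact: total_ge0.
have mt := @measurable_total R b n m.
have msat : @measurable_fun _ _ envT R setT (fun f => saturate K (total n m f)).
  exact: measurableT_comp (measurable_saturate K0) mt.
have mind : @measurable_fun _ _ envT R setT (fun f => total n m f * (K < total n m f)%R%:R)%R.
  apply: measurable_funM => //.
  rewrite (_ : (fun f => _) = \1_[set f | K < total n m f]%R).
    apply: measurable_indic; rewrite -[X in measurable X]setTI.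
    have := mt measurableT `]K, +oo[%classic (measurable_itv _).
    by congr (measurable (_ `&` _)); apply/seteqP; split=> f /=; rewrite in_itv/= andbT.
  apply/funext => f; rewrite indicE; congr (_%:R); congr nat_of_bool.
  by apply/idP/idP => [/mem_set//|/set_mem].
(* Pointwise, [z - saturate K z = z * (z / (K + z))], and [z / (K + z)] is at least 1/2 once
   [z > K]. *)
have key : \int[Pi]_f (total n m f * (K < total n m f)%R%:R)%:E +
    2%:E * \int[Pi]_f (saturate K (total n m f))%:E <= 2%:E.
  have sat0 f : (0 <= saturate K (total n m f))%R by rewrite saturate_ge0.
  rewrite -[leRHS]mule1 -[X in _ <= _ * X%:E]m1 -(integral_total Pi_iid weight_mean n mm).
  rewrite -!ge0_integralZl_real// -ge0_integralD_real//; last 3 first.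
  - exact: measurable_funM.
  - by move=> f; rewrite mulr_ge0.
  - by move=> f; rewrite mulr_ge0.
  apply: ge0_le_integral_real => //.
  - by apply: measurable_funD => //; exact: measurable_funM.
  - exact: measurable_funM.
  - by move=> f; apply: addr_ge0; apply: mulr_ge0 => //; exact: ler0n.
  move=> f; have z0 := t0 f; rewrite saturateE//; set z := total n m f in z0 *.
  have Kz : (0 < K + z)%R by rewrite ltr_wpDr.
  case: ltP => Kltz /=; rewrite ?mulr1 ?mulr0.
    have : (2^-1 <= z / (K + z))%R by rewrite ler_pdivlMr//; lra.
    by nra.
  have : (0 <= z * (z / (K + z)))%R by rewrite !mulr_ge0// invr_ge0 ltW.
  by lra.
move: key; rewrite -(fineK fin) -EFinM -leeBrDr// -EFinB => /le_trans; apply.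
rewrite lee_fin.
have : (1 - e / 2 < fine (\int[Pi]_f (saturate K (total n m f))%:E))%R by near: n.
by lra.
Unshelve. all: by end_near. Qed.

End zero_one_law.

(** * Regular case *)

Section path_sums.
Context {R : realType} {b : nat}.
Notation env := (@env R b).
Notation envT := (@envT R b).
Implicit Types (f g : env) (m : seq 'I_b -> R) (u v : seq 'I_b) (j : 'I_b).

(** The function [tau] is left free: the regular case takes a truncated logarithm, the singular case
    a logarithm restricted to letters of positive mass. *)
Fixpoint path_sum (tau : 'I_b -> R -> R) v f : R :=
  if v is j :: v' then (tau j (weight [::] j f) + path_sum tau v' (subenv [:: j] f))%R
  else 0%R.

Variables (Pi : probability envT R) (lam : set (b.-tuple R) -> \bar R).
Hypothesis Pi_iid : iid_env Pi lam.
Hypothesis weight_mean : forall j, \int[Pi]_f (weight [::] j f)%:E = 1.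

Lemma integral_subenv u (F : env -> R) :
  Pi.-integrable setT (EFin \o F) ->
  Pi.-integrable setT (EFin \o (F \o subenv u)) /\
  \int[Pi]_f (F (subenv u f))%:E = \int[Pi]_f (F f)%:E.
Proof.
move=> iF; have mF := measurable_int _ iF.
have ms := @measurable_subenv R b u.
have i2 : Pi.-integrable setT ((EFin \o F) \o subenv u).
  apply/integrableP; split; first exact: measurableT_comp mF ms.
  have /integrableP[_] := iF; apply: le_lt_trans.
  rewrite -(@ge0_integral_subenv _ _ _ _ Pi_iid u (fun f => `|(F f)%:E|))//.
  by apply: measurableT_comp mF => //.
split=> //.
transitivity (\int[pushforward Pi (subenv u : envT -> envT)]_f (F f)%:E).
  by rewrite (@integral_pushforward _ _ envT envT R (subenv u) ms Pi setT (EFin \o F)).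
by apply: eq_measure_integral => A mA _; exact: (subenv_law Pi_iid).
Qed.

Lemma integrable_path_prod v : Pi.-integrable setT (EFin \o path_prod v).
Proof.
apply/integrableP; split.
  by apply/measurable_EFinP; exact: measurable_path_prod.
rewrite (eq_integral (fun f : envT => (path_prod v f)%:E)).
  by rewrite (integral_path_prod Pi_iid weight_mean) ltry.
by move=> f _; rewrite /= ger0_norm ?path_prod_ge0.
Qed.

Lemma integrable_weight j : Pi.-integrable setT (EFin \o weight [::] j).
Proof.
apply/integrableP; split.
  by apply/measurable_EFinP; exact: measurable_weight.
rewrite (eq_integral (fun f : envT => (weight [::] j f)%:E)).
  by rewrite weight_mean ltry.
by move=> f _; rewrite /= ger0_norm ?weight_ge0.
Qed.

Variables (tau : 'I_b -> R -> R) (l : 'I_b -> R).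
Hypothesis tau_integrable : forall j,
  Pi.-integrable setT (EFin \o (fun f => weight [::] j f * tau j (weight [::] j f))%R).
Hypothesis tau_mean : forall j,
  \int[Pi]_f (weight [::] j f * tau j (weight [::] j f))%:E = (l j)%:E.

(** Under the density [path_prod v] the term of a letter [j] has mean [l j], since all the other
    factors are independent of it and have mean 1. *)
Lemma integral_path_sum v :
  Pi.-integrable setT (EFin \o (fun f => path_prod v f * path_sum tau v f)%R) /\
  \int[Pi]_f (path_prod v f * path_sum tau v f)%:E = (\sum_(j <- v) l j)%:E.
Proof.
elim: v => [|j v [iv ev]] /=.
  split; last by under eq_integral do rewrite mulr0; rewrite integral0 big_nil.
  by apply: eq_integrable (integrable0 Pi setT) => // f _; rewrite /= mulr0.
(* The root vector is separated from the weights at all longer words. *)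
pose root : pred (seq 'I_b) := fun u => u == [::].
have [iQ eQ] := integral_subenv [:: j] (integrable_path_prod v).
have [iS eS] := integral_subenv [:: j] iv.
have [i1 e1] := @integrable_indep R b Pi lam Pi_iid root
  (fun f => weight [::] j f * tau j (weight [::] j f))%R
  (path_prod v \o subenv [:: j]) (tau_integrable j) iQ
  (fun f g => erefl) (fun f g => erefl).
have [i2 e2] := @integrable_indep R b Pi lam Pi_iid root (weight [::] j)
  ((fun f => path_prod v f * path_sum tau v f)%R \o subenv [:: j])
  (integrable_weight j) iS (fun f g => erefl) (fun f g => erefl).
pose w f := weight [::] j f.
have split f : (w f * path_prod v (subenv [:: j] f) *
    (tau j (w f) + path_sum tau v (subenv [:: j] f)))%:E =
    (w f * tau j (w f) * path_prod v (subenv [:: j] f))%:E +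
    (w f * (path_prod v (subenv [:: j] f) * path_sum tau v (subenv [:: j] f)))%:E.
  by rewrite -EFinD; congr EFin; ring.
split.
  have := integrableD measurableT i1 i2; apply: eq_integrable => // f _.
  by rewrite /= split.
under eq_integral do rewrite split.
rewrite integralD// [X in X + _]e1 [X in _ + X]e2 tau_mean weight_mean.
rewrite [X in _ * X + _]eQ [X in _ + _ * X]eS ev.
by rewrite (integral_path_prod Pi_iid weight_mean) mule1 mul1e -EFinD big_cons.
Qed.

End path_sums.

(** * Stationary word masses and their entropy rate *)

Section invariant_masses.
Context {R : realType} {b : nat}.
Implicit Types (m : seq 'I_b -> R) (v : seq 'I_b) (j : 'I_b).
Local Open Scope ring_scope.

Definition shift_invariant m := forall v, m v = \sum_j m (j :: v).

Definition word_entropy m n : R := - \sum_(v : n.-tuple 'I_b) xlnx (m v).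

Variable m : seq 'I_b -> R.
Hypotheses (m_mass : mass_fun m) (m1 : m [::] = 1) (m_inv : shift_invariant m).

Let m_ge0 v : 0 <= m v. Proof. exact: m_mass.1. Qed.

Lemma invariant_mass_cons_le j v : m (j :: v) <= m v.
Proof. by rewrite [leRHS]m_inv; apply: (@ler_sum_term _ _ (fun j => m (j :: v))). Qed.

Lemma mass_cons_le j v : m (j :: v) <= m [:: j].
Proof.
elim/last_ind: v => // v i; apply: le_trans.
rewrite -rcons_cons [leRHS](m_mass.2).
exact: (@ler_sum_term _ _ (fun i => m (rcons (j :: v) i))).
Qed.

Lemma mass_le1 v : m v <= 1.
Proof.
by elim: v => [|j v]; [rewrite m1|apply: le_trans; exact: invariant_mass_cons_le].
Qed.

Lemma mass_letter_gt0 v j : 0 < m v -> j \in v -> 0 < m [:: j].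
Proof.
elim: v => // i v ih mv; rewrite inE => /predU1P[->|].
  exact: lt_le_trans mv (mass_cons_le _ _).
by apply: ih; exact: lt_le_trans mv (invariant_mass_cons_le _ _).
Qed.

(** Consistency gives the first letter the weights [m [:: j]], and invariance gives the rest of the
    word the masses [m] again; induction on the length follows. *)
Lemma sum_words_letters (l : 'I_b -> R) n :
  \sum_(v : n.-tuple 'I_b) m v * (\sum_(j <- v) l j) = n%:R * \sum_j m [:: j] * l j.
Proof.
elim: n => [|n ih].
  by rewrite (sum_words0 (fun v => m v * (\sum_(j <- v) l j))) big_nil mulr0 mul0r.
rewrite (sum_words_cons _ (fun v => m v * (\sum_(j <- v) l j))).
transitivity (\sum_j m [:: j] * l j +
    \sum_j \sum_(v : n.-tuple 'I_b) m (j :: v) * (\sum_(i <- v) l i)).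
  rewrite -big_split/=; apply: eq_bigr => j _.
  rewrite -[m [:: j]]/(mass_shift [:: j] m [::]).
  rewrite (mass_fun_nil n (mass_fun_shift _ m_mass)) mulr_suml -big_split/=.
  by apply: eq_bigr => v _; rewrite big_cons mulrDr.
rewrite exchange_big/= (eq_bigr (fun v : n.-tuple 'I_b => m v * (\sum_(i <- v) l i))).
  by rewrite ih -natr1 mulrDl mul1r addrC.
by move=> v _; rewrite -mulr_suml -m_inv.
Qed.

(** Conditional entropy of the first letter given the [n] letters that follow it. *)
Let cond_entropy n := \sum_(v : n.-tuple 'I_b) eta (fun j => m (j :: v)).

Let word_entropyS n : word_entropy m n.+1 = word_entropy m n + cond_entropy n.
Proof.
rewrite /word_entropy (sum_words_cons _ (fun v => xlnx (m v))) exchange_big/=.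
rewrite -!sumrN -big_split/=; apply: eq_bigr => v _.
by rewrite /eta -m_inv addrA addNr add0r.
Qed.

Let word_entropyE n : word_entropy m n = series cond_entropy n.
Proof.
elim: n => [|n ih].
  rewrite /word_entropy (sum_words0 (fun v => xlnx (m v))) m1 /xlnx ln1 mulr0 oppr0.
  by rewrite /series/= big_geq.
by rewrite word_entropyS ih seriesSr.
Qed.

Let cond_entropy_ge0 n : 0 <= cond_entropy n.
Proof. by apply: sumr_ge0 => v _; exact: eta_ge0. Qed.

(** Conditioning on one more letter lowers entropy: superadditivity of [eta] over the last
    letter. *)
Let cond_entropy_nonincreasing n : cond_entropy n.+1 <= cond_entropy n.
Proof.
rewrite /cond_entropy (sum_words_rcons _ (fun v => eta (fun j => m (j :: v)))).
apply: ler_sum => v _.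
apply: le_trans (eta_superadd_sum (index_enum _)
  (a := fun i j => m (j :: rcons v i)) _) _ => //.
rewrite le_eqVlt; apply/orP; left; apply/eqP; congr eta; apply/funext => j.
exact/esym/m_mass.2.
Qed.

(** The entropy is a Cesaro mean of conditional entropies, which are nonnegative and nonincreasing.
    Convergence is what gives the [limn] in the entropy its meaning. *)
Lemma word_entropy_rate_cvg : cvgn (fun n => n%:R^-1 * word_entropy m n).
Proof.
have cc : cvgn cond_entropy.
  apply: nonincreasing_is_cvgn.
    by apply/nonincreasing_seqP => n; exact: cond_entropy_nonincreasing.
  by exists 0 => _ [n _ <-]; exact: cond_entropy_ge0.
apply/cvg_ex; exists (limn cond_entropy).
rewrite -(cvg_shiftn 1); apply: cvg_trans (cesaro cc).
rewrite (_ : arithmetic_mean cond_entropy =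
  (fun n => (n + 1)%:R^-1 * word_entropy m (n + 1)))//.
by apply/funext => n; rewrite addn1 word_entropyE.
Qed.

End invariant_masses.

Lemma integrable_lincomb d (T : measurableType d) (R : realType)
    (mu : {measure set T -> \bar R}) (I : finType) (c : I -> R) (G : I -> T -> R) :
  (forall i, mu.-integrable setT (EFin \o G i)) ->
  mu.-integrable setT (fun x => (\sum_i c i * G i x)%:E) /\
  \int[mu]_x (\sum_i c i * G i x)%:E = \sum_i (c i)%:E * \int[mu]_x (G i x)%:E.
Proof.
move=> iG; have icG i : mu.-integrable setT (fun x => (c i)%:E * (G i x)%:E).
  exact: (integrableZl measurableT (c i) (iG i)).
have sE x : (\sum_i c i * G i x)%:E = \sum_i (c i)%:E * (G i x)%:E.
  by rewrite -sumEFin; apply: eq_bigr => i _; rewrite EFinM.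
split.
  have := integrable_sum measurableT (index_enum I) (P := xpredT) (fun i _ => icG i).
  by apply: eq_integrable => // x _; rewrite sE.
under eq_integral do rewrite sE.
rewrite integral_sum//; apply: eq_bigr => i _.
exact: (integralZl measurableT (iG i)).
Qed.

Section regular_case.
Context {R : realType} {b : nat}.
Notation env := (@env R b).
Notation envT := (@envT R b).
Implicit Types (f g : env) (u v : seq 'I_b) (j : 'I_b).

(** The cut is from above only: [z * ln z >= -1] already controls the other side, so
    [V_j * truncated_ln c V_j] is integrable as soon as [V_j] is. *)
Definition truncated_ln (c z : R) : R := Num.min (ln z) c.

Lemma measurable_truncated_ln c : measurable_fun setT (truncated_ln c).
Proof. by apply: measurable_minr => //; exact: measurable_ln. Qed.

Lemma mul_truncated_ln_ge c z : (0 <= c)%R -> (0 <= z)%R -> (- 1 <= z * truncated_ln c z)%R.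
Proof.
move=> c0 z0; rewrite /truncated_ln minEle; case: ifP => _.
  by apply: le_trans (xlnx_ge z0); rewrite lerBrDr addNr.
by apply: (@le_trans _ _ 0%R); rewrite ?oppr_le0// mulr_ge0.
Qed.

Lemma path_sum_truncated_le c v f : (0 <= c)%R ->
  (path_sum (fun=> truncated_ln c) v f <= (size v)%:R * c)%R.
Proof.
move=> c0; elim: v f => [|j v ih] f /=; first by rewrite mul0r.
by rewrite -natr1 mulrDl mul1r addrC lerD// ge_min lexx orbT.
Qed.

Lemma path_sum_truncated_ln c v f : (0 < path_prod v f)%R ->
  (path_sum (fun=> truncated_ln c) v f <= ln (path_prod v f))%R.
Proof.
elim: v f => [|j v ih] f /=; first by rewrite ln1.
have w0 := weight_ge0 [::] j f; have Q0 := path_prod_ge0 v (subenv [:: j] f).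
move=> wQ; have w_gt0 : (0 < weight [::] j f)%R.
  by rewrite lt_neqAle w0 andbT; apply: contraTneq wQ => <-; rewrite mul0r ltxx.
have Q_gt0 : (0 < path_prod v (subenv [:: j] f))%R.
  by rewrite lt_neqAle Q0 andbT; apply: contraTneq wQ => <-; rewrite mulr0 ltxx.
by rewrite lnM// lerD ?ih// ge_min lexx.
Qed.

Variables (Pi : probability envT R) (lam : set (b.-tuple R) -> \bar R).
Hypothesis Pi_iid : iid_env Pi lam.
Hypothesis weight_mean : forall j, \int[Pi]_f (weight [::] j f)%:E = 1.
Variable m : seq 'I_b -> R.
Hypotheses (m_mass : mass_fun m) (m1 : m [::] = 1%R) (m_inv : shift_invariant m).

Lemma integrable_truncated c j : (0 <= c)%R -> Pi.-integrable setT
  (EFin \o (fun f => weight [::] j f * truncated_ln c (weight [::] j f))%R).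
Proof.
move=> c0; have mw := @measurable_weight R b [::] j.
have iw1 : Pi.-integrable setT (fun f => (1 + c * weight [::] j f)%:E).
  have := integrableD measurableT (finite_measure_integrable_cst Pi 1%R measurableT)
    (integrableZl measurableT c (integrable_weight weight_mean j)).
  by apply: eq_integrable => // f _; rewrite /= EFinD EFinM.
apply: le_integrable iw1 => //.
  apply/measurable_EFinP/measurable_funM => //.
  exact: measurableT_comp (@measurable_truncated_ln c) mw.
move=> f _ /=; rewrite lee_fin; have w0 := weight_ge0 [::] j f.
rewrite [leRHS]ger0_norm ?addr_ge0 ?mulr_ge0// ler_norml.
have := mul_truncated_ln_ge c0 w0; set w := weight _ _ _ in w0 * => lo.
have cw0 : (0 <= c * w)%R by rewrite mulr_ge0.
have : (w * truncated_ln c w <= w * c)%R by rewrite ler_wpM2l// ge_min lexx orbT.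
by rewrite [(w * c)%R]mulrC => hi; apply/andP; split; lra.
Qed.

Definition truncated_mean c j : R :=
  fine (\int[Pi]_f (weight [::] j f * truncated_ln c (weight [::] j f))%:E).

Let truncated_meanE c j : (0 <= c)%R ->
  \int[Pi]_f (weight [::] j f * truncated_ln c (weight [::] j f))%:E =
  (truncated_mean c j)%:E.
Proof.
move=> c0; rewrite /truncated_mean fineK// integrable_fin_num//.
exact: integrable_truncated.
Qed.

(** The bound holds word by word. If [Z_n <= K], then [m v * path_prod v f <= Z_n] bounds the
    logarithms by [ln K]. Otherwise each truncated logarithm is at most [c], while
    [ln (m v) <= 0 <= ln K]. *)
Let truncated_pointwise c K n f : (0 <= c)%R -> (1 <= K)%R ->
  (\sum_(v : n.-tuple 'I_b) m v * (path_prod v f * path_sum (fun=> truncated_ln c) v f) +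
   \sum_(v : n.-tuple 'I_b) xlnx (m v) * path_prod v f <=
   ln K * total n m f + n%:R * c * (total n m f * (K < total n m f)%R%:R))%R.
Proof.
move=> c0 K1; set Z := total n m f; set I : R := (K < Z)%R%:R.
have -> : (ln K * Z + n%:R * c * (Z * I) =
    \sum_(v : n.-tuple 'I_b) m v * path_prod v f * (ln K + n%:R * c * I))%R.
  by rewrite -mulr_suml -/(total n m f) -/Z; ring.
rewrite -big_split/=; apply: ler_sum => v _.
have m0 := m_mass.1 v; have Q0 := path_prod_ge0 v f.
set S := path_sum _ _ _.
have -> : (m v * (path_prod v f * S) + xlnx (m v) * path_prod v f =
          m v * path_prod v f * (S + ln (m v)))%R by rewrite /xlnx; ring.
have a0 : (0 <= m v * path_prod v f)%R by rewrite mulr_ge0.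
have [->|aN0] := eqVneq (m v * path_prod v f)%R 0%R; first by rewrite !mul0r.
move: (aN0); rewrite mulf_eq0 negb_or => /andP[mN0 QN0].
have mv0 : (0 < m v)%R by rewrite lt_neqAle eq_sym mN0.
have Qv0 : (0 < path_prod v f)%R by rewrite lt_neqAle eq_sym QN0.
rewrite ler_wpM2l// /I; have [ZK|ZK] := leP Z K; rewrite ?mulr0 ?addr0 ?mulr1.
  apply: (@le_trans _ _ (ln (m v * path_prod v f))).
    by rewrite lnM// addrC lerD2l path_sum_truncated_ln.
  rewrite ler_ln ?posrE ?mulr_gt0// ?(lt_le_trans ltr01 K1)//.
  apply: le_trans ZK; rewrite /Z /total.
  apply: (@ler_sum_term _ _ (fun v : n.-tuple 'I_b => m v * path_prod v f)%R).
  by move=> u; rewrite mulr_ge0 ?(m_mass.1 _) ?path_prod_ge0.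
rewrite addrC lerD//.
  by apply: (@le_trans _ _ 0%R); [rewrite ln_le0// mass_le1|rewrite ln_ge0].
by have := path_sum_truncated_le v f c0; rewrite size_tuple.
Qed.

Let truncated_bound c K n : (0 <= c)%R -> (1 <= K)%R ->
  (n%:R * (\sum_j m [:: j] * truncated_mean c j) - word_entropy m n)%:E <=
  (ln K)%:E + (n%:R * c)%:E * \int[Pi]_f (total n m f * (K < total n m f)%R%:R)%:E.
Proof.
move=> c0 K1.
have iS v := integral_path_sum Pi_iid weight_mean (tau := fun=> truncated_ln c)
  (fun j => integrable_truncated j c0) (fun j => truncated_meanE j c0) v.
have [i1 e1] := @integrable_lincomb _ envT R Pi _ (fun v : n.-tuple 'I_b => m v)
  (fun (v : n.-tuple 'I_b) f => path_prod v f * path_sum (fun=> truncated_ln c) v f)%R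
  (fun v : n.-tuple 'I_b => (iS v).1).
have [i2 e2] := @integrable_lincomb _ envT R Pi _ (fun v : n.-tuple 'I_b => xlnx (m v))
  (fun (v : n.-tuple 'I_b) f => path_prod v f) (fun v : n.-tuple 'I_b => integrable_path_prod Pi_iid weight_mean v).
have mt := @measurable_total R b n m.
have t0 f : (0 <= total n m f)%R by exact: total_ge0.
have iZ := integrable_total Pi_iid weight_mean n m_mass.
have iZK : Pi.-integrable setT (EFin \o (fun f => total n m f * (K < total n m f)%R%:R)%R).
  apply: le_integrable iZ => //.
    apply/measurable_EFinP; apply: measurable_funM => //.
    rewrite (_ : (fun f => _) = \1_[set f | K < total n m f]%R).
      apply: measurable_indic; rewrite -[X in measurable X]setTI.
      have := mt measurableT `]K, +oo[%classic (measurable_itv _).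
      by congr (measurable (_ `&` _)); apply/seteqP; split=> f /=; rewrite in_itv/= andbT.
    apply/funext => f; rewrite indicE; congr (_%:R); congr nat_of_bool.
    by apply/idP/idP => [/mem_set//|/set_mem].
  move=> f _ /=; rewrite lee_fin !ger0_norm ?mulr_ge0//.
  by rewrite ler_piMr// lern1 leq_b1.
have e3 : (n%:R * (\sum_j m [:: j] * truncated_mean c j) - word_entropy m n)%:E =
    \int[Pi]_f (\sum_(v : n.-tuple 'I_b)
      m v * (path_prod v f * path_sum (fun=> truncated_ln c) v f))%:E +
    \int[Pi]_f (\sum_(v : n.-tuple 'I_b) xlnx (m v) * path_prod v f)%:E.
  rewrite e1 e2 EFinB -(sum_words_letters m_mass m_inv) /word_entropy EFinN oppeK.
  congr (_ + _).
    by rewrite -sumEFin; apply: eq_bigr => v _; rewrite (iS v).2 EFinM.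
  rewrite -sumEFin; apply: eq_bigr => v _.
  by rewrite (integral_path_prod Pi_iid weight_mean) mule1.
rewrite e3 -integralD//.
apply: le_trans (le_integral measurableT _ _ _) _.
- exact: integrableD.
- exact: (integrableD measurableT (integrableZl measurableT (ln K) iZ)
            (integrableZl measurableT (n%:R * c) iZK)).
- move=> f _; rewrite -EFinD -!EFinM -EFinD lee_fin.
  exact: truncated_pointwise.
rewrite integralD//; [|exact: (integrableZl measurableT _ iZ)|exact: (integrableZl measurableT _ iZK)].
rewrite (integralZl measurableT iZ) (integralZl measurableT iZK) (integral_total Pi_iid weight_mean n m_mass) m1 mule1.
exact: lexx.
Qed.

(* Under the size-biased law the logarithm of [Q_n nu[x|n]] is bounded by that
   of [Z_n], which is tight in the regular case; the truncation at [c] turns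
   the small exceptional probability into a small mean. *)
Theorem regular_truncated_le c : limit_mass Pi m = 1%R -> (0 <= c)%R ->
  (\sum_j m [:: j] * truncated_mean c j <= limn (fun n => n%:R^-1 * word_entropy m n))%R.
Proof.
move=> lm1 c0; set hc := (\sum_j _)%R; set h := limn _.
have hcvg : (fun n => n%:R^-1 * word_entropy m n)%R @ \oo --> h.
  exact: (word_entropy_rate_cvg m_mass m1 m_inv).
apply/ler_addgt0Pr => _/posnumP[e].
(* Dividing by [c + 1] keeps the tail term, which carries a factor [c], below [e / 2] even for
   [c = 0]. *)
have d0 : (0 < e%:num / 2 / (c + 1))%R by rewrite !divr_gt0// ltr_wpDl.
have [K K1 hK] := total_uniformly_integrable Pi_iid weight_mean m_mass m1 lm1 d0.
have lncvg : (fun n => n%:R^-1 * word_entropy m n + (n%:R^-1 * ln K + e%:num / 2) : R)%R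
    @ \oo --> (h + (0 * ln K + e%:num / 2))%R.
  apply: cvgD => //; apply: cvgD; last exact: cvg_cst.
  apply: cvgMr_tmp; rewrite -(cvg_shiftn 1).
  rewrite (_ : [sequence _]_n = harmonic)//; first exact: cvg_harmonic.
  by apply/funext => n; rewrite /= addn1.
have : (h + (0 * ln K + e%:num / 2) <= h + e%:num)%R.
  by rewrite mul0r add0r lerD2l ler_pdivrMr// ler_pMr// ler1n.
apply: le_trans; apply: (cvgr_to_ge lncvg); near=> n.
have n0 : (0 < n%:R :> R)%R by rewrite ltr0n; near: n; exists 1%N.
have : (n%:R * hc - word_entropy m n)%:E <=
    (ln K)%:E + (n%:R * c)%:E * (e%:num / 2 / (c + 1))%:E.
  apply: le_trans (truncated_bound n c0 K1) _; rewrite leeD2l// lee_wpmul2l//.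
    by rewrite lee_fin mulr_ge0.
  by near: n.
rewrite -EFinM -EFinD lee_fin => h1.
have h2 : (c * (e%:num / 2 / (c + 1)) <= e%:num / 2)%R.
  rewrite mulrA ler_pdivrMr ?ltr_wpDl// [leRHS]mulrDr mulr1 mulrC lerDl.
  by rewrite divr_ge0.
have h3 : (n%:R * hc <= word_entropy m n + (ln K + n%:R * (e%:num / 2)))%R.
  move: h1; rewrite lerBlDl => /le_trans; apply; rewrite lerD2l// lerD2l//.
  rewrite -[(n%:R * c * _)%R]mulrA.
  by rewrite ler_pM2l.
rewrite -(ler_pM2l n0); apply: (le_trans h3).
rewrite le_eqVlt; apply/orP; left; apply/eqP.
by field; rewrite gt_eqF.
Unshelve. all: by end_near. Qed.

End regular_case.

Section regular_entropy.
Context {R : realType} {b : nat}.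
Notation env := (@env R b).
Notation envT := (@envT R b).
Implicit Types (f g : env) (u v : seq 'I_b) (j : 'I_b).
Variables (Pi : probability envT R) (lam : set (b.-tuple R) -> \bar R).
Hypothesis Pi_iid : iid_env Pi lam.
Hypothesis weight_mean : forall j, \int[Pi]_f (weight [::] j f)%:E = 1.
Variable m : seq 'I_b -> R.
Hypotheses (m_mass : mass_fun m) (m1 : m [::] = 1%R) (m_inv : shift_invariant m).

Lemma measurable_xlnx : measurable_fun setT (@xlnx R).
Proof. by apply: measurable_funM => //; exact: measurable_ln. Qed.

Let mxw j : @measurable_fun _ _ envT R setT (fun f => xlnx (weight [::] j f)).
Proof. exact: measurableT_comp measurable_xlnx (@measurable_weight R b [::] j). Qed.

Let letters_sum1 : (\sum_j m [:: j] = 1)%R.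
Proof. by rewrite -m1 (m_mass.2 [::]). Qed.

(** The truncations increase to the logarithm, so monotone convergence carries the truncated
    inequalities to the limit. The limiting bound itself shows that the means are finite for letters
    of positive mass. *)
Lemma regular_entropy_le : limit_mass Pi m = 1%R ->
  \sum_j \int[Pi]_f (xlnx (weight [::] j f))%:E * (m [:: j])%:E <=
  (limn (fun n => n%:R^-1 * word_entropy m n)%R)%:E.
Proof.
move=> lm1; set h := limn _.
(* The added 1 makes the integrands nonnegative. *)
pose t k j f : R := (weight [::] j f * truncated_ln k%:R (weight [::] j f) + 1)%R.
have t0 k j f : (0 <= t k j f)%R.
  by rewrite -lerBlDr sub0r mul_truncated_ln_ge ?weight_ge0.
have mt k j : @measurable_fun _ _ envT R setT (t k j).
  apply: measurable_funD => //; apply: measurable_funM; first exact: measurable_weight.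
  exact: measurableT_comp (@measurable_truncated_ln R k%:R) (@measurable_weight R b [::] j).
have x0 j f : (0 <= xlnx (weight [::] j f) + 1)%R.
  by rewrite -lerBlDr sub0r (le_trans _ (xlnx_ge (weight_ge0 _ _ _)))// lerBrDr addNr weight_ge0.
have cvgt j : \int[Pi]_f (t k j f)%:E @[k --> \oo] -->
    \int[Pi]_f (xlnx (weight [::] j f) + 1)%:E.
  have := @cvg_monotone_convergence _ envT R Pi setT measurableT (fun k f => (t k j f)%:E).
  rewrite (eq_integral (fun f : envT => (xlnx (weight [::] j f) + 1)%:E)); last first.
    move=> f _; apply/cvg_lim => //; apply: cvg_near_cst.
    near=> k; rewrite /t /truncated_ln /xlnx min_l//.
    near: k; exact: nbhs_infty_ger.
  apply.
  - by move=> k; apply/measurable_EFinP.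
  - by move=> k f _; rewrite lee_fin.
  - move=> f _ k k' kk'; rewrite lee_fin lerD2r ler_wpM2l ?weight_ge0//.
    by rewrite /truncated_ln le_min ge_min lexx/= ge_min ler_nat kk' orbT.
have tE k j : \int[Pi]_f (t k j f)%:E = (truncated_mean Pi k%:R j + 1)%:E.
  have it := integrable_truncated weight_mean j (ler0n R k).
  under eq_integral do rewrite EFinD.
  rewrite integralD//; last exact: finite_measure_integrable_cst.
  by rewrite integral_cst_probability EFinD fineK// integrable_fin_num.
have bound k : \sum_j (m [:: j])%:E * \int[Pi]_f (t k j f)%:E <= (h + 1)%:E.
  have := regular_truncated_le Pi_iid weight_mean m_mass m1 m_inv lm1 (ler0n R k).
  rewrite -/h => hk; under eq_bigr do rewrite tE -EFinM.
  rewrite sumEFin lee_fin; under eq_bigr do rewrite mulrDr mulr1.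
  by rewrite big_split/= letters_sum1 lerD2r.
have xbound : \sum_j (m [:: j])%:E * \int[Pi]_f (xlnx (weight [::] j f) + 1)%:E <=
    (h + 1)%:E.
  have cv : \sum_j (m [:: j])%:E * \int[Pi]_f (t k j f)%:E @[k --> \oo] -->
      \sum_j (m [:: j])%:E * \int[Pi]_f (xlnx (weight [::] j f) + 1)%:E.
    apply: cvg_nnesum => j _.
      apply: nearW => k; rewrite mule_ge0 ?lee_fin ?(m_mass.1 _)// integral_ge0// => f _.
      by rewrite lee_fin.
    by apply: cvgeZl.
  rewrite -(cvg_lim _ cv)//; apply: lime_le; first by apply/cvg_ex; eexists; exact: cv.
  exact: nearW.
have m0 j : 0 <= (m [:: j])%:E by rewrite lee_fin (m_mass.1 _).
have A0 j : 0 <= \int[Pi]_f (xlnx (weight [::] j f) + 1)%:E.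
  by apply: integral_ge0 => f _; rewrite lee_fin.
have termE j : (m [:: j])%:E * \int[Pi]_f (xlnx (weight [::] j f) + 1)%:E =
    \int[Pi]_f (xlnx (weight [::] j f))%:E * (m [:: j])%:E + (m [:: j])%:E.
  (* A letter of zero mass may have an infinite mean; the convention [+oo * 0 = 0] removes it. *)
  have [->|mj] := eqVneq (m [:: j]) 0%R; first by rewrite mul0e mule0 adde0.
  have fin : \int[Pi]_f (xlnx (weight [::] j f) + 1)%:E < +oo.
    rewrite ltey; apply/eqP => oo; move: xbound; rewrite leNgt => /negP; apply.
    have mj0 : (0 < m [:: j])%R by rewrite lt_neqAle eq_sym mj (m_mass.1 _).
    rewrite (bigD1 j)//= oo mulry gtr0_sg// mul1e addye ?ltry//.
    rewrite -ltNye (lt_le_trans (ltNyr 0))//.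
    by apply: sume_ge0 => i _; rewrite mule_ge0.
  have i1 : Pi.-integrable setT (EFin \o (fun f => xlnx (weight [::] j f) + 1)%R).
    apply/integrableP; split; first by apply/measurable_EFinP; apply: measurable_funD.
    rewrite (eq_integral (fun f : envT => (xlnx (weight [::] j f) + 1)%:E))// => f _.
    by rewrite /= ger0_norm.
  have i2 : Pi.-integrable setT (EFin \o (fun f => xlnx (weight [::] j f))).
    have := integrableB measurableT i1 (finite_measure_integrable_cst Pi 1%R measurableT).
    by apply: eq_integrable => // f _; rewrite /= -EFinB addrK.
  rewrite muleC; under eq_integral do rewrite EFinD.
  rewrite integralD//; last exact: finite_measure_integrable_cst.
  rewrite integral_cst_probability -(fineK (integrable_fin_num measurableT i2)).
  set a := fine _.
  by rewrite -[LHS]/(((a + 1) * m [:: j])%:E) mulrDl mul1r.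
move: xbound; under eq_bigr do rewrite termE.
rewrite big_split/= sumEFin letters_sum1 EFinD leeD2rE//.
Unshelve. all: by end_near. Qed.

End regular_entropy.

(** * Singular case *)

Lemma measurable_sum_cond d (T : measurableType d) (R : realType) (I : finType)
    (A : pred I) (h : I -> T -> R) : (forall i, measurable_fun setT (h i)) ->
  measurable_fun setT (fun x => \sum_(i | A i) h i x)%R.
Proof.
move=> mh; rewrite (_ : (fun x => _) = fun x => \sum_i if A i then h i x else 0)%R.
  by apply: measurable_sum => i; case: (A i).
by apply/funext => x; rewrite big_mkcond.
Qed.

Section singular_case.
Context {R : realType} {b : nat}.
Notation env := (@env R b).
Notation envT := (@envT R b).
Implicit Types (f g : env) (m : seq 'I_b -> R) (u v : seq 'I_b) (j : 'I_b).

(* [Z_n] times the entropy of the level-[n] word under the normalised measure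
   [Q_n nu / Z_n], unfolded letter by letter by the chain rule. *)
Fixpoint path_entropy n m f : R :=
  if n is n'.+1 then
    (eta (fun j => weight [::] j f * total n' (mass_shift [:: j] m) (subenv [:: j] f)) +
     \sum_j weight [::] j f * path_entropy n' (mass_shift [:: j] m) (subenv [:: j] f))%R
  else 0%R.

Lemma path_entropy_ge0 n m f : mass_fun m -> (0 <= path_entropy n m f)%R.
Proof.
elim: n m f => [|n ih] m f mm //=.
rewrite addr_ge0//.
  apply: eta_ge0 => j; rewrite mulr_ge0 ?weight_ge0// total_ge0//.
  exact: mass_fun_shift.
by apply: sumr_ge0 => j _; rewrite mulr_ge0 ?weight_ge0// ih//; exact: mass_fun_shift.
Qed.

Lemma measurable_eta d (T : measurableType d) (a : 'I_b -> T -> R) :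
  (forall j, measurable_fun setT (a j)) ->
  measurable_fun setT (fun x => eta (fun j => a j x)).
Proof.
move=> ma; apply: measurable_funB.
  apply: (measurableT_comp measurable_xlnx).
  by apply: measurable_sum => j.
by apply: measurable_sum => j; exact: (measurableT_comp measurable_xlnx).
Qed.

Let measurable_step (F : env -> R) j : @measurable_fun _ _ envT R setT F ->
  @measurable_fun _ _ envT R setT (fun f => weight [::] j f * F (subenv [:: j] f))%R.
Proof.
move=> mF; apply: measurable_funM; first exact: measurable_weight.
exact: (measurableT_comp mF (@measurable_subenv R b [:: j])).
Qed.

Lemma measurable_path_entropy n m : @measurable_fun _ _ envT R setT (path_entropy n m).
Proof.
elim: n m => [|n ih] m /=; first exact: measurable_cst.
apply: measurable_funD.
  by apply: measurable_eta => j; apply: measurable_step; exact: measurable_total.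
by apply: measurable_sum => j; exact: measurable_step.
Qed.

Lemma path_entropy_superadd n m m' f : mass_fun m -> mass_fun m' ->
  (path_entropy n m f + path_entropy n m' f <=
   path_entropy n (fun v => m v + m' v) f)%R.
Proof.
elim: n m m' f => [|n ih] m m' f mm mm' /=; first by rewrite addr0.
rewrite addrACA lerD//.
  apply: le_trans (eta_superadd _ _) _.
  - by move=> j; rewrite mulr_ge0 ?weight_ge0// total_ge0//; exact: mass_fun_shift.
  - by move=> j; rewrite mulr_ge0 ?weight_ge0// total_ge0//; exact: mass_fun_shift.
  rewrite le_eqVlt; apply/orP; left; apply/eqP; congr eta; apply/funext => j.
  by rewrite -mulrDr -total_add.
rewrite -big_split/=; apply: ler_sum => j _; rewrite -mulrDr.
by rewrite ler_wpM2l ?weight_ge0// ih//; exact: mass_fun_shift.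
Qed.

Lemma mass_fun_sum (I : Type) (r : seq I) (M : I -> seq 'I_b -> R) :
  (forall i, mass_fun (M i)) -> mass_fun (fun v => \sum_(i <- r) M i v)%R.
Proof.
move=> MM; split=> v; first by apply: sumr_ge0 => i _; exact: (MM i).1.
by rewrite exchange_big/=; apply: eq_bigr => i _; exact: (MM i).2.
Qed.

Lemma path_entropy_superadd_sum (I : Type) (r : seq I) n (M : I -> seq 'I_b -> R) f :
  (forall i, mass_fun (M i)) ->
  (\sum_(i <- r) path_entropy n (M i) f <=
   path_entropy n (fun v => \sum_(i <- r) M i v) f)%R.
Proof.
move=> MM; elim: r => [|i r ih].
  by rewrite big_nil path_entropy_ge0//; exact: mass_fun_sum.
rewrite big_cons (_ : (fun v => _) = (fun v => M i v + \sum_(i <- r) M i v)%R); last first.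
  by apply/funext => v; rewrite big_cons.
apply: le_trans (path_entropy_superadd _ _ _ _) => //; last exact: mass_fun_sum.
by rewrite lerD2l.
Qed.

(** Chain rule. The recursive form serves to bound the increments in [n], this closed form to
    compare with [word_entropy] and the weights. *)
Lemma path_entropyE n m f : mass_fun m -> path_entropy n m f =
  (xlnx (total n m f) - \sum_(v : n.-tuple 'I_b) xlnx (m v * path_prod v f))%R.
Proof.
elim: n m f => [|n ih] m f mm /=.
  by rewrite (sum_words0 (fun v => xlnx (m v * path_prod v f))%R) total0 /= mulr1 subrr.
rewrite total_cons (sum_words_cons _ (fun v => xlnx (m v * path_prod v f))%R) /eta.
rewrite -addrA; congr (_ + _)%R; rewrite -!sumrN -big_split/=; apply: eq_bigr => j _.
have ms : mass_fun (mass_shift [:: j] m) by exact: mass_fun_shift.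
set w := weight _ _ _; set g := subenv _ _.
have w0 : (0 <= w)%R by exact: weight_ge0.
rewrite ih// xlnxM ?total_ge0// mulrBr.
have -> : (\sum_(v : n.-tuple 'I_b) xlnx (m (j :: v) * (w * path_prod v g)) =
    total n (mass_shift [:: j] m) g * xlnx w +
    w * \sum_(v : n.-tuple 'I_b) xlnx (mass_shift [:: j] m v * path_prod v g))%R.
  rewrite /total mulr_suml mulr_sumr -big_split/=; apply: eq_bigr => v _.
  have a0 : (0 <= m (j :: v) * path_prod v g)%R by rewrite mulr_ge0 ?(mm.1 _) ?path_prod_ge0.
  by rewrite mulrCA (xlnxM w0 a0).
by ring.
Qed.

Variables (Pi : probability envT R) (lam : set (b.-tuple R) -> \bar R).
Hypothesis Pi_iid : iid_env Pi lam.
Hypothesis weight_mean : forall j, \int[Pi]_f (weight [::] j f)%:E = 1.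

Lemma integral_weight_subenv j (F : env -> R) :
  @measurable_fun _ _ envT R setT F -> (forall f, (0 <= F f)%R) ->
  \int[Pi]_f (weight [::] j f * F (subenv [:: j] f))%:E = \int[Pi]_f (F f)%:E.
Proof.
move=> mF F0.
have mFs : @measurable_fun _ _ envT R setT (F \o subenv [:: j]).
  exact: (measurableT_comp mF (@measurable_subenv R b [:: j])).
under eq_integral do rewrite EFinM.
rewrite (@ge0_integral_indep _ _ _ _ Pi_iid (pred1 [::])
  (fun f => (weight [::] j f)%:E) (fun f => (F (subenv [:: j] f))%:E))//.
- rewrite weight_mean mul1e.
  by rewrite (ge0_integral_subenv Pi_iid [:: j] (F := fun f => (F f)%:E))//;
    apply/measurable_EFinP.
- by apply/measurable_EFinP; exact: measurable_weight.
- by apply/measurable_EFinP.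
- by move=> f; rewrite lee_fin weight_ge0.
- by move=> f; rewrite lee_fin.
Qed.

Lemma integral_path_entropyS n m : mass_fun m ->
  \int[Pi]_f (path_entropy n.+1 m f)%:E =
  \int[Pi]_f (eta (fun j => weight [::] j f *
     total n (mass_shift [:: j] m) (subenv [:: j] f))%R)%:E +
  \sum_j \int[Pi]_f (path_entropy n (mass_shift [:: j] m) f)%:E.
Proof.
move=> mm /=; have ms j : mass_fun (mass_shift [:: j] m) by exact: mass_fun_shift.
rewrite ge0_integralD_real//; last 4 first.
- by apply: measurable_eta => j; apply: measurable_step; exact: measurable_total.
- by apply: measurable_sum => j; apply: measurable_step; exact: measurable_path_entropy.
- by move=> f; apply: eta_ge0 => j; rewrite mulr_ge0 ?weight_ge0 ?total_ge0.
- by move=> f; apply: sumr_ge0 => j _; rewrite mulr_ge0 ?weight_ge0 ?path_entropy_ge0.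
congr (_ + _); under eq_integral do rewrite -sumEFin.
rewrite ge0_integral_sum//.
- apply: eq_bigr => j _; apply: integral_weight_subenv.
    exact: measurable_path_entropy.
  by move=> f; exact: path_entropy_ge0.
- by move=> j; apply/measurable_EFinP; apply: measurable_step; exact: measurable_path_entropy.
- by move=> j f _; rewrite lee_fin mulr_ge0 ?weight_ge0 ?path_entropy_ge0.
Qed.

Section invariant.
Variable m : seq 'I_b -> R.
Hypotheses (m_mass : mass_fun m) (m1 : m [::] = 1%R) (m_inv : shift_invariant m).

Let ms j : mass_fun (mass_shift [:: j] m). Proof. exact: mass_fun_shift. Qed.

Let total_shift_le n j f : (total n (mass_shift [:: j] m) f <= total n m f)%R.
Proof.
apply: ler_sum => v _; rewrite ler_wpM2r ?path_prod_ge0//.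
exact: invariant_mass_cons_le.
Qed.

Let msqrt n m' : @measurable_fun _ _ envT R setT (fun f => Num.sqrt (total n m' f)).
Proof.
apply: measurableT_comp (@measurable_total R b n m').
by apply: continuous_measurable_fun; exact: sqrt_continuous.
Qed.

Let msqrtE n m' : @measurable_fun _ _ envT (\bar R) setT (fun f => (Num.sqrt (total n m' f))%:E).
Proof. by apply/measurable_EFinP; exact: msqrt. Qed.

(** From [2 sqrt z <= 1 + z]: invariance makes the total of the shifted masses at most [Z_n], which
    has mean 1. *)
Let integral_sqrt_le1 n j :
  \int[Pi]_f (Num.sqrt (total n (mass_shift [:: j] m) f))%:E <= 1.
Proof.
have mt : @measurable_fun _ _ envT R setT (fun f => 1 + total n m f)%R.
  by apply: measurable_funD => //; exact: measurable_total.
apply: (@le_trans _ _ (\int[Pi]_f (2^-1 * (1 + total n m f))%:E)).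
  apply: ge0_le_integral_real => //.
  - exact: measurable_funM.
  move=> f; have t0 := total_ge0 n f (ms j); have tt := total_shift_le n j f.
  have := sqr_sqrtr t0; have := sqrtr_ge0 (total n (mass_shift [:: j] m) f).
  set s := Num.sqrt _ => s0 s2; have := sqr_ge0 (s - 1)%R.
  by rewrite sqrrB s2 mulr1 expr1n -mulr_natl; lra.
rewrite ge0_integralZl_real// => [|f]; last by rewrite addr_ge0// total_ge0.
rewrite ge0_integralD_real//; last 2 first.
- exact: measurable_total.
- by move=> f; exact: total_ge0.
rewrite (integral_total Pi_iid weight_mean n m_mass) m1 integral_cst_probability.
by rewrite -EFinD -EFinM lee_fin; lra.
Qed.

(* The siblings' subtrees are independent of each other and of the root
   vector. *)
Let integral_sqrt_cross n i j : i != j ->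
  \int[Pi]_f (Num.sqrt (
    weight [::] i f * total n (mass_shift [:: i] m) (subenv [:: i] f) *
    (weight [::] j f * total n (mass_shift [:: j] m) (subenv [:: j] f))))%:E <=
  \int[Pi]_f (Num.sqrt (total n m f))%:E.
Proof.
move=> ij.
pose q k f := (Num.sqrt (total n (mass_shift [:: k] m) f)).
pose w f : R := (2^-1 * (weight [::] i f + weight [::] j f))%R.
have q0 k f : (0 <= q k f)%R by exact: sqrtr_ge0.
have w0 f : (0 <= w f)%R by rewrite mulr_ge0// addr_ge0 ?weight_ge0.
have mw : @measurable_fun _ _ envT R setT w.
  by apply: measurable_funM => //; apply: measurable_funD; exact: measurable_weight.
have mq k : @measurable_fun _ _ envT R setT (fun f => q k (subenv [:: k] f)).
  exact: (measurableT_comp (msqrt n (mass_shift [:: k] m)) (@measurable_subenv R b [:: k])).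
have mt k : @measurable_fun _ _ envT R setT
    (fun f => weight [::] k f * total n (mass_shift [:: k] m) (subenv [:: k] f))%R.
  by apply: measurable_step; exact: measurable_total.
(* The two root weights may be dependent, so the root of their product is bounded by their
   arithmetic mean [w], whose mean is 1. *)
apply: (@le_trans _ _ (\int[Pi]_f
    (w f * (q i (subenv [:: i] f) * q j (subenv [:: j] f)))%:E)).
  apply: ge0_le_integral_real => //.
  - apply: (measurableT_comp (continuous_measurable_fun (@sqrt_continuous R))).
    exact: measurable_funM.
  - by apply: measurable_funM => //; exact: measurable_funM.
  move=> f; have wi := weight_ge0 [::] i f; have wj := weight_ge0 [::] j f.
  rewrite mulrACA sqrtrM ?mulr_ge0// [X in (_ * X)%R]sqrtrM ?total_ge0//.
  rewrite ler_wpM2r ?mulr_ge0 ?sqrtr_ge0// sqrtrM// /w.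
  have := sqr_sqrtr wi; have := sqr_sqrtr wj.
  set x := Num.sqrt _; set y := Num.sqrt _ => <- <-.
  by have := sqr_ge0 (x - y)%R; rewrite sqrrB -mulr_natl; lra.
under eq_integral do rewrite EFinM.
rewrite (@ge0_integral_indep _ _ _ _ Pi_iid (pred1 [::]) (fun f => (w f)%:E)
  (fun f => (q i (subenv [:: i] f) * q j (subenv [:: j] f))%:E)) => [|||||//|//].
- have -> : \int[Pi]_f (w f)%:E = 1.
    rewrite ge0_integralZl_real//; last 2 first.
    - by apply: measurable_funD; exact: measurable_weight.
    - by move=> f; rewrite addr_ge0 ?weight_ge0.
    rewrite ge0_integralD_real; [|exact: measurable_weight|exact: measurable_weight|
      by move=> f; exact: weight_ge0|by move=> f; exact: weight_ge0].
    by rewrite !weight_mean -EFinD -EFinM; congr EFin; rewrite mulVf.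
  rewrite mul1e; under eq_integral do rewrite EFinM.
  (* The words of the subtree at [i]; those of the subtree at [j] lie outside. *)
  pose starts_i : pred (seq 'I_b) := fun u => if u is k :: _ then k == i else false.
  rewrite (@ge0_integral_indep _ _ _ _ Pi_iid starts_i
    (fun f => (q i (subenv [:: i] f))%:E) (fun f => (q j (subenv [:: j] f))%:E)).
  + rewrite (ge0_integral_subenv Pi_iid [:: i] (F := fun f => (q i f)%:E));
      [|exact: msqrtE|by move=> f; rewrite lee_fin].
    rewrite (ge0_integral_subenv Pi_iid [:: j] (F := fun f => (q j f)%:E));
      [|exact: msqrtE|by move=> f; rewrite lee_fin].
    (* One factor is bounded by 1, and the other by the mean of [sqrt Z_n], as shifting lowers the
       masses. *)
    apply: (@le_trans _ _ (1 * \int[Pi]_f (q j f)%:E)).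
      apply: lee_wpmul2r; last exact: integral_sqrt_le1.
      by apply: integral_ge0 => f _; rewrite lee_fin.
    rewrite mul1e; apply: ge0_le_integral_real => //; first exact: msqrt.
    by move=> f; rewrite /q ler_wsqrtr.
  + exact: (proj2 (measurable_EFinP _ _) (mq i)).
  + exact: (proj2 (measurable_EFinP _ _) (mq j)).
  + by move=> f; rewrite lee_fin.
  + by move=> f; rewrite lee_fin.
  + move=> f g; congr (q i _)%:E; apply/funext => u.
    by rewrite /subenv /glue/= eqxx.
  + move=> f g; congr (q j _)%:E; apply/funext => u.
    by rewrite /subenv /glue/= eq_sym (negbTE ij).
- exact: (proj2 (measurable_EFinP _ _) mw).
- by apply/measurable_EFinP; exact: measurable_funM.
- by move=> f; rewrite lee_fin.
- by move=> f; rewrite lee_fin mulr_ge0.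
Qed.

(** The constant combines the 2 of [eta_le_sqrt] with the number of ordered pairs of distinct
    letters. *)
Let integral_eta_le n :
  \int[Pi]_f (eta (fun j => weight [::] j f *
     total n (mass_shift [:: j] m) (subenv [:: j] f))%R)%:E <=
  (2 * \sum_(j < b) \sum_(i < b | i != j) 1)%:E * \int[Pi]_f (Num.sqrt (total n m f))%:E.
Proof.
pose a j f : R := (weight [::] j f * total n (mass_shift [:: j] m) (subenv [:: j] f))%R.
have a0 j f : (0 <= a j f)%R by rewrite mulr_ge0 ?weight_ge0 ?total_ge0.
have ma j : @measurable_fun _ _ envT R setT (a j).
  by apply: measurable_step; exact: measurable_total.
have msq i j : @measurable_fun _ _ envT R setT (fun f => Num.sqrt (a i f * a j f)).
  apply: (measurableT_comp (continuous_measurable_fun (@sqrt_continuous R))).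
  exact: measurable_funM.
have msum : @measurable_fun _ _ envT R setT
    (fun f => \sum_j \sum_(i | i != j) Num.sqrt (a i f * a j f))%R.
  by apply: measurable_sum => j; apply: measurable_sum_cond => i; exact: msq.
have sum0 f : (0 <= \sum_j \sum_(i | i != j) Num.sqrt (a i f * a j f))%R.
  by apply: sumr_ge0 => j _; apply: sumr_ge0 => i _; exact: sqrtr_ge0.
apply: (@le_trans _ _ (\int[Pi]_f
    (2 * \sum_j \sum_(i | i != j) Num.sqrt (a i f * a j f))%:E)).
  apply: ge0_le_integral_real.
  - exact: measurable_eta.
  - exact: measurable_funM.
  - by move=> f; apply: eta_ge0 => j; exact: a0.
  - by move=> f; apply: (@eta_le_sqrt _ _ (fun j => a j f)) => j; exact: a0.
rewrite ge0_integralZl_real// EFinM -muleA lee_wpmul2l//.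
under eq_integral do rewrite -sumEFin.
have sum_j0 j f : (0 <= \sum_(i | i != j) Num.sqrt (a i f * a j f))%R.
  by apply: sumr_ge0 => i _; exact: sqrtr_ge0.
have msum_j j : @measurable_fun _ _ envT R setT
    (fun f => \sum_(i | i != j) Num.sqrt (a i f * a j f))%R.
  by apply: measurable_sum_cond => i; exact: msq.
rewrite ge0_integral_sum//; last 2 first.
- by move=> j; apply/measurable_EFinP.
- by move=> j f _; rewrite lee_fin.
rewrite -sumEFin ge0_sume_distrl; last first.
  by move=> j _; rewrite lee_fin; apply: sumr_ge0.
apply: lee_sum => j _; under eq_integral do rewrite -sumEFin big_mkcond.
rewrite ge0_integral_sum//; last 2 first.
- by move=> i; case: (i != j) => //; apply/measurable_EFinP; exact: msq.
- by move=> i f _; case: (i != j) => //; rewrite lee_fin sqrtr_ge0.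
rewrite -sumEFin ge0_sume_distrl// [leRHS]big_mkcond/=.
apply: lee_sum => i _; case: ifPn => [ij|_]; last by rewrite integral0.
by rewrite mul1e integral_sqrt_cross.
Qed.

(** The subtrees carry the shifted masses, which add up to [m] by invariance, so superadditivity
    bounds their total entropy by that of [m] at level [n]. Only the entropy of the first letter is
    new. *)
Let integral_path_entropy_step n :
  \int[Pi]_f (path_entropy n.+1 m f)%:E <=
  (2 * \sum_(j < b) \sum_(i < b | i != j) 1)%:E * \int[Pi]_f (Num.sqrt (total n m f))%:E +
  \int[Pi]_f (path_entropy n m f)%:E.
Proof.
rewrite integral_path_entropyS// leeD ?integral_eta_le//.
rewrite -ge0_integral_sum//; last 2 first.
- by move=> j; apply/measurable_EFinP; exact: measurable_path_entropy.
- by move=> j f _; rewrite lee_fin path_entropy_ge0.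
under eq_integral do rewrite sumEFin.
apply: ge0_le_integral_real.
- by apply: measurable_sum => j; exact: measurable_path_entropy.
- exact: measurable_path_entropy.
- by move=> f; apply: sumr_ge0 => j _; exact: path_entropy_ge0.
move=> f; apply: le_trans (path_entropy_superadd_sum _ n f ms) _.
rewrite le_eqVlt; apply/orP; left; apply/eqP; congr path_entropy.
by apply/funext => v; rewrite m_inv.
Qed.

Let sqrt_mean n : R := fine (\int[Pi]_f (Num.sqrt (total n m f))%:E).

Let sqrt_meanE n : (sqrt_mean n)%:E = \int[Pi]_f (Num.sqrt (total n m f))%:E.
Proof.
rewrite fineK// ge0_fin_numE; last by apply: integral_ge0 => f _; rewrite lee_fin sqrtr_ge0.
apply: (@le_lt_trans _ _ (\int[Pi]_f (1 + total n m f)%:E)).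
  apply: ge0_le_integral_real => //.
  - by apply: measurable_funD => //; exact: measurable_total.
  move=> f; have t0 := total_ge0 n f m_mass.
  have := sqr_sqrtr t0; have := sqrtr_ge0 (total n m f).
  by set s := Num.sqrt _ => s0 s2; nra.
rewrite ge0_integralD_real//; last 2 first.
- exact: measurable_total.
- by move=> f; exact: total_ge0.
rewrite (integral_total Pi_iid weight_mean n m_mass) m1 integral_cst_probability.
by rewrite -EFinD ltry.
Qed.

Let C : R := (2 * \sum_(j < b) \sum_(i < b | i != j) 1)%R.

Let integral_path_entropy_le n :
  \int[Pi]_f (path_entropy n m f)%:E <= (C * \sum_(0 <= k < n) sqrt_mean k)%:E.
Proof.
elim: n => [|n ih]; first by rewrite big_geq// mulr0 /= integral0.
apply: le_trans (integral_path_entropy_step n) _.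
rewrite -sqrt_meanE -/C -EFinM; apply: le_trans (leeD2l _ ih) _.
by rewrite -EFinD lee_fin big_nat_recr//= mulrDr addrC.
Qed.

Variable l : 'I_b -> R.
Hypothesis xlnx_integrable : forall j, (0 < m [:: j])%R ->
  Pi.-integrable setT (EFin \o (fun f => xlnx (weight [::] j f))).
Hypothesis xlnx_mean : forall j, (0 < m [:: j])%R ->
  \int[Pi]_f (xlnx (weight [::] j f))%:E = (l j)%:E.

(* Letters of zero mass are discarded, since their weights may have infinite
   mean entropy. *)
Let tau j (z : R) : R := if (0 < m [:: j])%R then ln z else 0%R.

Let l' j : R := if (0 < m [:: j])%R then l j else 0%R.

Let tau_integrable j :
  Pi.-integrable setT (EFin \o (fun f => weight [::] j f * tau j (weight [::] j f))%R).
Proof.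
rewrite /tau; case: (ltP 0%R (m [:: j])) => [mj|_]; first exact: xlnx_integrable.
by apply: eq_integrable (integrable0 Pi setT) => // f _; rewrite /= mulr0.
Qed.

Let tau_mean j :
  \int[Pi]_f (weight [::] j f * tau j (weight [::] j f))%:E = (l' j)%:E.
Proof.
rewrite /tau /l'; case: (ltP 0%R (m [:: j])) => [mj|_]; first exact: xlnx_mean.
by under eq_integral do rewrite mulr0; rewrite integral0.
Qed.

Let path_prod_xlnx v f : (forall j, j \in v -> (0 < m [:: j])%R) ->
  (path_prod v f * path_sum tau v f = xlnx (path_prod v f))%R.
Proof.
elim: v f => [|j v ih] f mv /=; first by rewrite /xlnx ln1.
rewrite xlnxM ?weight_ge0 ?path_prod_ge0// -ih; last first.
  by move=> i iv; apply: mv; rewrite inE iv orbT.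
by rewrite /tau mv ?mem_head// /xlnx; ring.
Qed.

Let mass_xlnx v f : (m v * (path_prod v f * path_sum tau v f) + xlnx (m v) * path_prod v f =
  xlnx (m v * path_prod v f))%R.
Proof.
have m0 := m_mass.1 v; rewrite xlnxM ?path_prod_ge0//.
have [->|mv] := eqVneq (m v) 0%R; first by rewrite /xlnx !mul0r mulr0.
have mv0 : (0 < m v)%R by rewrite lt_neqAle eq_sym mv.
rewrite path_prod_xlnx => [|j]; last exact: (mass_letter_gt0 m_mass m_inv mv0).
by ring.
Qed.

(** In the closed form of [path_entropy], [xlnx Z_n] is bounded below by [Z_n - 1], of mean 0. The
    remaining terms have the means [word_entropy] and [n] times the one-letter sum. *)
Let entropy_lower_bound n :
  (word_entropy m n - n%:R * (\sum_j m [:: j] * l' j))%:E <=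
  \int[Pi]_f (path_entropy n m f)%:E.
Proof.
have iS v := integral_path_sum Pi_iid weight_mean tau_integrable tau_mean v.
have [i1 e1] := @integrable_lincomb _ envT R Pi _ (fun v : n.-tuple 'I_b => m v)
  (fun (v : n.-tuple 'I_b) f => path_prod v f * path_sum tau v f)%R
  (fun v : n.-tuple 'I_b => (iS v).1).
have [i2 e2] := @integrable_lincomb _ envT R Pi _ (fun v : n.-tuple 'I_b => xlnx (m v))
  (fun (v : n.-tuple 'I_b) f => path_prod v f)
  (fun v : n.-tuple 'I_b => integrable_path_prod Pi_iid weight_mean v).
have iZ := integrable_total Pi_iid weight_mean n m_mass.
have iC : Pi.-integrable setT (fun f => (path_entropy n m f)%:E).
  apply/integrableP; split; first by apply/measurable_EFinP; exact: measurable_path_entropy.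
  apply: le_lt_trans (ltry (C * \sum_(0 <= k < n) sqrt_mean k)).
  apply: le_trans (integral_path_entropy_le n).
  rewrite le_eqVlt; apply/orP; left; apply/eqP; apply: eq_integral => f _.
  by rewrite gee0_abs// lee_fin path_entropy_ge0.
have -> : (word_entropy m n - n%:R * (\sum_j m [:: j] * l' j))%:E =
    \int[Pi]_f (total n m f)%:E - \int[Pi]_f (cst 1 f)%:E -
    (\int[Pi]_f (\sum_(v : n.-tuple 'I_b)
        m v * (path_prod v f * path_sum tau v f))%:E +
     \int[Pi]_f (\sum_(v : n.-tuple 'I_b) xlnx (m v) * path_prod v f)%:E).
  rewrite e1 e2 -(sum_words_letters m_mass m_inv) /word_entropy.
  rewrite (integral_total Pi_iid weight_mean n m_mass) m1 integral_cst_probability.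
  rewrite subee// sub0e.
  rewrite (eq_bigr (fun v : n.-tuple 'I_b => (m v * \sum_(j <- v) l' j)%:E)); last first.
    by move=> v _; rewrite (iS v).2 EFinM.
  rewrite [X in _ + X](eq_bigr (fun v : n.-tuple 'I_b => (xlnx (m v))%:E)); last first.
    by move=> v _; rewrite (integral_path_prod Pi_iid weight_mean) mule1.
  by rewrite !sumEFin -EFinD -EFinN; congr EFin; rewrite opprD addrC.
have i1cst := finite_measure_integrable_cst Pi 1%R measurableT.
have iD := integrableD measurableT i1 i2.
have iB := integrableB measurableT iZ i1cst.
rewrite -integralB// -integralD// -integralB//.
apply: (le_integral measurableT _ iC); first exact: integrableB.
move=> f _ /=; rewrite lee_fin path_entropyE//.
have -> : (\sum_(v : n.-tuple 'I_b) xlnx (m v * path_prod v f) =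
    \sum_(v : n.-tuple 'I_b) m v * (path_prod v f * path_sum tau v f) +
    \sum_(v : n.-tuple 'I_b) xlnx (m v) * path_prod v f)%R.
  by rewrite -big_split/=; apply: eq_bigr => v _; rewrite mass_xlnx.
by rewrite lerD2r; apply: xlnx_ge; exact: total_ge0.
Qed.

(* The entropy of the word given the environment grows sublinearly when [Z_n]
   tends to zero. *)
Theorem singular_entropy_le :
  (forall e : R, (0 < e)%R ->
     \forall n \near \oo, \int[Pi]_f (Num.sqrt (total n m f))%:E <= e%:E) ->
  (limn (fun n => n%:R^-1 * word_entropy m n) <= \sum_j m [:: j] * l j)%R.
Proof.
move=> small; set hV := (\sum_j _)%R; set h := limn _.
have hcvg : (fun n => n%:R^-1 * word_entropy m n)%R @ \oo --> h.
  exact: (word_entropy_rate_cvg m_mass m1 m_inv).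
have hVE : (\sum_j m [:: j] * l' j = hV)%R.
  apply: eq_bigr => j _; rewrite /l'; case: ifPn => //.
  by rewrite -leNgt => mj; have /eqP -> : m [:: j] == 0%R;
    [rewrite eq_le mj (m_mass.1 _)|rewrite !mul0r].
have s0 : sqrt_mean @ \oo --> 0%R.
  apply/cvgrPdist_le => e e0; near=> n; rewrite sub0r normrN ger0_norm.
    by rewrite -lee_fin sqrt_meanE; near: n; exact: small.
  by rewrite -lee_fin sqrt_meanE; apply: integral_ge0 => f _; rewrite lee_fin sqrtr_ge0.
(* The index is shifted by one to match [arithmetic_mean], which divides by [n.+1]. *)
have mean0 : (fun n => n.+1%:R^-1 * word_entropy m n.+1 : R)%R @ \oo --> h.
  rewrite (_ : (fun n => _) =
      (fun n => n%:R^-1 * word_entropy m n)%R \o (addn^~ 1%N)).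
    exact: (cvg_comp _ _ (cvg_addnr 1) hcvg).
  by apply/funext => n; rewrite /= addn1.
have ub : (fun n => C * arithmetic_mean sqrt_mean n + hV : R)%R @ \oo --> (C * 0 + hV)%R.
  by apply: cvgD; [apply: cvgMl_tmp; exact: cesaro|exact: cvg_cst].
rewrite -[hV]add0r -(mulr0 C); apply: ler_cvg_to mean0 ub _.
apply: nearW => n; rewrite /arithmetic_mean /=.
have := le_trans (entropy_lower_bound n.+1) (integral_path_entropy_le n.+1).
rewrite lee_fin hVE => h1.
have n0 : (0 < n.+1%:R :> R)%R by [].
rewrite -(ler_pM2l n0) mulVKf ?gt_eqF// mulrDr /series/=.
rewrite [X in (X + _)%R]mulrCA mulVKf ?gt_eqF//.
by rewrite -lerBlDr.
Unshelve. all: by end_near. Qed.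

End invariant.
End singular_case.

(** * Charges dominated by an ergodic measure *)

Section dominated_charge.
Context d (T : measurableType d) (R : realType).
Variables (nu : probability T R) (lam : set T -> R) (C : R).
Hypothesis lam_add : forall A B, measurable A -> measurable B -> A `&` B = set0 ->
  lam (A `|` B) = (lam A + lam B)%R.
Hypothesis lam_dom : forall A, measurable A -> (`|lam A| <= C * fine (nu A))%R.

Let lam_diff A B : measurable A -> measurable B -> B `<=` A ->
  (lam A - lam B = lam (A `\` B))%R.
Proof.
move=> mA mB BA; rewrite -[in LHS](setDUK BA) lam_add//.
- by rewrite addrC addKr.
- exact: measurableD.
- by rewrite setDE setICA setICr setI0.
Qed.

Let lam_dist A B : measurable A -> measurable B -> B `<=` A ->
  (`|lam A - lam B| <= C * (fine (nu A) - fine (nu B)))%R.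
Proof.
move=> mA mB BA; rewrite lam_diff//; apply: le_trans (lam_dom _) _.
  exact: measurableD.
rewrite -fineB ?fin_num_measure// measureD//; last by rewrite -ge0_fin_numE// fin_num_measure.
by rewrite setIidr.
Qed.

Let C_ge0 : (0 <= C)%R.
Proof.
have := lam_dom measurableT; rewrite probability_setT/= mulr1.
exact: le_trans.
Qed.

Let fine_nu_cvg (F : (set T)^nat) A : measurable A -> (forall n, measurable (F n)) ->
  nu (F n) @[n --> \oo] --> nu A -> fine (nu (F n)) @[n --> \oo] --> fine (nu A).
Proof.
by move=> mA mF; rewrite -{1}(@fineK _ (nu A)) ?fin_num_measure// => /fine_cvg.
Qed.

(** Domination transfers continuity along monotone sequences from [nu] to [lam]. *)
Let lam_cvg (F : (set T)^nat) A : measurable A -> (forall n, measurable (F n)) ->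
  (forall n, `|lam A - lam (F n)| <= C * `|fine (nu A) - fine (nu (F n))|)%R ->
  nu (F n) @[n --> \oo] --> nu A -> lam (F n) @[n --> \oo] --> lam A.
Proof.
move=> mA mF le /(fine_nu_cvg mA mF) cv.
apply/cvgrPdist_le => e e0.
have C1 : (0 < C + 1)%R by rewrite ltr_wpDl.
have ec : (0 < e / (C + 1))%R by rewrite divr_gt0.
move/cvgrPdist_le : cv => /(_ _ ec); apply: filterS => n h.
apply: le_trans (le n) _; apply: (@le_trans _ _ (C * (e / (C + 1)))%R).
  by rewrite ler_wpM2l.
rewrite mulrA ler_pdivrMr// mulrC ler_pM2l//.
by rewrite lerDl.
Qed.

Lemma dominated_cvg_bigcup (F : (set T)^nat) : (forall n, measurable (F n)) ->
  nondecreasing_seq F -> lam (F n) @[n --> \oo] --> lam (\bigcup_n F n).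
Proof.
move=> mF ndF; have mU : measurable (\bigcup_n F n) by exact: bigcupT_measurable.
apply: lam_cvg => //; last exact: nondecreasing_cvg_mu.
move=> n; apply: le_trans (lam_dist mU (mF n) _) _; first exact: bigcup_sup.
by rewrite ler_wpM2l// ler_norm.
Qed.

Lemma dominated_cvg_bigcap (F : (set T)^nat) : (forall n, measurable (F n)) ->
  nonincreasing_seq F -> lam (F n) @[n --> \oo] --> lam (\bigcap_n F n).
Proof.
move=> mF niF; have mI : measurable (\bigcap_n F n) by exact: bigcapT_measurable.
apply: lam_cvg => //; last first.
  by apply: nonincreasing_cvg_mu => //; rewrite -ge0_fin_numE// fin_num_measure.
move=> n; rewrite distrC [X in (_ * X)%R]distrC.
apply: le_trans (lam_dist (mF n) mI _) _; first exact: bigcap_inf.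
by rewrite ler_wpM2l// ler_norm.
Qed.

Definition dominated_charge (A : set T) : \bar R := (lam A)%:E.

Let lam0 : lam set0 = 0%R.
Proof.
apply/eqP; rewrite -normr_le0.
by have := lam_dom measurable0; rewrite measure0 mulr0.
Qed.

Let charge_set0 : dominated_charge set0 = 0.
Proof. by rewrite /dominated_charge lam0. Qed.

Let charge_fin A : measurable A -> dominated_charge A \is a fin_num.
Proof. by []. Qed.

Let lam_sum (F : (set T)^nat) n : (forall i, measurable (F i)) -> trivIset setT F ->
  lam (\bigcup_(i < n) F i) = (\sum_(0 <= i < n) lam (F i))%R.
Proof.
move=> mF tF; elim: n => [|n ih].
  by rewrite big_geq// (_ : \bigcup_(i in _) _ = set0) ?lam0// bigcup0.
rewrite big_nat_recr//= -ih bigcup_mkord big_ord_recr/= -bigcup_mkord lam_add//.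
  by apply: bigcup_measurable.
apply/seteqP; split => // x [[i /= ni Fi] Fn].
have /trivIsetP/(_ i n I I) := tF.
rewrite ltn_eqF// => /(_ isT) e.
by have : (F i `&` F n) x by []; rewrite e.
Qed.

(** Finite additivity together with continuity along the increasing finite unions. *)
Let charge_sigma_add : semi_sigma_additive dominated_charge.
Proof.
move=> F mF tF mU; rewrite /dominated_charge.
rewrite (_ : (fun n => _) = EFin \o (fun n => lam (\bigcup_(i < n) F i))); last first.
  by apply/funext => n; rewrite /= lam_sum// -sumEFin.
apply: cvg_EFin; first exact: nearW.
rewrite (_ : \bigcup_n F n = \bigcup_n \bigcup_(i < n) F i); last first.
  apply/seteqP; split => [x [n _ Fn]|x [n _ [i _ Fi]]]; last by exists i.
  by exists n.+1 => //; exists n => /=.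
apply: dominated_cvg_bigcup => [n|n k nk].
  exact: bigcup_measurable.
by apply/subsetPset => x [i /= ni Fi]; exists i => //=; exact: leq_trans nk.
Qed.

HB.instance Definition _ := isCharge.Build _ _ _ dominated_charge
  charge_set0 charge_fin charge_sigma_add.

(** The positive set of a Hahn decomposition: removing from [B] its part in the negative set, then
    adding what is missing of the positive set, can only increase the charge. *)
Lemma dominated_maximizer : exists2 M, measurable M &
  forall B, measurable B -> (lam B <= lam M)%R.
Proof.
have [M [N [[mM posM] [mN negN] MN MN0]]] := Hahn_decomposition dominated_charge.
exists M => // B mB.
have mBM : measurable (B `&` M) by exact: measurableI.
have -> : lam B = (lam (B `&` M) + lam (B `&` N))%R.
  rewrite -lam_add//; [by rewrite -setIUr MN setIT|exact: measurableI|].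
  by rewrite setIACA MN0 setI0.
have -> : lam M = (lam (B `&` M) + lam (M `\` B))%R.
  rewrite -lam_add//; [by rewrite [B `&` M]setIC setUIDK|exact: measurableD|].
  by apply/seteqP; split => // x [[Bx _] [_ /(_ Bx)]].
rewrite lerD2l; apply: (@le_trans _ _ 0%R).
  by have := negN _ (measurableI _ _ mB mN) (@subIsetr _ _ _); rewrite lee_fin.
by have := posM _ (measurableD mM mB) (@subDsetl _ _ _); rewrite lee_fin.
Qed.

End dominated_charge.

(** * Invariant charges under an ergodic map *)

Section ergodic_charge.
Context d (T : measurableType d) (R : realType).
Variables (f : T -> T) (nu : probability T R) (lam : set T -> R) (C : R).
Hypothesis mf : measurable_fun setT f.
Hypothesis nu_ergodic : ergodic f nu.
Hypothesis lam_add : forall A B, measurable A -> measurable B -> A `&` B = set0 ->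
  lam (A `|` B) = (lam A + lam B)%R.
Hypothesis lam_dom : forall A, measurable A -> (`|lam A| <= C * fine (nu A))%R.
Hypothesis lam_inv : forall A, measurable A -> lam (f @^-1` A) = lam A.
Hypothesis lamT : lam setT = 0%R.

Let lam_setUI A B : measurable A -> measurable B ->
  (lam (A `|` B) + lam (A `&` B) = lam A + lam B)%R.
Proof.
move=> mA mB.
have -> : lam (A `|` B) = (lam A + lam (B `\` A))%R.
  rewrite -lam_add//; last 2 first.
  - exact: measurableD.
  - by rewrite setDE setICA setICr setI0.
  congr lam; apply/seteqP; split=> x [Ax|Bx]; [by left| |by left|by right; case: Bx].
  by have [Ax|nAx] := pselect (A x); [left|right].
rewrite -addrA -[(lam (B `\` A) + _)%R]lam_add//.
- congr (_ + lam _)%R; apply/seteqP; split=> x; first by case=> -[].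
  by move=> Bx; have [Ax|nAx] := pselect (A x); [right|left].
- exact: measurableD.
- exact: measurableI.
- by apply/seteqP; split => // x [[_ nAx] [/nAx]].
Qed.

(* A maximiser of an invariant charge can be made exactly invariant: maximisers
   are closed under unions and intersections, so [limsup f^-n M] is one. *)
Let maximum_eq0 M : measurable M ->
  (forall B, measurable B -> (lam B <= lam M)%R) -> lam M = 0%R.
Proof.
move=> mM maxM.
pose W k := iter k (fun A => f @^-1` A) M.
have mW k : measurable (W k).
  by elim: k => //= k ih; rewrite -[X in measurable X]setTI; exact: mf.
have lW k : lam (W k) = lam M.
  by elim: k => //= k ih; rewrite -/(W k) lam_inv.
(* The charges of union and intersection add up to twice the maximum, and neither exceeds it. *)
have maxU A B : measurable A -> measurable B -> lam A = lam M -> lam B = lam M ->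
    lam (A `|` B) = lam M.
  move=> mA mB lA lB; apply/eqP; rewrite eq_le maxM/=; last exact: measurableU.
  have := lam_setUI mA mB; rewrite lA lB => /eqP; rewrite -subr_eq => /eqP.
  by have := maxM _ (measurableI _ _ mA mB); lra.
have mE n : measurable (\bigcup_(k >= n) W k) by exact: bigcup_measurable.
have lE n : lam (\bigcup_(k >= n) W k) = lam M.
  pose G N := \bigcup_(k in [set k | (n <= k <= n + N)%N]) W k.
  have mG N : measurable (G N) by exact: bigcup_measurable.
  have lG N : lam (G N) = lam M.
    elim: N => [|N ih].
      rewrite (_ : G 0%N = W n) ?lW//; apply/seteqP; split=> [x [k /=]|x Wx].
        by rewrite addn0 -eqn_leq => /eqP <-.
      by exists n => //=; rewrite addn0 leqnn.
    rewrite (_ : G N.+1 = G N `|` W (n + N.+1)%N).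
      by apply: maxU => //; exact: lW.
    apply/seteqP; split=> [x [k /= /andP[nk kN] Wk]|x [[k /= /andP[nk kN] Wk]|Wk]].
    - move: kN; rewrite leq_eqVlt => /predU1P[<-|]; first by right.
      by rewrite addnS ltnS => kN; left; exists k => //=; rewrite nk.
    - by exists k => //=; rewrite nk (leq_trans kN)// leq_add2l.
    - by exists (n + N.+1)%N => //=; rewrite leq_addr leqnn.
  have -> : \bigcup_(k >= n) W k = \bigcup_N G N.
    apply/seteqP; split=> [x [k /= nk Wk]|x [N _ [k /= /andP[nk _] Wk]]]; last by exists k.
    by exists (k - n)%N => //; exists k => //=; rewrite nk subnKC/=.
  have := dominated_cvg_bigcup lam_add lam_dom mG.
  have ndG : nondecreasing_seq G.
    move=> N N' NN'; apply/subsetPset => x [k /= /andP[nk kN] Wk]; exists k => //=.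
    by rewrite nk (leq_trans kN)// leq_add2l.
  move=> /(_ ndG); rewrite (_ : (fun N => lam (G N)) = cst (lam M)); last by apply/funext => N; exact: lG.
  by move=> /(cvg_unique (@Rhausdorff R) (cvg_cst _)) <-.
have mS : measurable (lim_sup_set W) by apply: bigcapT_measurable.
have lS : lam (lim_sup_set W) = lam M.
  have niE : nonincreasing_seq (fun n => \bigcup_(k >= n) W k).
    move=> n n' nn'; apply/subsetPset => x [k /= nk Wk]; exists k => //=.
    exact: leq_trans nk.
  have := dominated_cvg_bigcap lam_add lam_dom mE niE.
  rewrite (_ : (fun n => lam _) = cst (lam M)); last by apply/funext => N; exact: lE.
  by move=> /(cvg_unique (@Rhausdorff R) (cvg_cst _)) <-.
have invS : f @^-1` lim_sup_set W = lim_sup_set W.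
  apply/seteqP; split=> x h n _.
    by have [k /= nk Wk] := h n I; exists k.+1 => //=; exact: leqW.
  by have [[|k] //= nk Wk] := h n.+1 I; exists k.
rewrite -lS; apply/eqP; rewrite -normr_le0.
(* By domination the charge vanishes on the invariant set or on its complement, and the total charge
   is 0. *)
have [_ /(_ _ mS invS)[nu0|nu1]] := nu_ergodic.
  by have := lam_dom mS; rewrite nu0 mulr0.
have lC : lam (lim_sup_set W) = (- lam (~` lim_sup_set W))%R.
  apply/eqP; rewrite -addr_eq0 -lam_add ?setUv ?lamT ?setICr//.
  exact: measurableC.
rewrite lC normrN; have := lam_dom (measurableC mS).
by rewrite probability_setC// nu1 subee// mulr0.
Qed.

(** The maximum being 0, [A] and its complement both have charge at most 0, and the two charges add
    up to 0. *)
Theorem ergodic_charge_eq0 A : measurable A -> lam A = 0%R.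
Proof.
move=> mA; have [M mM maxM] := dominated_maximizer lam_add lam_dom.
have M0 := maximum_eq0 mM maxM.
have le0 B : measurable B -> (lam B <= 0)%R by rewrite -M0; exact: maxM.
have := lam_add mA (measurableC mA) (setICr A); rewrite setUv lamT.
by have := le0 _ mA; have := le0 _ (measurableC mA); lra.
Qed.

End ergodic_charge.

(** * The sequence space *)

Lemma continuous_prod_topology (I : Type) (U : topologicalType) (K : I -> topologicalType)
  (f : U -> prod_topology K) : (forall i, continuous (fun x => f x i)) -> continuous f.
Proof.
move=> cf x.
have := @cvg_sup (forall i, K i) I (fun i => Topological.class
    (initial_topology (fun f : (forall i, K i) => f i))) (f @ x) (f x).
have FF : Filter (f @ x) by exact: fmap_filter.
move=> /(_ FF)[_]; apply => i.
move=> V [?/= [[W oW <-]]] /= Wx /filterS; apply.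
by apply: (cf i); exact: open_nbhs_nbhs.
Qed.

Section sequence_space.
Context {b : nat} {b_ge2 : (2 <= b)%N}.
Notation Sigma := (seq_space b_ge2).
Implicit Types (u v : seq 'I_b) (j : 'I_b) (x : Sigma).

Lemma open_seq_measurable (A : set Sigma) : open A -> measurable A.
Proof. by move=> oA; apply: sub_sigma_algebra. Qed.

Lemma continuous_seq_coord n :
  continuous ((fun x => x n) : Sigma -> discrete_topology 'I_b).
Proof. exact: (@proj_continuous nat (fun=> discrete_topology 'I_b) n). Qed.

Lemma measurable_letter n j : measurable [set x : Sigma | x n = j].
Proof.
apply: open_seq_measurable.
apply: (@open_comp Sigma (discrete_topology 'I_b) (fun x => x n) [set j]).
  by move=> x _; exact: continuous_seq_coord.
exact: discrete_open.
Qed.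

Lemma cylinder_nil : @cylinder b b_ge2 [::] = setT.
Proof. by apply/seteqP; split. Qed.

Lemma cylinder_rcons v j :
  cylinder (rcons v j) = cylinder v `&` [set x : Sigma | x (size v) = j].
Proof.
apply/seteqP; split=> x; rewrite /cylinder/= size_rcons /prefix_word mkseqS.
  by move=> /eqP; rewrite eqseq_rcons => /andP[/eqP ? /eqP].
by case=> -> ->.
Qed.

Lemma cylinder_cons j v :
  cylinder (j :: v) = [set x : Sigma | x 0%N = j] `&` @left_shift b b_ge2 @^-1` cylinder v.
Proof.
apply/seteqP; split=> x; rewrite /cylinder/= /prefix_word /mkseq/= (iotaDl 1 0) -map_comp.
  by case.
by case=> -> ->.
Qed.

Lemma measurable_cylinder v : measurable (@cylinder b b_ge2 v).
Proof.
elim/last_ind: v => [|v j ih]; first by rewrite cylinder_nil.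
by rewrite cylinder_rcons; apply: measurableI => //; exact: measurable_letter.
Qed.

Lemma continuous_left_shift : continuous (@left_shift b b_ge2).
Proof.
apply: (@continuous_prod_topology nat Sigma (fun=> discrete_topology 'I_b)) => n.
exact: continuous_seq_coord.
Qed.

Lemma measurable_left_shift : measurable_fun setT (@left_shift b b_ge2).
Proof.
apply: (@measurability _ _ Sigma Sigma setT _ (@open Sigma)) => //.
move=> _ [A oA <-]; rewrite setTI; apply: open_seq_measurable.
by apply: open_comp => // x _; exact: continuous_left_shift.
Qed.

Lemma compact_seq_space : compact [set: Sigma].
Proof.
rewrite (_ : setT = [set f : Sigma | forall i, [set: discrete_topology 'I_b] (f i)]).
  apply: (@tychonoff nat (fun=> discrete_topology 'I_b) (fun=> setT)) => n.
  exact: (@finite_compact (discrete_topology 'I_b) _ (@finite_finset 'I_b setT)).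
by apply/seteqP; split.
Qed.

End sequence_space.

(** * Cylinder masses of a measure restricted to a Borel set *)

Section cylinder_masses.
Context {R : realType} {b : nat} {b_ge2 : (2 <= b)%N}.
Notation Sigma := (seq_space b_ge2).
Variable nu : probability Sigma R.
Implicit Types (A B : set Sigma) (u v : seq 'I_b) (j : 'I_b).

Definition cylinder_mass A v : R := fine (nu (A `&` cylinder v)).

Lemma fine_measure_letters A n : measurable A ->
  fine (nu A) = (\sum_j fine (nu (A `&` [set x | x n = j])))%R.
Proof.
move=> mA; apply: EFin_inj; rewrite fineK ?fin_num_measure// -sumEFin.
have mL j : measurable (A `&` [set x | x n = j]).
  by apply: measurableI => //; exact: measurable_letter.
under eq_bigr do rewrite fineK ?fin_num_measure//.
rewrite -(measure_bigsetU_ord nu xpredT mL); last first.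
  by apply/trivIsetP => i j _ _ /eqP ij; apply/seteqP; split=> // x [[_ xi] [_ xj]]; apply: ij; rewrite -xi -xj.
congr (nu _); apply/seteqP; split=> x.
  by move=> Ax; rewrite -bigcup_seq; exists (x n) => //=; rewrite mem_index_enum.
by rewrite -bigcup_seq => -[j _ []].
Qed.

Lemma cylinder_mass_fun A : measurable A -> mass_fun (cylinder_mass A).
Proof.
move=> mA; split=> v; first by rewrite fine_ge0.
rewrite /cylinder_mass (@fine_measure_letters _ (size v)); last first.
  by apply: measurableI => //; exact: measurable_cylinder.
by apply: eq_bigr => j _; rewrite -setIA -cylinder_rcons.
Qed.

Lemma cylinder_mass_nil A : cylinder_mass A [::] = fine (nu A).
Proof. by rewrite /cylinder_mass cylinder_nil setIT. Qed.

Lemma cylinder_massT v : cylinder_mass setT v = fine (nu (cylinder v)).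
Proof. by rewrite /cylinder_mass setTI. Qed.

Lemma cylinder_mass_add A B v : measurable A -> measurable B -> A `&` B = set0 ->
  cylinder_mass (A `|` B) v = (cylinder_mass A v + cylinder_mass B v)%R.
Proof.
move=> mA mB AB; have mv := @measurable_cylinder b b_ge2 v.
rewrite /cylinder_mass setIUl measureU; [|exact: measurableI|exact: measurableI|].
  by rewrite fineD ?fin_num_measure//; exact: measurableI.
by rewrite setIACA AB set0I.
Qed.

(** The sets on the left partition the preimage of [A] intersected with the cylinder of [v], and
    [nu] is invariant. *)
Lemma cylinder_mass_shift_preimage A v : measurable A ->
  invariant_measure (@left_shift b b_ge2) nu ->
  (\sum_j cylinder_mass (@left_shift b b_ge2 @^-1` A) (j :: v))%R = cylinder_mass A v.
Proof.
move=> mA nu_inv; have mAv : measurable (A `&` cylinder v).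
  by apply: measurableI => //; exact: measurable_cylinder.
rewrite [RHS]/cylinder_mass -nu_inv//.
rewrite (@fine_measure_letters _ 0).
  by apply: eq_bigr => j _; rewrite /cylinder_mass cylinder_cons preimage_setI -setIA [X in _ `&` X]setIC.
by rewrite -[X in measurable X]setTI; exact: measurable_left_shift.
Qed.

Lemma shift_invariant_cylinder_mass : invariant_measure (@left_shift b b_ge2) nu ->
  shift_invariant (cylinder_mass setT).
Proof. by move=> nu_inv v; rewrite -cylinder_mass_shift_preimage// preimage_setT. Qed.

Lemma entropyE : entropy nu = limn (fun n => n%:R^-1 * word_entropy (cylinder_mass setT) n)%R.
Proof.
rewrite /entropy; congr (limn _); apply/funext => n; congr (_ * _)%R.
rewrite /word_entropy -sumrN; apply: eq_bigr => v _.
by rewrite cylinder_massT.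
Qed.

End cylinder_masses.

(** * The zero-one alternative for an ergodic measure *)

Section ergodic_cascade.
Context {R : realType} {b : nat} {b_ge2 : (2 <= b)%N}.
Notation Sigma := (seq_space b_ge2).
Notation env := (@env R b).
Notation envT := (@envT R b).
Variables (Pi : probability envT R) (lam : set (b.-tuple R) -> \bar R).
Hypothesis Pi_iid : iid_env Pi lam.
Hypothesis weight_mean : forall j, \int[Pi]_f (weight [::] j f)%:E = 1.
Implicit Types (u v : seq 'I_b) (m : seq 'I_b -> R) (A B : set Sigma).

Lemma limit_mass0 : limit_mass Pi (fun=> 0%R) = 0%R.
Proof.
have m0 : @mass_fun R b (fun=> 0%R) by split=> v //; rewrite big1.
by apply/eqP; rewrite eq_le (limit_mass_le Pi_iid weight_mean m0) (limit_mass_ge0 Pi_iid weight_mean m0).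
Qed.

Lemma limit_mass_sum (I : Type) (s : seq I) (M : I -> seq 'I_b -> R) :
  (forall i, mass_fun (M i)) ->
  limit_mass Pi (fun v => \sum_(i <- s) M i v)%R = (\sum_(i <- s) limit_mass Pi (M i))%R.
Proof.
move=> mM; elim: s => [|i s ih].
  by rewrite big_nil -[RHS]limit_mass0; congr (limit_mass Pi _); apply/funext => v; rewrite big_nil.
rewrite big_cons -ih -(limit_mass_add Pi_iid weight_mean)//.
  by congr (limit_mass Pi _); apply/funext => v; rewrite big_cons.
exact: mass_fun_sum.
Qed.

Lemma take_prefix_word (x : Sigma) k n : (k <= n)%N ->
  take k (prefix_word x n) = prefix_word x k.
Proof. by move=> kn; rewrite /prefix_word /mkseq -map_take take_iota (minn_idPl kn). Qed.

Lemma cylinder_cat_sub u v : cylinder (u ++ v) `<=` @cylinder b b_ge2 u.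
Proof.
move=> x; rewrite /cylinder/= size_cat => xuv.
by rewrite -(@take_prefix_word _ _ (size u + size v)) ?leq_addr// xuv take_size_cat.
Qed.

Variable nu : probability Sigma R.
Hypothesis nu_ergodic : ergodic (@left_shift b b_ge2) nu.

Let L A := limit_mass Pi (cylinder_mass nu A).

(** The difference of the two sides is an invariant charge of total 0, dominated by [(1 + L setT)]
    times [nu], so ergodicity forces it to vanish. *)
Lemma limit_mass_proportional A : measurable A -> L A = (L setT * fine (nu A))%R.
Proof.
move=> mA; apply/eqP; rewrite -subr_eq0; apply/eqP.
have L0 B : measurable B -> (0 <= L B)%R.
  by move=> mB; exact: (limit_mass_ge0 Pi_iid weight_mean (cylinder_mass_fun nu mB)).
have Lle B : measurable B -> (L B <= fine (nu B))%R.
  move=> mB; rewrite -cylinder_mass_nil.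
  exact: (limit_mass_le Pi_iid weight_mean (cylinder_mass_fun nu mB)).
have nu0 B : (0 <= fine (nu B))%R by rewrite fine_ge0.
apply: (@ergodic_charge_eq0 _ _ _ (@left_shift b b_ge2) nu
  (fun A => L A - L setT * fine (nu A))%R (1 + L setT)%R _ nu_ergodic) => //.
- exact: measurable_left_shift.
- move=> B C mB mC BC; rewrite measureU// fineD ?fin_num_measure//.
  rewrite /L (_ : cylinder_mass _ _ = fun v => cylinder_mass nu B v + cylinder_mass nu C v)%R.
    rewrite (limit_mass_add Pi_iid weight_mean); [ring|exact: cylinder_mass_fun..].
  by apply/funext => v; exact: cylinder_mass_add.
- move=> B mB; have := L0 _ mB; have := Lle _ mB; have := nu0 B.
  have := mulr_ge0 (L0 _ measurableT) (nu0 B).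
  by rewrite ler_norml; move=> *; apply/andP; split; lra.
- move=> B mB; have mB' : measurable (@left_shift b b_ge2 @^-1` B).
    by rewrite -[X in measurable X]setTI; exact: measurable_left_shift.
  rewrite nu_ergodic.1//; congr (_ - _)%R; rewrite /L.
  (* Invariance: averaging over the first generation turns the limit mass of the preimage of [B]
     into that of the sum of its one-letter shifts, which is the mass function of [B]. *)
  have mf := cylinder_mass_fun nu mB'.
  rewrite (limit_mass_cat Pi_iid weight_mean 1 mf).
  rewrite (sum_words_cons 0 (fun v => limit_mass Pi (mass_shift v _))).
  under eq_bigr do rewrite (sum_words0 (fun v => limit_mass Pi (mass_shift (_ :: v) _))).
  rewrite -limit_mass_sum; last by move=> j; exact: mass_fun_shift.
  congr (limit_mass Pi _); apply/funext => v.
  by rewrite -cylinder_mass_shift_preimage//; exact: nu_ergodic.1.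
- by rewrite probability_setT mulr1 subrr.
Qed.

(** In the decomposition at depth [size u], every word other than [u] carries no mass. *)
Lemma limit_mass_cylinder u :
  limit_mass Pi (cylinder_mass nu (cylinder u)) = limit_mass Pi (mass_shift u (cylinder_mass nu setT)).
Proof.
have mu : mass_fun (cylinder_mass nu (cylinder u)).
  by apply: cylinder_mass_fun; exact: measurable_cylinder.
rewrite (limit_mass_cat Pi_iid weight_mean (size u) mu).
rewrite (bigD1 (in_tuple u))//= big1 ?addr0.
  congr (limit_mass Pi _); apply/funext => v; rewrite /mass_shift /cylinder_mass setTI.
  by rewrite setIidr//; exact: cylinder_cat_sub.
move=> v vu; rewrite -[RHS]limit_mass0; congr (limit_mass Pi _); apply/funext => w.
rewrite /mass_shift /cylinder_mass (_ : _ `&` _ = set0) ?measure0//.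
apply/seteqP; split => // x [xu /cylinder_cat_sub].
rewrite /cylinder/= size_tuple => xv; move/eqP : vu; apply.
by apply/val_inj => /=; rewrite -xv.
Qed.

Lemma cascade_zero_one : limit_mass Pi (cylinder_mass nu setT) = 1%R \/
  {ae Pi, forall f, total_lim (cylinder_mass nu setT) f = 0%R}.
Proof.
apply: (limit_mass_zero_one Pi_iid weight_mean) => [||v].
- exact: cylinder_mass_fun.
- by rewrite cylinder_mass_nil probability_setT.
- rewrite -limit_mass_cylinder -/(L _) limit_mass_proportional; last exact: measurable_cylinder.
  by rewrite cylinder_massT.
Qed.

End ergodic_cascade.

(** * The law of the environment *)

Section environment_law.
Context d (T : measurableType d) (R : realType) (P : probability T R) (b : nat).
Variable X : seq 'I_b -> {RV P >-> b.-tuple R}.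

Definition env_of (w : T) : @envT R b := fun v => X v w.

Lemma measurable_env_of : measurable_fun setT env_of.
Proof. by apply: measurable_fun_env => v; exact: measurable_funPT. Qed.

HB.instance Definition _ := isMeasurableFun.Build _ _ T (@envT R b) env_of measurable_env_of.

Definition env_law : probability (@envT R b) R := distribution P env_of.

Lemma ge0_integral_env_law (F : @envT R b -> \bar R) : measurable_fun [set: envT] F ->
  (forall f, 0 <= F f) -> \int[env_law]_f F f = \int[P]_w F (env_of w).
Proof. by move=> mF F0; rewrite ge0_integral_distribution. Qed.

Lemma ae_env_law (Q : @envT R b -> Prop) :
  {ae env_law, forall f, Q f} -> {ae P, forall w, Q (env_of w)}.
Proof.
move=> [N [mN N0 QN]]; exists (env_of @^-1` N); split => //.
- by rewrite -[X in measurable X]setTI; exact: measurable_env_of.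
- by move=> w /QN.
Qed.

Context d1 (T1 : measurableType d1) (P1 : probability T1 R).
Variable V : {RV P1 >-> b.-tuple R}.
Hypothesis X_iid : iid_copies X V.

Lemma env_law_iid : iid_env env_law (distribution P1 V).
Proof.
move=> s B us mB; have [ind idd] := X_iid.
by rewrite -[LHS]/(P (\bigcap_(i in [set` s]) X i @^-1` B i)) ind//; apply: eq_bigr => v _; exact: idd.
Qed.

(** Both sides may be infinite, so the positive and negative parts are transferred separately. *)
Lemma integral_env_law_coord v (F : b.-tuple R -> \bar R) : measurable_fun setT F ->
  \int[env_law]_f F (f v) = \int[P1]_w F (V w).
Proof.
have ge0 (G : b.-tuple R -> \bar R) : measurable_fun setT G -> (forall t, 0 <= G t) ->
    \int[env_law]_f G (f v) = \int[P1]_w G (V w).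
  move=> mG G0; rewrite (@ge0_integral_env_law (fun f => G (f v)))//; last first.
    exact: (measurableT_comp mG (measurable_env_coord v)).
  rewrite -(ge0_integral_distribution (X v) mG G0) -(ge0_integral_distribution V mG G0).
  by apply: eq_measure_integral => A mA _; exact: X_iid.2.
move=> mF; rewrite [LHS]integralE [RHS]integralE.
congr (_ - _).
  transitivity (\int[env_law]_f F^\+ (f v)).
    by apply: eq_integral => f _; rewrite !unlock.
  rewrite ge0//; last exact: measurable_funepos.
  by apply: eq_integral => w _; rewrite !unlock.
transitivity (\int[env_law]_f F^\- (f v)).
  by apply: eq_integral => f _; rewrite !unlock.
rewrite ge0//; last exact: measurable_funeneg.
by apply: eq_integral => w _; rewrite !unlock.
Qed.

Hypothesis V_ge0 : forall w j, (0 <= tnth (V w) j)%R.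

Lemma integral_env_law_weight (g : R -> R) j : measurable_fun setT g ->
  \int[env_law]_f (g (weight [::] j f))%:E = 'E_P1[fun w => g (tnth (V w) j)].
Proof.
move=> mg; rewrite unlock.
rewrite (@integral_env_law_coord [::] (fun t => (g `|tnth t j|)%:E)).
  by apply: eq_integral => w _; rewrite ger0_norm.
apply/measurable_EFinP; apply: (measurableT_comp mg).
by apply: (measurableT_comp (@normr_measurable R setT)); exact: measurable_tnth.
Qed.

Hypothesis V_mean : forall j, 'E_P1[fun w => tnth (V w) j] = 1.

Lemma env_law_weight_mean j : \int[env_law]_f (weight [::] j f)%:E = 1.
Proof. by rewrite (@integral_env_law_weight id). Qed.

(** Equality in law transfers the sign of [V] to [X] only up to a null set; countably many words and
    letters keep it null. *)
Lemma env_ge0 : {ae P, forall w, forall v j, (0 <= tnth (X v w) j)%R}.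
Proof.
suff h vj : {ae P, forall w, (0 <= tnth (X vj.1 w) vj.2)%R}.
  by apply: ae_imply (ae_forall_count h) => w Xw v j; exact: (Xw (v, j)).
case: vj => v j /=; pose N := (fun t : b.-tuple R => tnth t j) @^-1` `]-oo, 0%R[.
have mN : measurable N.
  by rewrite -[X in measurable X]setTI; exact: (measurable_tnth j).
exists (X v @^-1` N); split.
- by rewrite -[X in measurable X]setTI; exact: measurable_funPT.
- rewrite -[LHS]/(distribution P (X v) N) X_iid.2//.
  rewrite -[LHS]/(P1 (V @^-1` N)) (_ : _ @^-1` _ = set0) ?measure0//.
  by apply/seteqP; split => // w; rewrite /N/= in_itv/= ltNge V_ge0.
- by move=> w /= /negP; rewrite -ltNge /N/= in_itv.
Qed.

End environment_law.

(** * The cascade as a function of its environment *)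

Section cascade_total.
Context d (T : measurableType d) (R : realType) (P : probability T R)
  (b : nat) (b_ge2 : (2 <= b)%N).
Notation Sigma := (seq_space b_ge2).
Variable X : seq 'I_b -> {RV P >-> b.-tuple R}.
Variable nu : probability Sigma R.
Let m := cylinder_mass nu setT.

Lemma path_prodE n (v : n.-tuple 'I_b) (f : @env R b) :
  path_prod v f = (\prod_(k < n) weight (take k v) (tnth v k) f)%R.
Proof.
elim: n v f => [|n ih] v f; first by rewrite tuple0 big_ord0.
case/tupleP: v => j v; rewrite big_ord_recl tnth0 take0 /= ih; congr (_ * _)%R.
by apply: eq_bigr => k _; rewrite tnthS.
Qed.

Lemma prefix_word_size n (x : Sigma) : size (prefix_word x n) == n.
Proof. by rewrite size_mkseq. Qed.

Lemma cascade_densityE n w (x : Sigma) : cascade_density X n w x =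
  (\sum_(v : n.-tuple 'I_b) (\prod_(k < n) tnth (X (take k v) w) (tnth v k))
    * \1_(@cylinder b b_ge2 v) x)%R.
Proof.
rewrite (bigD1 (Tuple (prefix_word_size n x)))//= [X in (_ + X)%R]big1 ?addr0 => [|v vx].
  rewrite indicE mem_set ?mulr1; last by rewrite /cylinder/= (eqP (prefix_word_size n x)).
  rewrite /cascade_density; apply: eq_bigr => k _.
  rewrite take_prefix_word; last exact: ltnW.
  by rewrite (tnth_nth (x k))/= nth_mkseq.
rewrite indicE memNset ?mulr0// /cylinder/= size_tuple => xv.
by move/eqP : vx; apply; apply: val_inj.
Qed.

(** The density is a finite combination of cylinder indicators, hence integrable for every [w],
    whatever the signs of the weights. *)
Lemma cascade_massE n w : cascade_mass X nu n w =
  (\sum_(v : n.-tuple 'I_b) (\prod_(k < n) tnth (X (take k v) w) (tnth v k)) * m v)%:E.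
Proof.
rewrite /cascade_mass; under eq_integral do rewrite cascade_densityE.
have ind v : nu.-integrable setT (EFin \o \1_(@cylinder b b_ge2 v)).
  by apply: integrable_indic; exact: measurable_cylinder.
have [_ ->] := integrable_lincomb
  (fun v : n.-tuple 'I_b => \prod_(k < n) tnth (X (take k v) w) (tnth v k))%R
  (fun v : n.-tuple 'I_b => ind v).
rewrite -sumEFin; apply: eq_bigr => v _.
rewrite integral_indic//; last exact: measurable_cylinder.
by rewrite EFinM /m /cylinder_mass setTI setIT fineK ?fin_num_measure//; exact: measurable_cylinder.
Qed.

Lemma measurable_cascade_Z : measurable_fun setT (cascade_Z X nu).
Proof.
apply: measurable_fun_limn_esup => n; rewrite (funext (cascade_massE n)).
apply/measurable_EFinP; apply: measurable_sum => v; apply: measurable_funM => //.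
apply: measurable_prod => k _.
by apply: (measurableT_comp (measurable_tnth _)); exact: measurable_funPT.
Qed.

Context d1 (T1 : measurableType d1) (P1 : probability T1 R).
Variable V : {RV P1 >-> b.-tuple R}.
Hypothesis X_iid : iid_copies X V.
Hypothesis V_ge0 : forall w j, (0 <= tnth (V w) j)%R.
Hypothesis V_mean : forall j, 'E_P1[fun w => tnth (V w) j] = 1.

Lemma cascade_mass_total :
  {ae P, forall w, forall n, cascade_mass X nu n w = (total n m (env_of X w))%:E}.
Proof.
apply: ae_imply (env_ge0 X_iid V_ge0) => w Xw n; rewrite cascade_massE; congr EFin.
apply: eq_bigr => v _; rewrite mulrC path_prodE; congr (_ * _)%R.
by apply: eq_bigr => k _; rewrite /weight /env_of ger0_norm.
Qed.

Lemma integral_cascade_Z : \int[P]_w cascade_Z X nu w = (limit_mass (env_law X) m)%:E.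
Proof.
have iid := env_law_iid X_iid; have mean := env_law_weight_mean X_iid V_ge0 V_mean.
have mm : mass_fun m by exact: cylinder_mass_fun.
rewrite (limit_massE iid mean mm) (integral_total_limE iid mean mm).
have mG := @measurable_limn_esup_total R b m.
rewrite ge0_integral_env_law//; last first.
  move=> f; apply: le_trans (limn_einf_total_ge0 f mm) _; exact: limn_einf_sup.
apply: ae_eq_integral => //.
- exact: measurable_cascade_Z.
- exact: (measurableT_comp mG (measurable_env_of X)).
- apply: ae_imply cascade_mass_total => w cw _; rewrite /cascade_Z.
  by congr limn_esup; apply/funext.
Qed.

End cascade_total.

(** * Weak convergence to zero *)

Section bounded_below.
Context d (T : measurableType d) (R : realType) (P : probability T R).
Variables (f : T -> R) (c : R).
Hypotheses (mf : measurable_fun setT f) (f_ge : forall x, (- c <= f x)%R).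

Let mEf : measurable_fun setT (EFin \o f).
Proof. exact/measurable_EFinP. Qed.

Let neg_fin : \int[P]_x (EFin \o f)^\- x < +oo.
Proof.
apply: (@le_lt_trans _ _ (\int[P]_x `|c|%:E)); last by rewrite integral_cst_probability ltry.
apply: ge0_le_integral => //.
- exact: measurable_funeneg.
- move=> x _; rewrite funenegE ge_max/= !lee_fin normr_ge0 andbT.
  by rewrite lerNl (le_trans _ (f_ge x))// lerN2 ler_norm.
Qed.

Lemma bounded_below_integral_gtNy : -oo < \int[P]_x (f x)%:E.
Proof.
rewrite -[X in _ < X]/(\int[P]_x (EFin \o f) x) integralE.
have n0 : 0 <= \int[P]_x (EFin \o f)^\- x by exact: integral_ge0.
have -> : \int[P]_x (EFin \o f)^\- x = (fine (\int[P]_x (EFin \o f)^\- x))%:E.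
  by rewrite fineK// ge0_fin_numE.
apply: (@lt_le_trans _ _ (0 - (fine (\int[P]_x (EFin \o f)^\- x))%:E)).
  by rewrite sub0e -EFinN ltNyr.
by apply: leeB => //; exact: integral_ge0.
Qed.

Lemma bounded_below_integrable : \int[P]_x (f x)%:E < +oo ->
  P.-integrable setT (EFin \o f).
Proof.
move=> foo; apply/integrableP; split => //.
rewrite (eq_integral ((EFin \o f)^\+ \+ (EFin \o f)^\-)); last first.
  by move=> x _; rewrite -[RHS]/(((EFin \o f)^\+ \+ (EFin \o f)^\-) x) -fune_abse.
rewrite ge0_integralD//; [|exact: measurable_funepos|exact: measurable_funeneg].
apply: lte_add_pinfty => //.
rewrite ltey; apply/eqP => e; move: foo.
rewrite -[X in X < _]/(\int[P]_x (EFin \o f) x) integralE e.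
by case: (\int[P]_x (EFin \o f)^\- x) neg_fin.
Qed.

End bounded_below.

(** * Vanishing of the weak limit *)

Section singular.
Context d (T : measurableType d) (R : realType) (P : probability T R)
  (b : nat) (b_ge2 : (2 <= b)%N).
Notation Sigma := (seq_space b_ge2).
Variable X : seq 'I_b -> {RV P >-> b.-tuple R}.
Variable nu : probability Sigma R.

Lemma continuous_seq_measurable (f : Sigma -> R) : continuous f -> measurable_fun setT f.
Proof.
move=> cf; apply: (measurability _ (RGenOpens.measurableE R)).
move=> _ [_ [a [c ->] <-]]; rewrite setTI; apply: open_seq_measurable.
by apply: open_comp => [x _|]; [exact: cf|exact: interval_open].
Qed.

Lemma continuous_seq_bounded (f : Sigma -> R) : continuous f ->
  exists2 C : R, (0 <= C)%R & forall x, (`|f x| <= C)%R.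
Proof.
move=> cf; have cT : {within [set: Sigma], continuous f} by exact: continuous_subspaceT.
have [M [_ hM]] := compact_bounded (continuous_compact cT compact_seq_space).
exists (`|M| + 1)%R => [|x]; first by rewrite addr_ge0.
apply: hM; last by exists x.
by rewrite (le_lt_trans (ler_norm M))// ltrDl.
Qed.

Lemma integral_density_le n w (f : Sigma -> R) C :
  (forall v j, (0 <= tnth (X v w) j)%R) -> (0 <= C)%R ->
  measurable_fun setT f -> (forall x, (`|f x| <= C)%R) ->
  `|\int[nu]_x (f x * cascade_density X n w x)%:E| <= C%:E * cascade_mass X nu n w.
Proof.
move=> Xw C0 mf fC.
have d0 x : (0 <= cascade_density X n w x)%R by apply: prodr_ge0.
have md : measurable_fun setT (cascade_density X n w : Sigma -> R).
  rewrite (funext (cascade_densityE X n w)); apply: measurable_sum => v.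
  by apply: measurable_funM => //; apply: measurable_indic; exact: measurable_cylinder.
have mfd : measurable_fun setT (fun x => (f x * cascade_density X n w x)%:E).
  by apply/measurable_EFinP; exact: measurable_funM.
apply: le_trans (le_abse_integral _ measurableT mfd) _.
rewrite /cascade_mass -ge0_integralZl_real//; apply: ge0_le_integral => //.
- exact: measurableT_comp.
- by apply/measurable_EFinP; exact: measurable_funM.
- by move=> x _; rewrite /= lee_fin normrM [X in (_ * X)%R]ger0_norm// ler_wpM2r.
Qed.

(** Continuous functions on the compact sequence space are bounded, so their integrals are at most a
    constant times the total mass. The zero kernel is the limit. *)
Lemma cascade_limit_zero : {ae P, forall w, forall v j, (0 <= tnth (X v w) j)%R} ->
  {ae P, forall w, cascade_mass X nu n w @[n --> \oo] --> 0} -> Q_singular X nu.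
Proof.
move=> X0 mass0; exists (@kzero _ _ T Sigma R : R.-ftker T ~> Sigma); last exact: aeW.
apply: ae_imply2 X0 mass0 => w Xw mw f cf.
rewrite (_ : \int[_]_x (f x)%:E = 0); last exact: integral_measure_zero.
have [C C0 fC] := continuous_seq_bounded cf.
have mf := continuous_seq_measurable cf.
have Cm : C%:E * cascade_mass X nu n w @[n --> \oo] --> 0.
  by rewrite -(mule0 C%:E); apply: cvgeZl.
have NCm : - (C%:E * cascade_mass X nu n w) @[n --> \oo] --> 0.
  by rewrite -oppe0; exact: cvgeN.
apply: squeeze_cvge NCm Cm; apply: nearW => n.
have le := integral_density_le n Xw C0 mf fC; apply/andP; split.
  by rewrite leeNl (le_trans _ le)// -abseN lee_abs.
by rewrite (le_trans (lee_abs _)).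
Qed.

End singular.

Theorem corollary2p14 (R : realType) (b : nat) (b_ge2 : (2 <= b)%N)
    (d1 : measure_display) (T1 : measurableType d1) (P1 : probability T1 R)
    (V : {RV P1 >-> b.-tuple R})
    (V_ge0 : forall (w : T1) (j : 'I_b), (0 <= tnth (V w) j)%R)
    (V_mean : forall j : 'I_b, 'E_P1[fun w => tnth (V w) j] = 1)
    (d : measure_display) (T : measurableType d) (P : probability T R)
    (X : seq 'I_b -> {RV P >-> b.-tuple R})
    (X_iid : iid_copies X V)
    (nu : probability (seq_space b_ge2) R)
    (nu_ergodic : ergodic (@left_shift b b_ge2) nu) :
  (cascade_entropy V nu < (entropy nu)%:E -> Q_regular X nu) /\
  ((entropy nu)%:E < cascade_entropy V nu ->
     \int[P]_w cascade_Z X nu w = 0 /\ Q_singular X nu).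
Proof.
have iid := env_law_iid X_iid.
have mean := env_law_weight_mean X_iid V_ge0 V_mean.
set Pi := env_law X in iid mean.
pose m := cylinder_mass nu setT.
have mm : mass_fun m by exact: cylinder_mass_fun.
have m1 : m [::] = 1%R by rewrite /m cylinder_mass_nil probability_setT.
have m_inv : shift_invariant m by exact: shift_invariant_cylinder_mass nu_ergodic.1.
pose E j := \int[Pi]_f (xlnx (weight [::] j f))%:E.
have hVE : cascade_entropy V nu = \sum_j E j * (m [:: j])%:E.
  apply: eq_bigr => j _; rewrite /E /Pi.
  rewrite (integral_env_law_weight X_iid V_ge0 j (@measurable_xlnx R)); congr (_ * _).
  by rewrite /m cylinder_massT fineK// fin_num_measure//; exact: measurable_cylinder.
have dich := cascade_zero_one iid mean nu_ergodic.
rewrite hVE entropyE -/m; split=> [hVh|hhV].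
  case: dich => [reg|sing]; first by rewrite /Q_regular (integral_cascade_Z nu X_iid V_ge0 V_mean) reg.
  (* In the degenerate alternative [singular_entropy_le] contradicts the hypothesis, once the means
     of letters of positive mass are known to be finite. *)
  exfalso.
  have mx j : @measurable_fun _ _ (@envT R b) R setT (fun f => xlnx (weight [::] j f)).
    exact: measurableT_comp (@measurable_xlnx R) (@measurable_weight R b [::] j).
  have x_ge j (f : @envT R b) : (- 1 <= xlnx (weight [::] j f))%R.
    by apply: le_trans (xlnx_ge (weight_ge0 _ _ _)); rewrite lerBrDr addNr weight_ge0.
  have ENy j : -oo < E j := bounded_below_integral_gtNy Pi (mx j) (x_ge j).
  (* No mean is [-oo], so an infinite one with positive mass would make the whole sum infinite,
     against [hVh]. *)
  have Eoo j : (0 < m [:: j])%R -> E j < +oo.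
    move=> mj; rewrite ltey; apply/eqP => Ej.
    suff e : \sum_j E j * (m [:: j])%:E = +oo by move: hVh; rewrite e.
    apply/esum_eqyP => [i _|]; last first.
      by exists j; rewrite mem_index_enum Ej gt0_mulye// lte_fin.
    move: (ENy i) ; case: (E i) => // [_].
    have := mm.1 [:: i]; rewrite le_eqVlt => /predU1P[<-|mi]; first by rewrite mule0.
    by rewrite gt0_mulye// lte_fin.
  have xi j : (0 < m [:: j])%R -> Pi.-integrable setT (EFin \o (fun f => xlnx (weight [::] j f))).
    by move=> mj; apply: bounded_below_integrable (x_ge j) (Eoo j mj); exact: mx.
  have xE j : (0 < m [:: j])%R -> E j = (fine (E j))%:E.
    by move=> mj; rewrite fineK// (integrable_fin_num measurableT (xi j mj)).
  have := singular_entropy_le iid mean mm m1 m_inv xi xE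
    (integral_sqrt_total_small iid mean mm m1 sing).
  rewrite leNgt => /negP; apply; rewrite -lte_fin; apply: le_lt_trans hVh.
  rewrite -sumEFin; apply: lee_sum => j _.
  have := mm.1 [:: j]; rewrite le_eqVlt => /predU1P[<-|mj]; first by rewrite mule0 mul0r.
  by rewrite (xE _ mj) -EFinM mulrC.
case: dich => [reg|sing].
  have := regular_entropy_le iid mean mm m1 m_inv reg.
  by rewrite leNgt hhV.
have lm0 : limit_mass Pi m = 0%R.
  apply: EFin_inj; rewrite (limit_massE iid mean mm).
  rewrite (@ae_eq_integral _ (@envT R b) R Pi setT (cst 0)) ?integral0//.
    by apply/measurable_EFinP; exact: measurable_total_lim.
  by apply: ae_imply sing => f f0 _; rewrite f0.
split; first by rewrite (integral_cascade_Z nu X_iid V_ge0 V_mean) -/Pi -/m lm0.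
apply: cascade_limit_zero; first exact: env_ge0 X_iid V_ge0.
have cv : {ae Pi, forall f, (total n m f)%:E @[n --> \oo] --> 0}.
  apply: ae_imply2 (total_cvg iid mean mm) sing => f h e; rewrite e in h.
  by apply: cvg_EFin => //; exact: nearW.
apply: ae_imply2 (ae_env_law cv) (cascade_mass_total nu X_iid V_ge0) => w tw cw.
by rewrite (funext cw).
Qed.
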